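(* Let $M$ be a manifold of bounded geometry and $E\to M$ a vector bundle of bounded geometry. Then $\mathcal U^*_{-\infty}(E)$ (with the operator norm of $\mathfrak B(L^2(E))$) is a local $C^*$-algebra.
   Context: A Riemannian manifold $M$ (without boundary) has bounded geometry if its injectivity radius is bounded below by a positive constant and its curvature tensor and all its covariant derivatives are bounded. A vector bundle of bounded geometry is a complex vector bundle with Hermitian metric and compatible connection whose curvature tensor and all its covariant derivatives are bounded. $H^k(E)$, $k\in\mathbb Z$, are the $L^2$-Sobolev spaces (for $k\ge0$ the completion of $C_c^\infty(E)$ in $\|s\|_{H^k}^2=\sum_{i=0}^k\int_M\|\nabla^is\|^2$; $H^{-k}(E)$ the dual of $H^k(E)$), $H^\infty(E)=\bigcap_kH^k(E)$, $H^{-\infty}_\iota(E)=\varinjlim H^{-k}(E)$. A smoothing operator is a continuous linear map $H^{-\infty}_\iota(E)\to H^\infty(E)$; equivalently it is bounded $H^{-k}(E)\to H^l(E)$ for all $k,l\in\mathbb N$. For $L\subset M$ let $\|u\|_{H^s,L}=\inf\{\|u'\|_{H^s}: u'=u\text{ on a neighbourhood of }L\}$. A continuous operator $A:H^r(E)\to H^s(E)$ is quasilocal if there is $\mu:\mathbb R_{>0}\to\mathbb R_{\ge0}$ with $\mu(R)\to0$ as $R\to\infty$ and $\|Au\|_{H^s,M-B_R(L)}\le\mu(R)\|u\|_{H^r}$ for all $L\subset M$ and all $u\in H^r(E)$ with $\operatorname{supp}u\subset L$. A smoothing operator is quasilocal if it is quasilocal as an operator $H^{-k}(E)\to H^l(E)$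 for all $k,l\in\mathbb N$. $\mathcal U^*_{-\infty}(E)\subset\mathfrak B(L^2(E))$ is the $*$-algebra of all quasilocal smoothing operators $A$ whose adjoint $A^*$ is also a quasilocal smoothing operator. A normed $*$-algebra $A$ is a local $C^*$-algebra if its completion $\overline A$ is a $C^*$-algebra, $A$ is closed under holomorphic functional calculus (for all $a\in A$ and all $f$ holomorphic on a neighbourhood of the spectrum of $a$ in $\overline A$, with $f(0)=0$ if $A$ has no unit, $f(a)\in A$), and all matrix algebras over $A$ are also closed under holomorphic functional calculus. *)

(* Defs.v *)
From HB Require Import structures.
From mathcomp Require Import all_boot all_order all_algebra.
From mathcomp Require Import all_classical all_reals all_analysis.
From mathcomp Require Import complex.
Set Implicit Arguments.
Unset Strict Implicit.
Unset Printing Implicit Defensive.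
Import Order.TTheory GRing.Theory Num.Theory numFieldNormedType.Exports.
Local Open Scope classical_set_scope.
Local Open Scope ring_scope.

Section SmoothMaps.
Context {R : realType}.

Definition iterated_derive (V W : normedModType R) (vs : seq V) (f : V -> W) :
    V -> W :=
  foldr (fun v g => 'D_v g) f vs.

(* For finite-dimensional [V] and open [O] this is smoothness on [O]: all
   iterated directional derivatives exist and are continuous. *)
Definition smooth_on (V W : normedModType R) (O : set V) (f : V -> W) : Prop :=
  forall vs x, O x ->
    {for x, continuous (iterated_derive vs f)} /\
    forall v, derivable (iterated_derive vs f) x v.

End SmoothMaps.

Record chart (R : realType) (n : nat) (T : topologicalType) := Chart {
  cdom : set T;
  cmap : T -> 'rV[R]_n;
  cinv : 'rV[R]_n -> T }.

Definition cimg (R : realType) n (T : topologicalType) (c : chart R n T) :=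
  cmap c @` cdom c.

Definition is_chart (R : realType) n (T : topologicalType)
    (c : chart R n T) : Prop :=
  [/\ open (cdom c),
      open (cimg c),
      forall x, cdom c x -> cinv c (cmap c x) = x,
      forall x, cdom c x -> {for x, continuous (cmap c)} &
      forall y, cimg c y -> {for y, continuous (cinv c)}].

Definition smooth_transition (R : realType) n (T : topologicalType)
    (c d : chart R n T) : Prop :=
  smooth_on (cmap c @` (cdom c `&` cdom d)) (cmap d \o cinv c).

Definition compatible (R : realType) n (T : topologicalType)
    (c d : chart R n T) : Prop :=
  smooth_transition c d /\ smooth_transition d c.

Record manifold (R : realType) (n : nat) := Manifold {
  points :> topologicalType;
  atlas : set (chart R n points);
  manifold_hausdorff : hausdorff_space points;
  manifold_second_countable : @second_countable points;
  atlas_chart : forall c, atlas c -> is_chart c;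
  atlas_cover : forall x, exists2 c, atlas c & cdom c x;
  atlas_compatible : forall c d, atlas c -> atlas d -> compatible c d }.

(* Tangent vectors at [x] are the derivations at [x] of the algebra of smooth
   functions; as functions on all of [M -> R], they vanish on the non-smooth
   ones, so that two of them are equal iff they are equal as derivations. *)
Definition tvector (R : realType) n (M : manifold R n) : Type :=
  (M -> R^o) -> R^o.
HB.instance Definition _ (R : realType) n (M : manifold R n) :=
  GRing.Lmodule.on (tvector M).

Definition vfield (R : realType) n (M : manifold R n) : Type := M -> tvector M.
HB.instance Definition _ (R : realType) n (M : manifold R n) :=
  GRing.Lmodule.on (vfield M).

Section Manifolds.
Context {R : realType} {n : nat} {M : manifold R n}.
Local Notation C := R[i].
Implicit Types (x : M) (f : M -> R^o) (X Y : vfield M).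

Definition smoothM_on (W : set M) f : Prop :=
  forall c, atlas c -> smooth_on (cmap c @` (cdom c `&` W)) (f \o cinv c).

Definition smoothM f : Prop := smoothM_on setT f.

Definition csmoothM_on (W : set M) (f : M -> C) : Prop :=
  smoothM_on W (fun x => complex.Re (f x)) /\
  smoothM_on W (fun x => complex.Im (f x)).

Definition csmoothM (f : M -> C) : Prop := csmoothM_on setT f.

Definition tangent x (v : tvector M) : Prop :=
  [/\ forall f, ~ smoothM f -> v f = 0,
      forall (a : R) f f', smoothM f -> smoothM f' ->
        v (fun y => a * f y + f' y) = a * v f + v f' &
      forall f f', smoothM f -> smoothM f' ->
        v (fun y => f y * f' y) = f x * v f' + v f * f' x].

Definition smooth_vfield X : Prop :=
  (forall x, tangent x (X x)) /\
  forall f, smoothM f -> smoothM (fun x => X x f).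

Definition bracket X Y : vfield M :=
  fun x f => X x (fun y => Y y f) - Y x (fun y => X y f).

Definition cderiv (v : tvector M) (f : M -> C) : C :=
  Complex (v (fun x => complex.Re (f x))) (v (fun x => complex.Im (f x))).

(* the image of the vector [w] at [a] under the differential of [e] *)
Definition pushforward (V : normedModType R) (e : V -> M) (a w : V) :
    tvector M :=
  fun f => if `[< smoothM f >] then 'D_w (f \o e) a else 0.

Definition velocity (gamma : R^o -> M) (t : R) : tvector M :=
  pushforward gamma (t : R^o) (1 : R^o).

Definition cc_fun f : Prop :=
  continuous f /\ compact (closure [set x | f x != 0]).

End Manifolds.

Section IteratedIntegral.
Context {R : realType}.

Fixpoint integral_Rn (n : nat) : ('rV[R]_n -> R) -> R :=
  match n with
  | 0 => fun f => f 0
  | n'.+1 => fun f =>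
      (\int[lebesgue_measure]_t
         integral_Rn (fun v : 'rV[R]_n' =>
           f (row_mx (const_mx t : 'rV[R]_1) v)))%R
  end.

End IteratedIntegral.

Section Metric.
Context {R : realType} {n : nat} {M : manifold R n}.
Variable g : M -> tvector M -> tvector M -> R.
Implicit Types (x : M) (f : M -> R^o) (X Y Z : vfield M).

Definition is_metric : Prop :=
  [/\ forall x (a : R) u v w, tangent x u -> tangent x v -> tangent x w ->
        g x (a *: u + v) w = a * g x u w + g x v w,
      forall x u v, tangent x u -> tangent x v -> g x u v = g x v u,
      forall x u, tangent x u -> u <> 0 -> 0 < g x u u &
      forall X Y, smooth_vfield X -> smooth_vfield Y ->
        smoothM (fun x => g x (X x) (Y x))].

Definition is_levi_civita (D : vfield M -> vfield M -> vfield M) : Prop :=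
  (forall X Y, smooth_vfield X -> smooth_vfield Y -> smooth_vfield (D X Y)) /\
  (forall f X Y Z,
     smoothM f -> smooth_vfield X -> smooth_vfield Y -> smooth_vfield Z ->
     D (fun x => f x *: X x + Y x) Z = (fun x => f x *: D X Z x + D Y Z x)) /\
  (forall f X Y Z,
     smoothM f -> smooth_vfield X -> smooth_vfield Y -> smooth_vfield Z ->
     D X (fun x => f x *: Y x + Z x) =
     (fun x => f x *: D X Y x + X x f *: Y x + D X Z x)) /\
  (forall X Y, smooth_vfield X -> smooth_vfield Y ->
     D X Y - D Y X = bracket X Y) /\
  (forall X Y Z x, smooth_vfield X -> smooth_vfield Y -> smooth_vfield Z ->
     X x (fun y => g y (Y y) (Z y)) =
     g x (D X Y x) (Z x) + g x (Y x) (D X Z x)).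

Definition volume_density (c : chart R n M) (y : 'rV[R]_n) : R :=
  Num.sqrt (\det (\matrix_(i < n, j < n)
    g (cinv c y) (pushforward (cinv c) y (delta_mx 0 i))
                 (pushforward (cinv c) y (delta_mx 0 j)))).

(* The Riemannian volume, as a positive linear functional on the continuous
   functions with compact support (a Radon measure). *)
Definition is_volume (I : (M -> R^o) -> R) : Prop :=
  [/\ forall (a : R) f f', cc_fun f -> cc_fun f' ->
        I (fun x => a * f x + f' x) = a * I f + I f',
      forall f, cc_fun f -> (forall x, 0 <= f x) -> 0 <= I f &
      forall c f, atlas c -> cc_fun f ->
        closure [set x | f x != 0] `<=` cdom c ->
        I f = integral_Rn (fun y => if `[< cimg c y >]
          then f (cinv c y) * volume_density c y else 0)].

End Metric.

(* The Levi-Civita connection and the volume are determined by the metric. *)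
Record riemannian (R : realType) (n : nat) (M : manifold R n) := Riemannian {
  metric : M -> tvector M -> tvector M -> R;
  lc : vfield M -> vfield M -> vfield M;
  vol : (M -> R^o) -> R;
  metricP : is_metric metric;
  lcP : is_levi_civita metric lc;
  volP : is_volume metric vol }.

Section Riemannian.
Context {R : realType} {n : nat} {M : manifold R n} (g : riemannian M).
Local Notation C := R[i].
Implicit Types (x y p : M) (X Y : vfield M) (L : set M).

Definition speed (gamma : R^o -> M) (t : R) : R :=
  Num.sqrt (metric g (gamma t) (velocity gamma t) (velocity gamma t)).

(* a curve that is smooth on a neighbourhood of [0, 1] *)
Definition smooth_curve (gamma : R^o -> M) : Prop :=
  exists2 e : R, 0 < e & forall f, smoothM f ->
    smooth_on [set t : R^o | - e < t < 1 + e] (f \o gamma).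

Definition curve_length (gamma : R^o -> M) : \bar R :=
  (\int[lebesgue_measure]_(t in `[0%R, 1%R]) (speed gamma t)%:E)%E.

(* a piecewise smooth path, as the list of its smooth pieces *)
Fixpoint path_joins x (pieces : seq (R^o -> M)) y : Prop :=
  match pieces with
  | [::] => x = y
  | gamma :: pieces' =>
      [/\ smooth_curve gamma, gamma 0 = x & path_joins (gamma 1) pieces' y]
  end.

Definition rdist x y : \bar R :=
  ereal_inf [set l | exists2 pieces, path_joins x pieces y &
                     l = (\sum_(gamma <- pieces) curve_length gamma)%E].

Definition nbhd_of L (r : R) : set M :=
  [set x | exists2 y, L y & (rdist y x < r%:E)%E].

(* The geodesic equation at the parameter [t], tested on functions:
   [(f o gamma)'' = Hess f (gamma', gamma') + df (D/dt gamma')] and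
   [Hess f (X, X) = X (X f) - (nabla_X X) f]. *)
Definition geodesic_at (gamma : R^o -> M) (t : R) : Prop :=
  forall f X, smoothM f -> smooth_vfield X -> X (gamma t) = velocity gamma t ->
    'D_1 ('D_1 (f \o gamma)) (t : R^o) =
    X (gamma t) (fun y => X y f) - lc g X X (gamma t) f.

Definition orthonormal_basis x (b : 'I_n -> tvector M) : Prop :=
  (forall i, tangent x (b i)) /\
  forall i j, metric g x (b i) (b j) = (i == j)%:R.

Definition eball (r : R) : set 'rV[R]_n :=
  [set v | \sum_i v 0 i ^+ 2 < r ^+ 2].

(* [cinv c] is the exponential map at [p], read in the orthonormal basis [b] of
   the tangent space, and is a diffeomorphism from the ball of radius [r] onto
   an open subset of [M]. *)
Definition exp_chart p (b : 'I_n -> tvector M) (r : R) (c : chart R n M) :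
    Prop :=
  [/\ is_chart c /\ (forall d, atlas d -> compatible c d),
      cimg c = eball r,
      cinv c 0 = p,
      forall v : 'rV[R]_n,
        velocity (fun t : R^o => cinv c (t *: v)) 0 =
        \sum_i v 0 i *: b i &
      forall (v : 'rV[R]_n) (t : R), eball r (t *: v) ->
        geodesic_at (fun t : R^o => cinv c (t *: v)) t].

Definition injectivity_radius p : \bar R :=
  ereal_sup [set r%:E | r in [set r : R | 0 < r /\
    exists b c, orthonormal_basis p b /\ exp_chart p b r c]].

End Riemannian.

Section Connections.
Context {R : realType} {n : nat} {M : manifold R n} (g : riemannian M).
Variables (W : zmodType) (D : vfield M -> W -> W).
Implicit Types (X Y : vfield M) (Xs Ys : seq (vfield M)) (s : W).

(* In the covariant derivatives of a tensor below, the direction of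
   differentiation is the first argument. *)

Fixpoint nabla_iter (k : nat) s Xs : W :=
  match k, Xs with
  | 0, _ => s
  | k'.+1, X :: Ys =>
      D X (nabla_iter k' s Ys) -
      \sum_(j < size Ys)
        nabla_iter k' s (set_nth 0 Ys j (lc g X (nth 0 Ys j)))
  | _.+1, [::] => 0
  end.

Definition curvature Xs s : W :=
  match Xs with
  | [:: X; Y] => D X (D Y s) - D Y (D X s) - D (bracket X Y) s
  | _ => 0
  end.

(* the [k]-th covariant derivative of the curvature, with [k + 2] arguments *)
Fixpoint nabla_curvature (k : nat) Xs s : W :=
  match k, Xs with
  | 0, _ => curvature Xs s
  | k'.+1, X :: Ys =>
      D X (nabla_curvature k' Ys s) - nabla_curvature k' Ys (D X s) -
      \sum_(j < size Ys)
        nabla_curvature k' (set_nth 0 Ys j (lc g X (nth 0 Ys j))) s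
  | _.+1, [::] => 0
  end.

(* [smooth] singles out the smooth sections, and [sqn s x] is [|s(x)|^2]. *)
Definition bounded_curvature (smooth : set W) (sqn : W -> M -> R) : Prop :=
  forall k, exists B : R, forall Xs s x,
    size Xs = k.+2 ->
    (forall i, (i < k.+2)%N ->
       smooth_vfield (nth 0 Xs i) /\
       metric g x (nth 0 Xs i x) (nth 0 Xs i x) <= 1) ->
    smooth s -> sqn s x <= 1 ->
    sqn (nabla_curvature k Xs s) x <= B.

End Connections.

Definition bounded_geometry (R : realType) n (M : manifold R n)
    (g : riemannian M) : Prop :=
  (exists2 r : R, 0 < r & forall p, (r%:E <= injectivity_radius g p)%E) /\
  bounded_curvature g (lc g) (@smooth_vfield R n M)
    (fun Z x => metric g x (Z x) (Z x)).

Definition section (R : realType) n (M : manifold R n)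
  (F : M -> lmodType R[i]) : Type := forall x, F x.

Section SectionModule.
Context {R : realType} {n : nat} {M : manifold R n} (F : M -> lmodType R[i]).
Local Notation S := (section F).

HB.instance Definition _ := gen_eqMixin S.
HB.instance Definition _ := gen_choiceMixin S.

Let add (s t : S) : S := fun x => s x + t x.
Let zero : S := fun=> 0.
Let opp (s : S) : S := fun x => - s x.
Let scale (a : R[i]) (s : S) : S := fun x => a *: s x.

Let addA : associative add.
Proof. by move=> s t u; apply: functional_extensionality_dep => x; exact: addrA. Qed.
Let addC : commutative add.
Proof. by move=> s t; apply: functional_extensionality_dep => x; exact: addrC. Qed.
Let add0 : left_id zero add.
Proof. by move=> s; apply: functional_extensionality_dep => x; exact: add0r. Qed.
Let addN : left_inverse zero opp add.
Proof. by move=> s; apply: functional_extensionality_dep => x; exact: addNr. Qed.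

HB.instance Definition _ := GRing.isZmodule.Build S addA addC add0 addN.

Let scaleA a b (s : S) : scale a (scale b s) = scale (a * b) s.
Proof. by apply: functional_extensionality_dep => x; exact: scalerA. Qed.
Let scale1 : left_id 1 scale.
Proof. by move=> s; apply: functional_extensionality_dep => x; exact: scale1r. Qed.
Let scaleDr : right_distributive scale +%R.
Proof. by move=> a s t; apply: functional_extensionality_dep => x; exact: scalerDr. Qed.
Let scaleDl (s : S) : {morph scale^~ s : a b / a + b}.
Proof. by move=> a b; apply: functional_extensionality_dep => x; exact: scalerDl. Qed.

HB.instance Definition _ :=
  GRing.Zmodule_isLmodule.Build R[i] S scaleA scale1 scaleDr scaleDl.

End SectionModule.

(* a local trivialization of rank [r]; only the fibres over [tdom] matter *)
Record trivialization (R : realType) n (M : manifold R n)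
    (F : M -> lmodType R[i]) (r : nat) := Trivialization {
  tdom : set M;
  tmap : forall x, F x -> 'rV[R[i]]_r;
  tinv : forall x, 'rV[R[i]]_r -> F x }.

Section BundleAxioms.
Context {R : realType} {n : nat} {M : manifold R n} {r : nat}.
Variable F : M -> lmodType R[i].
Local Notation C := R[i].
Local Notation triv := (trivialization F r).
Local Notation S := (section F).

Definition is_trivialization (tau : triv) : Prop :=
  [/\ open (tdom tau),
      forall x, tdom tau x -> linear (@tmap _ _ _ _ _ tau x) &
      forall x, tdom tau x ->
        cancel (@tmap _ _ _ _ _ tau x) (@tinv _ _ _ _ _ tau x) /\
        cancel (@tinv _ _ _ _ _ tau x) (@tmap _ _ _ _ _ tau x)].

Definition smooth_change (tau tau' : triv) : Prop :=
  forall (v : 'rV[C]_r) j,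
    csmoothM_on (tdom tau `&` tdom tau')
      (fun x => tmap tau' (tinv tau x v) 0 j).

Definition is_bundle (A : set triv) : Prop :=
  [/\ forall tau, A tau -> is_trivialization tau,
      forall x, exists2 tau, A tau & tdom tau x &
      forall tau tau', A tau -> A tau' -> smooth_change tau tau'].

Definition smooth_section_for (A : set triv) (s : S) : Prop :=
  forall tau, A tau -> forall j,
    csmoothM_on (tdom tau) (fun x => tmap tau (s x) 0 j).

Variable A : set triv.
Local Notation smooth := (smooth_section_for A).

Definition is_hermitian_metric (h : forall x, F x -> F x -> C) : Prop :=
  [/\ forall x a (u v w : F x), h x (a *: u + v) w = a * h x u w + h x v w,
      forall x (u v : F x), h x v u = (h x u v)^*%C,
      forall x (u : F x), u != 0 -> 0 < h x u u &
      forall s t, smooth s -> smooth t -> csmoothM (fun x => h x (s x) (t x))].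

Definition is_connection (D : vfield M -> S -> S) : Prop :=
  [/\ forall X s, smooth_vfield X -> smooth s -> smooth (D X s),
      forall f X Y s,
        smoothM f -> smooth_vfield X -> smooth_vfield Y -> smooth s ->
        D (fun x => f x *: X x + Y x) s =
        (fun x => (f x)%:C%C *: D X s x + D Y s x) &
      forall f X s t,
        csmoothM f -> smooth_vfield X -> smooth s -> smooth t ->
        D X (fun x => f x *: s x + t x) =
        (fun x => f x *: D X s x + cderiv (X x) f *: s x + D X t x)].

Definition is_metric_connection (h : forall x, F x -> F x -> C)
    (D : vfield M -> S -> S) : Prop :=
  forall X s t x, smooth_vfield X -> smooth s -> smooth t ->
    cderiv (X x) (fun y => h y (s y) (t y)) =
    h x (D X s x) (t x) + h x (s x) (D X t x).

End BundleAxioms.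

Record hermitian_bundle (R : realType) n (M : manifold R n) (r : nat) :=
  HermitianBundle {
  fibre :> M -> lmodType R[i];
  trivializations : set (trivialization fibre r);
  hmetric : forall x, fibre x -> fibre x -> R[i];
  nabla : vfield M -> section fibre -> section fibre;
  bundleP : is_bundle trivializations;
  hmetricP : is_hermitian_metric trivializations hmetric;
  nablaP : is_connection trivializations nabla;
  nabla_hmetricP : is_metric_connection trivializations hmetric nabla }.

Section Bundles.
Context {R : realType} {n : nat} {M : manifold R n} {r : nat}.
Variable E : hermitian_bundle M r.

Definition smooth_section (s : section E) : Prop :=
  smooth_section_for (@trivializations _ _ _ _ E) s.

Definition sqnorm (s : section E) (x : M) : R :=
  complex.Re (hmetric (s x) (s x)).

Definition test_section (s : section E) : Prop :=
  smooth_section s /\ compact (closure [set x | s x != 0]).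

Definition test : Type := {s : section E | test_section s}.

End Bundles.

Definition bounded_geometry_bundle (R : realType) n (M : manifold R n) r
    (g : riemannian M) (E : hermitian_bundle M r) : Prop :=
  bounded_curvature g (@nabla _ _ _ _ E) (@smooth_section _ _ _ _ E)
    (@sqnorm _ _ _ _ E).

(* Distributions, among which all the Sobolev spaces are realized, are
   functionals on the test sections. A section [s] acts as
   [phi |-> \int_M <s, phi>], hence the conjugate-linearity of the elements of
   the Sobolev spaces. *)
Definition dsection (R : realType) n (M : manifold R n) r
  (E : hermitian_bundle M r) : Type := test E -> R[i]^o.
HB.instance Definition _ (R : realType) n (M : manifold R n) r
    (E : hermitian_bundle M r) :=
  GRing.Lmodule.on (dsection E).

Section Sobolev.
Context {R : realType} {n : nat} {M : manifold R n} (g : riemannian M).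
Context {r : nat} (E : hermitian_bundle M r).
Local Notation C := R[i].
Local Notation dist := (dsection E).
Implicit Types (u v : dist) (s t : section E) (phi psi : test E) (L : set M).

Definition conj_linear u : Prop :=
  forall (a : C) phi psi chi, sval chi = a *: sval phi + sval psi ->
    u chi = (a^*)%C * u phi + u psi.

(* the upper integral of [f >= 0]; it is [vol g f] for [f] continuous with
   compact support *)
Definition upper_integral (f : M -> R) : \bar R :=
  ereal_inf [set (vol g h)%:E | h in [set h | cc_fun h /\ forall x, f x <= h x]].

Definition l2_pairing s t : C :=
  let h x := hmetric (s x) (t x) in
  Complex (vol g (fun x => complex.Re (h x))) (vol g (fun x => complex.Im (h x))).

(* [|nabla^i s|^2] at [x], computed in an arbitrarily chosen orthonormal frame *)
Definition sqnorm_nabla (i : nat) s (x : M) : R :=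
  let X := xget (fun=> 0) [set X : 'I_n -> vfield M |
    (forall j, smooth_vfield (X j)) /\
    orthonormal_basis g x (fun j => X j x)] in
  \sum_(m : i.-tuple 'I_n)
    sqnorm (nabla_iter g (@nabla _ _ _ _ E) i s [seq X j | j <- m]) x.

Definition test_norm (k : nat) s : \bar R :=
  ((\sum_(0 <= i < k.+1) upper_integral (sqnorm_nabla i s)) `^ 2^-1)%E.

(* [H^k] for [k >= 0] is the completion of the test sections: its elements are
   the limits, as distributions, of the sequences of test sections that are
   Cauchy for [test_norm k]. *)
Definition approximates (k : nat) (phi : nat -> test E) u : Prop :=
  (forall e : R, 0 < e -> exists N, forall i j, (N <= i)%N -> (N <= j)%N ->
     (test_norm k (sval (phi i) - sval (phi j))%R < e%:E)%E) /\
  forall psi, l2_pairing (sval (phi i)) (sval psi) @[i --> \oo] --> u psi.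

Definition completion_norm (k : nat) u : \bar R :=
  ereal_inf [set l | exists2 phi, approximates k phi u &
                     test_norm k (sval (phi i)) @[i --> \oo] --> l].

Definition dual_norm (k : nat) u : \bar R :=
  ereal_inf [set B%:E | B in [set B : R | 0 <= B /\
    forall phi, ((Normc.normc (u phi))%:E <=
                 B%:E * test_norm k (sval phi))%E]].

Definition sobolev_norm (k : int) u : \bar R :=
  match k with
  | Posz k => completion_norm k u
  | Negz k => dual_norm k.+1 u
  end.

Definition sobolev (k : int) : set dist :=
  [set u | conj_linear u /\ (sobolev_norm k u < +oo)%E].

Definition equal_on (O : set M) u v : Prop :=
  forall phi, closure [set x | sval phi x != 0] `<=` O -> u phi = v phi.

Definition supp u : set M :=
  [set x | forall O, open O -> O x -> ~ equal_on O u 0].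

Definition local_norm (k : int) u L : \bar R :=
  ereal_inf [set sobolev_norm k u' | u' in [set u' | sobolev k u' /\
    exists O, [/\ open O, L `<=` O & equal_on O u' u]]].

(* operators from [H^k] to [H^l]; their values outside [H^k] are irrelevant *)
Definition bounded_operator (k l : int) (A : dist -> dist) : Prop :=
  [/\ forall u, sobolev k u -> sobolev l (A u),
      forall (a : C) u v, sobolev k u -> sobolev k v ->
        A (a *: u + v) = a *: A u + A v &
      exists2 B : R, 0 <= B &
        forall u, sobolev k u ->
          (sobolev_norm l (A u) <= B%:E * sobolev_norm k u)%E].

Definition quasilocal (k l : int) (A : dist -> dist) : Prop :=
  exists mu : R -> R,
    [/\ forall rho, 0 < rho -> 0 <= mu rho,
        mu rho @[rho --> +oo%R] --> (0 : R) &
        forall rho L u, 0 < rho -> sobolev k u -> supp u `<=` L ->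
          (local_norm l (A u) (~` nbhd_of g L rho) <=
           (mu rho)%:E * sobolev_norm k u)%E].

Definition quasilocal_smoothing (A : dist -> dist) : Prop :=
  forall k l : nat,
    bounded_operator (- k%:Z) l A /\ quasilocal (- k%:Z) l A.

(* The bounded operators on [L^2], extended by zero outside [L^2]. *)
Definition l2_operator : set (dist -> dist) :=
  [set T | bounded_operator 0 0 T /\ forall u, ~ sobolev 0 u -> T u = 0].

Definition opnorm (T : dist -> dist) : R :=
  inf [set B : R | 0 <= B /\ forall u, sobolev 0 u ->
    (sobolev_norm 0 (T u) <= B%:E * sobolev_norm 0 u)%E].

Definition of_test phi : dist := fun psi => l2_pairing (sval phi) (sval psi).

(* By density of the test sections, it suffices to test the adjunction on
   them: [T (of_test phi) psi] is [<T phi, psi>]. *)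
Definition is_adjoint (T S : dist -> dist) : Prop :=
  forall phi psi, T (of_test phi) psi = ((S (of_test psi) phi)^*)%C.

Definition adjoint (T : dist -> dist) : dist -> dist :=
  xget 0 [set S | l2_operator S /\ is_adjoint T S].

Definition l2_smoothing (T : dist -> dist) : Prop :=
  exists2 A, quasilocal_smoothing A & forall u, sobolev 0 u -> A u = T u.

Definition Ustar : set (dist -> dist) :=
  [set T | [/\ l2_operator T, l2_smoothing T &
    exists S, [/\ l2_operator S, is_adjoint T S & l2_smoothing S]]].

End Sobolev.

Arguments opnorm {R n M} g {r} E T.
Arguments adjoint {R n M} g {r} E T.
Arguments Ustar {R n M} g {r} E.

Section LocalCstar.
Context {R : realType}.
Local Notation C := R[i].

Section Calculus.
Variables (X : lmodType C) (mul : X -> X -> X) (norm : X -> R).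
Implicit Types (a b e : X) (A : set X) (U : set C^o).

Definition is_unit_of A e : Prop :=
  A e /\ forall a, A a -> mul e a = a /\ mul a e = a.

Definition has_unit A : Prop := exists e, is_unit_of A e.

Definition spectrum e a : set C^o :=
  [set z | ~ exists b, mul b (z *: e - a) = e /\ mul (z *: e - a) b = e].

Definition holomorphic_on U (f : C^o -> C^o) : Prop :=
  forall z, U z -> derivable f z 1.

Definition cvg_compact U (F : nat -> C^o -> C^o) (f : C^o -> C^o) : Prop :=
  forall K : set C^o, compact K -> K `<=` U ->
  forall eps : R, 0 < eps -> exists N, forall i, (N <= i)%N ->
  forall z, K z -> Normc.normc (F i z - f z) < eps.

(* The holomorphic functional calculus [f |-> f(a)] is the unique continuous
   unital homomorphism from the algebra of holomorphic functions on a
   neighbourhood [U] of the spectrum of [a] that sends [z] to [a]. *)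
Definition is_calculus e a U (Phi : (C^o -> C^o) -> X) : Prop :=
  [/\ Phi (fun=> 1) = e /\ Phi id = a,
      forall (c : C) f f', holomorphic_on U f -> holomorphic_on U f' ->
        Phi (fun z => c * f z + f' z) = c *: Phi f + Phi f',
      forall f f', holomorphic_on U f -> holomorphic_on U f' ->
        Phi (fun z => f z * f' z) = mul (Phi f) (Phi f') &
      forall F f, (forall i, holomorphic_on U (F i)) -> holomorphic_on U f ->
        cvg_compact U F f -> norm (Phi (F i) - Phi f) @[i --> \oo] --> (0 : R)].

(* [e] is the unit of the ambient algebra *)
Definition closed_calculus_in e A : Prop :=
  forall a U Phi f,
    A a -> open U -> spectrum e a `<=` U -> is_calculus e a U Phi ->
    holomorphic_on U f -> (~ has_unit A -> U 0 /\ f 0 = 0) -> A (Phi f).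

End Calculus.

Section Unitization.
Variables (X : lmodType C) (mul : X -> X -> X) (norm : X -> R).

Definition unitization : lmodType C := (C^o * X)%type.

Definition unitization_mul (a b : unitization) : unitization :=
  ((a.1 : C) * b.1, (a.1 : C) *: b.2 + (b.1 : C) *: a.2 + mul a.2 b.2).

Definition unitization_norm (a : unitization) : R :=
  Normc.normc a.1 + norm a.2.

(* Closure of [A] under holomorphic functional calculus in the Banach algebra
   [X]; if [X] has no unit, spectra are taken in its unitization. *)
Definition closed_calculus (A : set X) : Prop :=
  (forall e, is_unit_of mul setT e -> closed_calculus_in mul norm e A) /\
  (~ has_unit mul setT ->
   closed_calculus_in unitization_mul unitization_norm
     ((1, 0) : unitization) [set ((0, a) : unitization) | a in A]).

End Unitization.

Section Matrices.
Variables (X : lmodType C) (mul : X -> X -> X) (norm : X -> R) (m : nat).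

Definition alg_matrix : lmodType C := ('I_m -> 'I_m -> X : lmodType C).

Definition matrix_mul (a b : alg_matrix) : alg_matrix :=
  fun i j => \sum_k mul (a i k) (b k j).

(* one of the equivalent norms on matrices *)
Definition matrix_norm (a : alg_matrix) : R := \sum_i \sum_j norm (a i j).

Definition matrices_over (A : set X) : set alg_matrix :=
  [set a | forall i j, A (a i j)].

End Matrices.

Section Algebras.
Variables (X : lmodType C) (mul : X -> X -> X) (star : X -> X) (norm : X -> R).

(* [A] is a normed *-algebra for the given operations *)
Definition normed_star_algebra (A : set X) : Prop :=
  [/\ [/\ A 0,
          forall (c : C) a b, A a -> A b -> A (c *: a + b),
          forall a b, A a -> A b -> A (mul a b) &
          forall a, A a -> A (star a)],
      [/\ forall (c : C) a b d, A a -> A b -> A d ->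
            mul (c *: a + b) d = c *: mul a d + mul b d,
          forall (c : C) a b d, A a -> A b -> A d ->
            mul d (c *: a + b) = c *: mul d a + mul d b &
          forall a b d, A a -> A b -> A d -> mul a (mul b d) = mul (mul a b) d],
      [/\ forall (c : C) a b, A a -> A b ->
            star (c *: a + b) = (c^*)%C *: star a + star b,
          forall a b, A a -> A b -> star (mul a b) = mul (star b) (star a) &
          forall a, A a -> star (star a) = a] &
      [/\ forall a, A a -> 0 <= norm a /\ (norm a = 0 -> a = 0),
          forall (c : C) a, A a -> norm (c *: a) = Normc.normc c * norm a,
          forall a b, A a -> A b -> norm (a + b) <= norm a + norm b &
          forall a b, A a -> A b -> norm (mul a b) <= norm a * norm b]].

Definition Cstar_algebra : Prop :=
  [/\ normed_star_algebra setT,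
      forall a, norm (mul (star a) a) = norm a ^+ 2 &
      forall a : nat -> X,
        (forall eps : R, 0 < eps -> exists N, forall i j,
           (N <= i)%N -> (N <= j)%N -> norm (a i - a j) < eps) ->
        exists b, norm (a i - b) @[i --> \oo] --> (0 : R)].

End Algebras.

(* [j] exhibits [B] as the completion of the normed *-algebra [A] *)
Definition is_completion (X : lmodType C) (mul : X -> X -> X) (star : X -> X)
    (norm : X -> R) (A : set X) (B : lmodType C) (mulB : B -> B -> B)
    (starB : B -> B) (normB : B -> R) (j : X -> B) : Prop :=
  [/\ forall (c : C) a b, A a -> A b -> j (c *: a + b) = c *: j a + j b,
      forall a b, A a -> A b -> j (mul a b) = mulB (j a) (j b),
      forall a, A a -> j (star a) = starB (j a),
      forall a, A a -> normB (j a) = norm a &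
      forall (b : B) (eps : R), 0 < eps ->
        exists2 a, A a & normB (j a - b) < eps].

Definition local_Cstar_algebra (X : lmodType C) (mul : X -> X -> X)
    (star : X -> X) (norm : X -> R) (A : set X) : Prop :=
  normed_star_algebra mul star norm A /\
  exists (B : lmodType C) (mulB : B -> B -> B) (starB : B -> B)
         (normB : B -> R) (j : X -> B),
    [/\ Cstar_algebra mulB starB normB,
        is_completion mul star norm A mulB starB normB j,
        closed_calculus mulB normB (j @` A) &
        forall m, closed_calculus (@matrix_mul B mulB m.+1)
          (@matrix_norm B normB m.+1) (matrices_over (j @` A))].

End LocalCstar.

(* Main.v *)
Require Import Defs.
From HB Require Import structures.
From mathcomp Require Import all_boot all_order all_algebra.
From mathcomp Require Import all_classical all_reals all_analysis.
From mathcomp Require Import complex ring lra.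
Set Implicit Arguments.
Unset Strict Implicit.
Unset Printing Implicit Defensive.
Import Order.TTheory GRing.Theory Num.Theory numFieldNormedType.Exports.
Local Open Scope classical_set_scope.
Local Open Scope ring_scope.

(** Write [U] for the algebra [Ustar g E] and [P] for its closure among the
    adjointable bounded operators on [L^2]. Everything rests on a sandwich
    property: [A \o B \o K] belongs to [U] as soon as [A] and [K] do and [B] is
    in [P]. Indeed [K] maps [H^-k] to [L^2], [B] preserves [L^2], and [A] maps
    [L^2] to [H^l], so that the product is smoothing; it is quasilocal because
    it is the limit, in the norm of the operators from [H^-k] to [H^l], of the
    products [A \o F \o K] with [F] in [U]; and its adjoint is again such a
    sandwich ([l2_smoothing_sandwich], [Ustar_sandwich]). Quasilocality is
    stable under norm limits ([decays_limit]) and under composition, without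
    cut-off functions: by the definition of the local norms, [A u] is the sum of
    a small distribution and of one that is supported near [u], and the second
    operator is applied to both ([decays_comp]).

    Now let [f] be holomorphic near the spectrum of [a], an element of [U], with
    [f 0 = 0]. Then [f z = c * z + z * g z * z] with [g] holomorphic on the same
    open set ([holomorphic_divided]), hence [f(a) = c a + a g(a) a]. As [g(a)]
    is in [P], or in its unitization, [f(a)] is in [U]. If [U] has a unit [e],
    then [e] is a unit of [P] too and [b = e b e] is in [U] for all [b] in [P]:
    a unital [U] is already complete. Matrices over [U] inherit the sandwich
    property. All of this is carried out for a *-subalgebra with the sandwich
    property in a complete algebra satisfying the C*-identity, in
    [local_Cstar_sandwich].

    The function [g] is [(f z - c * z) / z ^ 2], and the point is its
    differentiability at [0]. It is read off Cauchy's formula on a small square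
    around [0] ([goursat], [cauchy_formula]), in the form [f w * T 1 w = T f w],
    where [T] is the unnormalized Cauchy integral and [T 1 0 != 0]
    ([cauchy_transform1_neq0]).

    Finally, [L^2], that is the Sobolev space of order zero, is the completion
    of the test sections for a positive form, realized inside the functionals on
    test sections ([sobolev0_completion]). It is a Hilbert space
    ([completion_complete]), so that its adjointable bounded operators are
    complete for the operator norm ([adjointable_complete]) and satisfy the
    C*-identity ([op_norm_Cstar]). *)

Local Notation nc := Normc.normc.

(** * Moduli of complex numbers *)

Section Modulus.
Context {R : realType}.
Local Notation C := R[i].
Implicit Types (z w : C).

Lemma normr_normc z : `|z| = (nc z)%:C%C.
Proof. by case: z. Qed.

Lemma normc_ge0 z : 0 <= nc z.
Proof. by case: z => a b; exact: sqrtr_ge0. Qed.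

Lemma normcD z w : nc (z + w) <= nc z + nc w.
Proof. exact: (@le_normcD R z w). Qed.

Lemma normc_distC z w : nc (z - w) = nc (w - z).
Proof. by rewrite -(@normcN R (w - z)) opprB. Qed.

Lemma le_normcB z w : nc (z - w) <= nc z + nc w.
Proof. by rewrite -(@normcN R w) normcD. Qed.

Lemma normc_real (a : R) : nc (a%:C%C) = `|a|.
Proof. by rewrite /= expr0n addr0 sqrtr_sqr. Qed.

Lemma Re_le_normc z : `|complex.Re z| <= nc z.
Proof. by case: z => a b /=; rewrite -sqrtr_sqr ler_wsqrtr// lerDl sqr_ge0. Qed.

Lemma Im_le_normc z : `|complex.Im z| <= nc z.
Proof. by case: z => a b /=; rewrite -sqrtr_sqr ler_wsqrtr// lerDr sqr_ge0. Qed.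

Lemma normc_le_ReIm z : nc z <= `|complex.Re z| + `|complex.Im z|.
Proof.
case: z => a b /=.
have ab0 : 0 <= `|a| + `|b| by rewrite addr_ge0.
rewrite -[leRHS](ger0_norm ab0) -sqrtr_sqr ler_wsqrtr//.
rewrite sqrrD !real_normK ?num_real//.
have : 0 <= `|a| * `|b| by rewrite mulr_ge0.
by rewrite mulr2n; lra.
Qed.

Lemma normc_eq0 z : (nc z == 0) = (z == 0).
Proof. by apply/eqP/eqP => [/Normc.eq0_normc //|->]; rewrite Normc.normc0. Qed.

Lemma normc_gt0 z : (0 < nc z) = (z != 0).
Proof. by rewrite lt_def normc_ge0 andbT normc_eq0. Qed.

(** The balls that define the topology of [C^o] have radii in [C]; they are
    positive, hence real. *)
Lemma near_normcP (z : C^o) (P : C^o -> Prop) :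
  (\forall w \near z, P w) <->
  exists2 d : R, 0 < d & forall w, nc (w - z) < d -> P w.
Proof.
split=> [/nbhs_normP[e /= e0 eP]|[d d0 dP]].
  exists (complex.Re e); first by move: e0; case: (e) => a b; rewrite ltcE => /andP[].
  move=> w wz; apply: eP; rewrite /ball_/= distrC normr_normc.
  move: e0; case: e wz => a b /= wz; rewrite ltcE /= => /andP[/eqP b0 _].
  by rewrite ltcE /= b0 eqxx.
apply/nbhs_normP; exists d%:C%C; first by rewrite /= ltcR.
by move=> w /=; rewrite /ball_/= distrC normr_normc ltcR; exact: dP.
Qed.

(** Multiplying the difference quotient out removes the division and the
    exclusion of [w = z]. *)
Lemma derivable_normcP (f : C^o -> C^o) (z : C^o) : derivable f z 1 <->
  exists c : C, forall e : R, 0 < e -> exists2 d : R, 0 < d &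
    forall w, nc (w - z) < d -> nc (f w - f z - c * (w - z)) <= e * nc (w - z).
Proof.
split=> [/cvg_ex[/= c fc]|[c fc]].
  exists c => e e0.
  have ec0 : 0 < e%:C%C by rewrite ltcR.
  have /cvgrPdist_le/(_ e%:C%C ec0) := fc.
  rewrite near_withinE => /near_normcP[d d0 dP]; exists d => // w wz.
  have [->|wz0] := eqVneq w z; first by rewrite !subrr mulr0 subr0 Normc.normc0 mulr0.
  have h0 : w - z != 0 by rewrite subr_eq0.
  have := dP (w - z) _ h0; rewrite subr0 => /(_ wz).
  rewrite normr_normc lecR /= -[(w - z) *: 1]/((w - z) * 1) mulr1 subrK.
  rewrite -[_ *: _]/((w - z)^-1 * (f w - f z)) => H.
  rewrite -ler_pdivrMr ?normc_gt0// -Normc.normcV -Normc.normcM.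
  by rewrite mulrBl mulfK// normc_distC mulrC.
apply/cvg_ex; exists c; apply/cvgrPdist_le => /= e.
case: e => e b; rewrite ltcE /= => /andP[/eqP -> e0].
have [d d0 dP] := fc e e0.
rewrite near_withinE; apply/near_normcP; exists d => // h.
rewrite subr0 => hd h0.
have := dP (h + z); rewrite addrK => /(_ hd) H.
rewrite normr_normc lecR -[h *: 1]/(h * 1) mulr1.
rewrite -[_ *: _]/(h^-1 * (f (h + z) - f z)) normc_distC.
have hn : 0 < nc h by rewrite normc_gt0.
by rewrite -(ler_pM2r hn) -Normc.normcM mulrBl mulrAC mulVf// mul1r.
Qed.

Lemma derivable_continuous_normc (f : C^o -> C^o) (z : C^o) : derivable f z 1 ->
  forall e : R, 0 < e -> exists2 d : R, 0 < d &
    forall w, nc (w - z) < d -> nc (f w - f z) < e.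
Proof.
move=> /derivable1_diffP/differentiable_continuous/cvgrPdist_lt fz e e0.
have := fz e%:C%C; rewrite ltcR => /(_ e0)/near_normcP[d d0 dP].
by exists d => // w /dP; rewrite normr_normc ltcR normc_distC.
Qed.

End Modulus.

(** * Integrals of complex functions along segments *)

Section SegmentIntegral.
Context {R : realType}.
Local Notation C := R[i].
Local Notation Re := complex.Re.
Local Notation Im := complex.Im.
Local Notation mu := (@lebesgue_measure R).
Implicit Types (a b m : R) (g h : R -> C).

(** Two-sided continuity, even at the end points: the integrands below are
    differentiable around the contours. *)
Definition continuous_on_segment a b g : Prop := forall x : R, a <= x <= b ->
  {for x, continuous (fun x => Re (g x))} /\
  {for x, continuous (fun x => Im (g x))}.
Local Notation cc := continuous_on_segment.

Definition segment_integral a b g : C :=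
  Complex (\int[mu]_(x in `[a, b]) Re (g x))%R (\int[mu]_(x in `[a, b]) Im (g x))%R.
Local Notation cint := segment_integral.

Lemma integrable_segment a b (g : R -> R) :
  (forall x : R, a <= x <= b -> {for x, continuous g}) ->
  mu.-integrable `[a, b] (EFin \o g).
Proof.
move=> cg; apply: continuous_compact_integrable; first exact: segment_compact.
by apply: continuous_in_subspaceT => x /set_mem; rewrite /= in_itv/=; exact: cg.
Qed.

Lemma Rintegral_segmentL a b (p : R) (f g : R -> R) :
  (forall x : R, a <= x <= b -> {for x, continuous f}) ->
  (forall x : R, a <= x <= b -> {for x, continuous g}) ->
  (\int[mu]_(x in `[a, b]) (p * f x + g x) =
   p * (\int[mu]_(x in `[a, b]) f x) + \int[mu]_(x in `[a, b]) g x)%R.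
Proof.
move=> cf cg; rewrite RintegralD//; [|apply: integrable_segment..] => //.
  by rewrite RintegralZl//; exact: integrable_segment.
by move=> x /cf; apply: cvgM; exact: cvg_cst.
Qed.

Lemma integrable_ReIm a b g : cc a b g ->
  mu.-integrable `[a, b] (EFin \o (fun x => Re (g x))) /\
  mu.-integrable `[a, b] (EFin \o (fun x => Im (g x))).
Proof. by move=> cg; split; apply: integrable_segment => x /cg[]. Qed.

Lemma eq_segment_integral a b g h : (forall x : R, a <= x <= b -> g x = h x) ->
  cint a b g = cint a b h.
Proof.
move=> gh; congr Complex; apply: eq_Rintegral => x /set_mem;
  by rewrite /= in_itv/= => /gh ->.
Qed.

Lemma continuous_on_segmentL a b (c : C) g h : cc a b g -> cc a b h ->
  cc a b (fun x => c * g x + h x).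
Proof.
move=> cg ch x xab; have [cg1 cg2] := cg x xab; have [ch1 ch2] := ch x xab.
have E1 : (fun x => Re (c * g x + h x)) =
    (fun x => Re c * Re (g x) - Im c * Im (g x) + Re (h x)).
  by apply/funext => y; case: c (g y) (h y) => ? ? [? ?] [].
have E2 : (fun x => Im (c * g x + h x)) =
    (fun x => Re c * Im (g x) + Im c * Re (g x) + Im (h x)).
  by apply/funext => y; case: c {E1} (g y) (h y) => ? ? [? ?] [].
rewrite E1 E2; split.
- by apply: cvgD ch1; apply: cvgB; apply: cvgM => //; exact: cvg_cst.
- by apply: cvgD ch2; apply: cvgD; apply: cvgM => //; exact: cvg_cst.
Qed.

Lemma segment_integralL a b (c : C) g h : cc a b g -> cc a b h ->
  cint a b (fun x => c * g x + h x) = c * cint a b g + cint a b h.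
Proof.
move=> cg ch; case: c => p q; rewrite /cint; simpc.
have cf (k : R) (f1 f2 : R -> R) (x : R) : {for x, continuous f1} ->
    {for x, continuous f2} -> {for x, continuous (fun x => k * f1 x + f2 x)}.
  by move=> c1 c2; apply: cvgD => //; apply: cvgM => //; exact: cvg_cst.
congr Complex.
- rewrite -addrA -mulNr -!Rintegral_segmentL//.
  + by apply: eq_Rintegral => x _; case: (g x) (h x) => ? ? [? ?] /=; ring.
  + by move=> x /cg[].
  + by move=> x xab; apply: cf; [exact: (cg x xab).2|exact: (ch x xab).1].
  + by move=> x /cg[].
  + by move=> x /ch[].
- rewrite -addrA -!Rintegral_segmentL//.
  + by apply: eq_Rintegral => x _; case: (g x) (h x) => ? ? [? ?] /=; ring.
  + by move=> x /cg[].
  + by move=> x xab; apply: cf; [exact: (cg x xab).1|exact: (ch x xab).2].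
  + by move=> x /cg[].
  + by move=> x /ch[].
Qed.

Lemma continuous_on_segment_cst a b (c : C) : cc a b (fun=> c).
Proof. by move=> x _; split; exact: cvg_cst. Qed.

Lemma segment_integral_cst a b (c : C) : a <= b ->
  cint a b (fun=> c) = (b - a)%:C%C * c.
Proof.
move=> ab; case: c => p q; rewrite /cint; simpc.
rewrite !Rintegral_cst//= lebesgue_measure_itv/= lte_fin.
case: ltP => [_|ba]; first by rewrite [p * _]mulrC [q * _]mulrC.
have -> : b = a by apply/le_anti; rewrite ab ba.
by rewrite subrr !mulr0 !mul0r.
Qed.

Lemma segment_integral_split a m b g : a <= m -> m <= b -> cc a b g ->
  cint a b g = cint a m g + cint m b g.
Proof.
move=> am mb /integrable_ReIm[g1 g2].
have split (f : R -> R) : mu.-integrable `[a, b] (EFin \o f) ->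
    (\int[mu]_(x in `[a, b]) f x =
     \int[mu]_(x in `[a, m]) f x + \int[mu]_(x in `[m, b]) f x)%R.
  move=> intf; rewrite -(@Rintegral_itv_obnd_cbnd _ m (BRight b)); last first.
    apply: integrableS intf => //; apply: subset_itvr; rewrite bnd_simp//.
  rewrite -(@Rintegral_itvB _ f (BLeft a) (BRight b) m) ?bnd_simp//.
  by rewrite addrC subrK.
by rewrite /cint !split.
Qed.

Lemma le_Rintegral_segment a b (p q : R) (f : R -> R) : a <= b ->
  (forall x : R, a <= x <= b -> {for x, continuous f}) ->
  (forall x : R, a <= x <= b -> p <= f x <= q) ->
  p * (b - a) <= (\int[mu]_(x in `[a, b]) f x)%R <= q * (b - a).
Proof.
move=> ab /integrable_segment cf fpq.
have cstE k : k * (b - a) = (\int[mu]_(x in `[a, b]) k)%R.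
  rewrite Rintegral_cst//= lebesgue_measure_itv/= lte_fin.
  case: ltP => [//|ba].
  have -> : b = a by apply/le_anti; rewrite ab ba.
  by rewrite subrr.
have cst_int k : mu.-integrable `[a, b] (EFin \o (fun=> k)).
  by apply: integrable_segment => x _; exact: cvg_cst.
apply/andP; split; rewrite cstE; apply: le_Rintegral => // x;
  by rewrite /= in_itv/= => /fpq/andP[].
Qed.

(** The factor [2] comes from bounding real and imaginary parts separately. *)
Lemma normc_segment_integral a b g (k : R) : a <= b -> cc a b g ->
  (forall x : R, a <= x <= b -> nc (g x) <= k) ->
  nc (cint a b g) <= 2 * k * (b - a).
Proof.
move=> ab cg gk; apply: le_trans (normc_le_ReIm _) _.
have bnd (p : C -> R) : (forall z, `|p z| <= nc z) ->
    (forall x : R, a <= x <= b -> {for x, continuous (fun x => p (g x))}) ->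
    `|(\int[mu]_(x in `[a, b]) p (g x))%R| <= k * (b - a).
  move=> pnc cp; rewrite ler_norml -mulNr; apply: le_Rintegral_segment => // x xab.
  by rewrite -ler_norml (le_trans (pnc _))// gk.
have H1 := bnd _ Re_le_normc (fun x xab => (cg x xab).1).
have H2 := bnd _ Im_le_normc (fun x xab => (cg x xab).2).
by rewrite /cint/=; lra.
Qed.

Lemma continuous_on_segment_bounded a b g : a <= b -> cc a b g ->
  exists k : R, forall x : R, a <= x <= b -> nc (g x) <= k.
Proof.
move=> ab cg.
have bnd (p : R -> R) : (forall x : R, a <= x <= b -> {for x, continuous p}) ->
    exists k, forall x, a <= x <= b -> `|p x| <= k.
  move=> cp.
  have [c _ Hc] : exists2 c, c \in `[a, b]%R &
      forall t, t \in `[a, b]%R -> `|p t| <= `|p c|.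
    apply: (@EVT_max _ (fun x => `|p x|)) => //.
    apply: continuous_in_subspaceT => x /set_mem; rewrite /= in_itv/= => xab.
    by apply: cvg_norm; exact: cp.
  by exists `|p c| => x xab; apply: Hc; rewrite in_itv.
have [k1 H1] := bnd _ (fun x xab => (cg x xab).1).
have [k2 H2] := bnd _ (fun x xab => (cg x xab).2).
exists (k1 + k2) => x xab; apply: le_trans (normc_le_ReIm _) _.
by rewrite lerD ?H1 ?H2.
Qed.

(** For isometric [p], which serves horizontal and vertical segments at once. *)
Lemma continuous_on_segment_path a b (f : C^o -> C^o) (p : R -> C) :
  (forall x y : R, nc (p x - p y) = `|x - y|) ->
  (forall x : R, a <= x <= b -> derivable f (p x) 1) ->
  cc a b (fun x => f (p x)).
Proof.
move=> p_isom df x xab; have cf := derivable_continuous_normc (df x xab).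
have H (q : C -> R) : (forall z, `|q z| <= nc z) -> {morph q : x y / x - y} ->
    {for x, continuous (fun x => q (f (p x)))}.
  move=> qnc qB; apply/cvgrPdist_lt => e e0; have [d d0 dP] := cf e e0.
  near=> y; rewrite -qB; apply: le_lt_trans (qnc _) _.
  rewrite normc_distC; apply: dP; rewrite p_isom distrC.
  by near: y; exact: cvgr_dist_lt.
split; apply: H.
- exact: Re_le_normc.
- by move=> [? ?] [].
- exact: Im_le_normc.
- by move=> [? ?] [].
Unshelve. all: by end_near. Qed.

End SegmentIntegral.

(** * Integrals along boundaries of rectangles *)

Section RectangleIntegral.
Context {R : realType}.
Local Notation C := R[i].
Local Notation Re := complex.Re.
Local Notation Im := complex.Im.
Local Notation cc := continuous_on_segment.
Local Notation cint := segment_integral.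
Implicit Types (f g : C^o -> C^o) (x y : R).

(** The contour integral of [f z dz], counterclockwise along the boundary. *)
Definition rect_integral f x0 x1 y0 y1 : C :=
  cint x0 x1 (fun x => f (Complex x y0)) - cint x0 x1 (fun x => f (Complex x y1))
  + 'i%C * (cint y0 y1 (fun y => f (Complex x1 y)) -
            cint y0 y1 (fun y => f (Complex x0 y))).
Local Notation J := rect_integral.

Definition rect x0 x1 y0 y1 (z : C) : Prop :=
  x0 <= Re z <= x1 /\ y0 <= Im z <= y1.

Definition rect_boundary x0 x1 y0 y1 (z : C) : Prop :=
  rect x0 x1 y0 y1 z /\ [\/ Re z = x0, Re z = x1, Im z = y0 | Im z = y1].

Definition continuous_on_boundary f x0 x1 y0 y1 :=
  [/\ cc x0 x1 (fun x => f (Complex x y0)), cc x0 x1 (fun x => f (Complex x y1)),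
      cc y0 y1 (fun y => f (Complex x1 y)) & cc y0 y1 (fun y => f (Complex x0 y))].
Local Notation bc := continuous_on_boundary.

Lemma normc_dist_horizontal x x' y : nc (Complex x y - Complex x' y) = `|x - x'|.
Proof.
rewrite -[_ - _]/(Complex (x - x') (y - y)) /= subrr.
by rewrite expr0n addr0 sqrtr_sqr.
Qed.

Lemma normc_dist_vertical x y y' : nc (Complex x y - Complex x y') = `|y - y'|.
Proof.
rewrite -[_ - _]/(Complex (x - x) (y - y')) /= subrr.
by rewrite expr0n add0r sqrtr_sqr.
Qed.

Lemma continuous_on_horizontal f x0 x1 y :
  (forall x, x0 <= x <= x1 -> derivable f (Complex x y) 1) ->
  cc x0 x1 (fun x => f (Complex x y)).
Proof.
by apply: (continuous_on_segment_path (p := fun x => Complex x y)) => ? ?;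
  exact: normc_dist_horizontal.
Qed.

Lemma continuous_on_vertical f x y0 y1 :
  (forall y, y0 <= y <= y1 -> derivable f (Complex x y) 1) ->
  cc y0 y1 (fun y => f (Complex x y)).
Proof.
by apply: (continuous_on_segment_path (p := fun y => Complex x y)) => ? ?;
  exact: normc_dist_vertical.
Qed.

Lemma derivable_continuous_on_boundary f x0 x1 y0 y1 : x0 <= x1 -> y0 <= y1 ->
  (forall z, rect_boundary x0 x1 y0 y1 z -> derivable f z 1) -> bc f x0 x1 y0 y1.
Proof.
move=> x01 y01 df; split.
- apply: continuous_on_horizontal => x hx; apply: df.
  by split; [split=> //=; rewrite lexx|constructor 3].
- apply: continuous_on_horizontal => x hx; apply: df.
  by split; [split=> //=; rewrite lexx y01|constructor 4].
- apply: continuous_on_vertical => y hy; apply: df.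
  by split; [split=> //=; rewrite lexx x01|constructor 2].
- apply: continuous_on_vertical => y hy; apply: df.
  by split; [split=> //=; rewrite lexx|constructor 1].
Qed.

Lemma continuous_on_boundaryL (c : C) f g x0 x1 y0 y1 :
  bc f x0 x1 y0 y1 -> bc g x0 x1 y0 y1 ->
  bc (fun z => c * f z + g z) x0 x1 y0 y1.
Proof. by move=> [? ? ? ?] [? ? ? ?]; split; exact: continuous_on_segmentL. Qed.

Lemma continuous_on_boundary_cst (c : C) x0 x1 y0 y1 :
  bc (fun=> c) x0 x1 y0 y1.
Proof. by split; exact: continuous_on_segment_cst. Qed.

Lemma rect_integralL (c : C) f g x0 x1 y0 y1 :
  bc f x0 x1 y0 y1 -> bc g x0 x1 y0 y1 ->
  J (fun z => c * f z + g z) x0 x1 y0 y1 =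
  c * J f x0 x1 y0 y1 + J g x0 x1 y0 y1.
Proof.
by move=> [? ? ? ?] [? ? ? ?]; rewrite /J !segment_integralL//; ring.
Qed.

Lemma rect_integral_cst (c : C) x0 x1 y0 y1 : J (fun=> c) x0 x1 y0 y1 = 0.
Proof. by rewrite /J; ring. Qed.

(** For [f z = z] the integrands on opposite sides differ by a constant, and the
    contributions of the two pairs of sides cancel. *)
Lemma rect_integral_affine (c d : C) x0 x1 y0 y1 : x0 <= x1 -> y0 <= y1 ->
  J (fun z => c * z + d) x0 x1 y0 y1 = 0.
Proof.
move=> x01 y01.
have bid : bc id x0 x1 y0 y1.
  by apply: derivable_continuous_on_boundary => // z _; exact: derivable_id.
rewrite rect_integralL//; last exact: continuous_on_boundary_cst.
rewrite rect_integral_cst addr0.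
suff -> : J id x0 x1 y0 y1 = 0 by rewrite mulr0.
have [b1 b2 b3 b4] := bid.
have segB a b p q (k : C) : a <= b -> cc a b q ->
    (forall t, p t = q t + k) -> cint a b p - cint a b q = (b - a)%:C%C * k.
  move=> ab cq pq; rewrite -segment_integral_cst//; apply/eqP.
  rewrite subr_eq; apply/eqP; rewrite addrC.
  rewrite -[cint a b q]mul1r -segment_integralL//; last exact: continuous_on_segment_cst.
  by apply: eq_segment_integral => t _; rewrite pq mul1r.
rewrite /J (segB _ _ _ _ (Complex 0 (y0 - y1)))//; last first.
  by move=> t /=; simpc; rewrite addrC subrK.
rewrite (segB _ _ _ _ (Complex (x1 - x0) 0))//; last first.
  by move=> t /=; simpc; rewrite addrC subrK.
by simpc; apply/eqP; rewrite eq_complex /= eqxx; apply/eqP; ring.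
Qed.

Lemma normc_rect_integral f x0 x1 y0 y1 k : x0 <= x1 -> y0 <= y1 ->
  bc f x0 x1 y0 y1 -> (forall z, rect_boundary x0 x1 y0 y1 z -> nc (f z) <= k) ->
  nc (J f x0 x1 y0 y1) <= 4 * k * ((x1 - x0) + (y1 - y0)).
Proof.
move=> x01 y01 [b1 b2 b3 b4] fk.
have H1 : nc (cint x0 x1 (fun x => f (Complex x y0))) <= 2 * k * (x1 - x0).
  apply: normc_segment_integral => // x hx; apply: fk.
  by split; [split=> //=; rewrite lexx|constructor 3].
have H2 : nc (cint x0 x1 (fun x => f (Complex x y1))) <= 2 * k * (x1 - x0).
  apply: normc_segment_integral => // x hx; apply: fk.
  by split; [split=> //=; rewrite lexx y01|constructor 4].
have H3 : nc (cint y0 y1 (fun y => f (Complex x1 y))) <= 2 * k * (y1 - y0).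
  apply: normc_segment_integral => // x hx; apply: fk.
  by split; [split=> //=; rewrite lexx x01|constructor 2].
have H4 : nc (cint y0 y1 (fun y => f (Complex x0 y))) <= 2 * k * (y1 - y0).
  apply: normc_segment_integral => // x hx; apply: fk.
  by split; [split=> //=; rewrite lexx|constructor 1].
have nci : nc ('i%C : C) = 1 by rewrite /= expr0n expr1n add0r sqrtr1.
apply: le_trans (normcD _ _) _; rewrite Normc.normcM nci mul1r.
have := le_normcB (cint x0 x1 (fun x => f (Complex x y0)))
  (cint x0 x1 (fun x => f (Complex x y1))).
have := le_normcB (cint y0 y1 (fun y => f (Complex x1 y)))
  (cint y0 y1 (fun y => f (Complex x0 y))).
by lra.
Qed.

Lemma rect_integral_splitx f x0 m x1 y0 y1 : x0 <= m -> m <= x1 ->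
  cc x0 x1 (fun x => f (Complex x y0)) -> cc x0 x1 (fun x => f (Complex x y1)) ->
  J f x0 x1 y0 y1 = J f x0 m y0 y1 + J f m x1 y0 y1.
Proof.
move=> xm mx c0 c1; rewrite /J (segment_integral_split xm mx c0).
by rewrite (segment_integral_split xm mx c1); ring.
Qed.

Lemma rect_integral_splity f x0 x1 y0 m y1 : y0 <= m -> m <= y1 ->
  cc y0 y1 (fun y => f (Complex x1 y)) -> cc y0 y1 (fun y => f (Complex x0 y)) ->
  J f x0 x1 y0 y1 = J f x0 x1 y0 m + J f x0 x1 m y1.
Proof.
move=> ym my c0 c1; rewrite /J (segment_integral_split ym my c0).
by rewrite (segment_integral_split ym my c1); ring.
Qed.

Lemma eq_rect_integral f g x0 x1 y0 y1 : x0 <= x1 -> y0 <= y1 ->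
  (forall z, rect_boundary x0 x1 y0 y1 z -> f z = g z) ->
  J f x0 x1 y0 y1 = J g x0 x1 y0 y1.
Proof.
move=> x01 y01 fg; rewrite /J; congr (_ - _ + _ * (_ - _));
  apply: eq_segment_integral => t ht; apply: fg.
- by split; [split=> //=; rewrite lexx|constructor 3].
- by split; [split=> //=; rewrite lexx y01|constructor 4].
- by split; [split=> //=; rewrite lexx x01|constructor 2].
- by split; [split=> //=; rewrite lexx|constructor 1].
Qed.

Lemma rect_integral_quarters f x0 x1 y0 y1 xm ym :
  x0 <= xm <= x1 -> y0 <= ym <= y1 ->
  (forall z, rect x0 x1 y0 y1 z -> derivable f z 1) ->
  J f x0 x1 y0 y1 = (J f x0 xm y0 ym + J f x0 xm ym y1) +
                    (J f xm x1 y0 ym + J f xm x1 ym y1).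
Proof.
move=> /andP[x0m xm1] /andP[y0m ym1] df.
have x01 := le_trans x0m xm1; have y01 := le_trans y0m ym1.
rewrite (@rect_integral_splitx _ _ xm)//; last 2 first.
- by apply: continuous_on_horizontal => x hx; apply: df; split=> //=; rewrite lexx.
- by apply: continuous_on_horizontal => x hx; apply: df; split=> //=; rewrite lexx y01.
congr (_ + _); apply: rect_integral_splity => //;
  apply: continuous_on_vertical => y hy; apply: df; split=> //=;
  rewrite ?lexx ?x0m ?xm1 ?x01//.
Qed.

End RectangleIntegral.

(** * Goursat's theorem *)

Section Goursat.
Context {R : realType}.
Local Notation C := R[i].
Local Notation Re := complex.Re.
Local Notation Im := complex.Im.
Local Notation J := rect_integral.
Implicit Types (f g : C^o -> C^o) (x y : R).

Lemma derivable_affine (c d : C) (z : C^o) : derivable (fun z : C^o => c * z + d : C^o) z 1.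
Proof.
apply/derivable_normcP; exists c => e e0; exists 1 => // w _.
have -> : c * w + d - (c * z + d) - c * (w - z) = 0 by ring.
by rewrite Normc.normc0 mulr_ge0 ?normc_ge0// ltW.
Qed.

Lemma normcD4_lt (z1 z2 z3 z4 : C) (k : R) :
  4 * nc z1 < k -> 4 * nc z2 < k -> 4 * nc z3 < k -> 4 * nc z4 < k ->
  nc ((z1 + z2) + (z3 + z4)) < k.
Proof.
have := normcD (z1 + z2) (z3 + z4).
have := normcD z1 z2; have := normcD z3 z4; lra.
Qed.

Lemma segment_dist (p d x t : R) : p <= x -> x <= p + d -> p <= t <= p + d ->
  `|x - t| <= d.
Proof. by move=> *; rewrite ler_norml; apply/andP; split; lra. Qed.

(** Bisection: one of the four quarters of a rectangle carries at least a
    quarter of the integral, so that some nested rectangles of scale [2^-k]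
    carry at least [4^-k] of it. Near their common point, [f] differs from an
    affine function, the integral of which vanishes, by [o(2^-k)]; and this is
    integrated along a boundary of length [O(2^-k)]. *)
Lemma goursat f x0 x1 y0 y1 : x0 <= x1 -> y0 <= y1 ->
  (forall z, rect x0 x1 y0 y1 z -> derivable f z 1) -> J f x0 x1 y0 y1 = 0.
Proof.
move=> x01 y01 df; apply/Normc.eq0_normc.
pose a := x1 - x0; pose b := y1 - y0.
have a0 : 0 <= a by rewrite subr_ge0.
have b0 : 0 <= b by rewrite subr_ge0.
(* integrals over sub-rectangles of scale [2^-k], with lower left corner [p] *)
pose K k (p : R * R) := J f p.1 (p.1 + a / 2 ^+ k) p.2 (p.2 + b / 2 ^+ k).
pose inside k (p : R * R) := x0 <= p.1 /\ p.1 + a / 2 ^+ k <= x1 /\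
                             y0 <= p.2 /\ p.2 + b / 2 ^+ k <= y1.
pose quarter k (p q : R * R) :=
  [/\ p.1 <= q.1, q.1 + a / 2 ^+ k.+1 <= p.1 + a / 2 ^+ k,
      p.2 <= q.2, q.2 + b / 2 ^+ k.+1 <= p.2 + b / 2 ^+ k &
      nc (K k p) <= 4 * nc (K k.+1 q)].
have half (c : R) k : c / 2 ^+ k = c / 2 ^+ k.+1 + c / 2 ^+ k.+1.
  by rewrite exprS invfM; lra.
have aK : x0 + a / 2 ^+ 0 = x1 by rewrite expr0 divr1 /a addrC subrK.
have bK : y0 + b / 2 ^+ 0 = y1 by rewrite expr0 divr1 /b addrC subrK.
have scale_ge0 (c : R) k : 0 <= c -> 0 <= c / 2 ^+ k.
  by move=> c0; rewrite divr_ge0// exprn_ge0.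
have step k p : inside k p -> exists q, quarter k p q.
  move=> [i1 [i2 [i3 i4]]]; apply: contrapT => noq.
  have small q : p.1 <= q.1 -> q.1 + a / 2 ^+ k.+1 <= p.1 + a / 2 ^+ k ->
      p.2 <= q.2 -> q.2 + b / 2 ^+ k.+1 <= p.2 + b / 2 ^+ k ->
      4 * nc (K k.+1 q) < nc (K k p).
    by move=> q1 q2 q3 q4; rewrite ltNge; apply/negP => q5; apply: noq; exists q.
  have ak := scale_ge0 a k.+1 a0; have bk := scale_ge0 b k.+1 b0.
  have aE := half a k; have bE := half b k.
  set a' := a / 2 ^+ k.+1 in ak aE small; set b' := b / 2 ^+ k.+1 in bk bE small.
  rewrite aE addrA in i2; rewrite bE addrA in i4.
  have KE : K k p = (K k.+1 p + K k.+1 (p.1, p.2 + b')) +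
      (K k.+1 (p.1 + a', p.2) + K k.+1 (p.1 + a', p.2 + b')).
    rewrite /K /= -/a' -/b' aE bE (addrA p.1) (addrA p.2).
    apply: rect_integral_quarters; rewrite ?lerDl ?ak ?bk//.
    move=> z [/andP[z1 z2] /andP[z3 z4]]; apply: df; split; apply/andP; split.
    - exact: le_trans i1 z1.
    - exact: le_trans z2 i2.
    - exact: le_trans i3 z3.
    - exact: le_trans z4 i4.
  suff : nc (K k p) < nc (K k p) by rewrite ltxx.
  by rewrite {1}KE; apply: normcD4_lt; apply: small;
    rewrite /= ?aE ?bE ?addrA ?lexx ?lerDl.
have /choice[next nextP] : forall kp : nat * (R * R), exists q,
    inside kp.1 kp.2 -> quarter kp.1 kp.2 q.
  move=> [k p]; have [/step[q ?]|?] := pselect (inside k p); first by exists q.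
  by exists p.
pose s := fix s k := if k is k'.+1 then next (k', s k') else (x0, y0).
have sin k : inside k (s k).
  elim: k => [|k IHk].
    by rewrite /inside -[s 0%N]/(x0, y0) /fst /snd aK bK !lexx.
  have [q1 q2 q3 q4 _] := nextP (k, s k) IHk; move: IHk => [i1 [i2 [i3 i4]]].
  split; first exact: le_trans i1 q1.
  split; first exact: le_trans q2 i2.
  by split; [exact: le_trans i3 q3|exact: le_trans q4 i4].
have sq k : quarter k (s k) (s k.+1) by exact: (nextP (k, s k) (sin k)).
have sKle k : nc (J f x0 x1 y0 y1) <= 4 ^+ k * nc (K k (s k)).
  elim: k => [|k IHk].
    by rewrite expr0 mul1r /K -[s 0%N]/(x0, y0) /fst /snd aK bK lexx.
  apply: le_trans IHk _; rewrite exprSr -mulrA ler_wpM2l// ?exprn_ge0//.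
  by case: (sq k).
have smono k m : (s k).1 <= (s (k + m)%N).1 /\ (s k).2 <= (s (k + m)%N).2 /\
    (s (k + m)%N).1 + a / 2 ^+ (k + m) <= (s k).1 + a / 2 ^+ k /\
    (s (k + m)%N).2 + b / 2 ^+ (k + m) <= (s k).2 + b / 2 ^+ k.
  elim: m => [|m [i1 [i2 [i3 i4]]]]; first by rewrite addn0 !lexx.
  rewrite addnS; have [q1 q2 q3 q4 _] := sq (k + m)%N.
  split; first exact: le_trans i1 q1.
  split; first exact: le_trans i2 q3.
  by split; [exact: le_trans q2 i3|exact: le_trans q4 i4].
(* the left ends increase and are bounded by all right ends: take their supremum *)
have common (c : R) (u : nat -> R) : 0 <= c ->
    (forall k m, u k <= u (k + m)%N /\
                 u (k + m)%N + c / 2 ^+ (k + m) <= u k + c / 2 ^+ k) ->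
    exists t, forall k, u k <= t <= u k + c / 2 ^+ k.
  move=> c0 umono.
  have ub k : ubound (range u) (u k + c / 2 ^+ k).
    move=> _ [j _ <-]; have [kj|jk] := leqP k j.
      have [_] := umono k (j - k)%N; rewrite subnKC// => H.
      by apply: le_trans H; rewrite lerDl scale_ge0.
    have [H _] := umono j (k - j)%N; rewrite subnKC 1?ltnW// in H.
    by apply: le_trans H _; rewrite lerDl scale_ge0.
  exists (sup (range u)) => k; apply/andP; split.
    by apply: ub_le_sup; [exists (u 0%N + c / 2 ^+ 0)|exists k].
  by apply: ge_sup; [exists (u 0%N); exists 0%N|].
have [t1 t1P] := common a (fun k => (s k).1) a0 ltac:(by move=> k m; have [? [? [? ?]]] := smono k m).
have [t2 t2P] := common b (fun k => (s k).2) b0 ltac:(by move=> k m; have [? [? [? ?]]] := smono k m).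
pose t : C := Complex t1 t2.
have tin : rect x0 x1 y0 y1 t.
  by have := t1P 0%N; have := t2P 0%N; rewrite -[s 0%N]/(x0, y0) /fst /snd aK bK.
have [c fc] := (derivable_normcP f t).1 (df t tin).
apply/eqP; rewrite eq_le normc_ge0 andbT; apply/ler_addgt0Pr => e e0.
rewrite add0r.
pose l := a + b; have l0 : 0 <= l by rewrite addr_ge0.
(* the final bound is [4 ^+ k * (4 * (e1 * lk) * lk) = 4 * (l * l) * e1] *)
pose e1 := e / (4 * (l * l) + 1).
have den0 : 0 < 4 * (l * l) + 1 by rewrite ltr_wpDl// mulr_ge0// mulr_ge0.
have e10 : 0 < e1 by rewrite divr_gt0.
have [d d0 dP] := fc e1 e10.
have [k kd] : exists k, l / 2 ^+ k < d.
  have /cvgrPdist_lt/(_ d d0)[k _ kP] :=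
    @cvg_geometric R l 2^-1 ltac:(by rewrite gtr0_norm ?invr_gt0 ?invf_lt1 ?ltr1n).
  exists k; have := kP k (leqnn k); rewrite /= sub0r normrN /geometric /= exprVn.
  exact/le_lt_trans/ler_norm.
set lk := l / 2 ^+ k in kd.
have lk0 : 0 <= lk by exact: scale_ge0.
have lkE : lk = a / 2 ^+ k + b / 2 ^+ k by rewrite /lk mulrDl.
(* [f] minus its affine approximation at [t] has the same integral as [f] *)
pose g : C^o -> C^o := fun z => (-1) * (c * z + (f t - c * t)) + f z.
have [i1 [i2 [i3 i4]]] := sin k.
have x01' : (s k).1 <= (s k).1 + a / 2 ^+ k by rewrite lerDl scale_ge0.
have y01' : (s k).2 <= (s k).2 + b / 2 ^+ k by rewrite lerDl scale_ge0.
have bcf : continuous_on_boundary f (s k).1 ((s k).1 + a / 2 ^+ k)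
    (s k).2 ((s k).2 + b / 2 ^+ k).
  apply: (derivable_continuous_on_boundary x01' y01') => z [[/andP[? ?] /andP[? ?]] _].
  apply: df; split; apply/andP; split.
  - exact: le_trans i1 _.
  - exact: le_trans i2.
  - exact: le_trans i3 _.
  - exact: le_trans i4.
have bcaff : continuous_on_boundary (fun z => c * z + (f t - c * t))
    (s k).1 ((s k).1 + a / 2 ^+ k) (s k).2 ((s k).2 + b / 2 ^+ k).
  by apply: (derivable_continuous_on_boundary x01' y01') => z _; exact: derivable_affine.
have KE : K k (s k) = J g (s k).1 ((s k).1 + a / 2 ^+ k)
    (s k).2 ((s k).2 + b / 2 ^+ k).
  by rewrite /g rect_integralL// rect_integral_affine// mulr0 add0r.
have gb z : rect_boundary (s k).1 ((s k).1 + a / 2 ^+ k)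
    (s k).2 ((s k).2 + b / 2 ^+ k) z -> nc (g z) <= e1 * lk.
  move=> [[/andP[z1 z2] /andP[z3 z4]] _].
  have zt : nc (z - t) <= lk.
    apply: le_trans (normc_le_ReIm _) _; rewrite lkE.
    rewrite /t; case: z z1 z2 z3 z4 => p q z1 z2 z3 z4.
    by apply: lerD; [apply: segment_dist z1 z2 (t1P k)|apply: segment_dist z3 z4 (t2P k)].
  have -> : g z = f z - f t - c * (z - t) by rewrite /g; ring.
  apply: le_trans (dP z _) _; first exact: le_lt_trans zt kd.
  by rewrite ler_wpM2l// ltW.
have := normc_rect_integral x01' y01' ltac:(
  exact: (continuous_on_boundaryL (-1) bcaff bcf)) gb.
rewrite -KE !(addrC _ (_ / _)) !addrK -lkE => Kb.
have := sKle k; move/le_trans; apply.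
have p4 : 0 < 4 ^+ k :> R by rewrite exprn_gt0.
have lk2 : 4 ^+ k * (lk * lk) = l * l.
  rewrite /lk; have -> : 4 ^+ k = 2 ^+ k * 2 ^+ k :> R by rewrite -exprMn; congr (_ ^+ _); lra.
  have p2 : 2 ^+ k != 0 :> R by rewrite expf_neq0.
  by field.
apply: (@le_trans _ _ (4 ^+ k * (4 * (e1 * lk) * lk))); first by rewrite ler_pM2l.
have -> : 4 ^+ k * (4 * (e1 * lk) * lk) = e1 * (4 * (4 ^+ k * (lk * lk))) by ring.
rewrite lk2 /e1 mulrAC ler_pdivrMr// ler_wpM2l// ?ltW//; lra.
Qed.

End Goursat.

(** * Cauchy transforms on a square *)

Section CauchyFormula.
Context {R : realType}.
Local Notation C := R[i].
Local Notation Re := complex.Re.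
Local Notation Im := complex.Im.
Local Notation J := rect_integral.
Local Notation bc := continuous_on_boundary.
Implicit Types (f g phi : C^o -> C^o) (x y : R).

Lemma derivable_subC (w z : C^o) : derivable (fun z : C^o => z - w : C^o) z 1.
Proof.
apply/derivable_normcP; exists 1 => e e0; exists 1 => // v _.
have -> : v - w - (z - w) - 1 * (v - z) = 0 by ring.
by rewrite Normc.normc0 mulr_ge0 ?normc_ge0// ltW.
Qed.

Lemma derivable_div_subC f (w z : C^o) : z != w -> derivable f z 1 ->
  derivable (fun z => f z * (z - w)^-1 : C^o) z 1.
Proof.
move=> zw df; apply: (@derivableM _ _ f (fun z : C^o => (z - w)^-1 : C^o)); first exact: df.
by apply: derivableV; [rewrite subr_eq0|exact: derivable_subC].
Qed.

Lemma rectS x0 x1 y0 y1 x0' x1' y0' y1' (z : C) :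
  x0 <= x0' -> x1' <= x1 -> y0 <= y0' -> y1' <= y1 ->
  rect x0' x1' y0' y1' z -> rect x0 x1 y0 y1 z.
Proof.
move=> a b c d [/andP[z1 z2] /andP[z3 z4]]; split; apply/andP; split.
- exact: le_trans a z1.
- exact: le_trans z2 b.
- exact: le_trans c z3.
- exact: le_trans z4 d.
Qed.

(** Cutting along the sides of the small square leaves four rectangles on which
    [f] is holomorphic, so that Goursat's theorem applies to them. *)
Lemma rect_integral_shrink f (w : C) x0 x1 y0 y1 t : 0 < t ->
  x0 <= Re w - t -> Re w + t <= x1 -> y0 <= Im w - t -> Im w + t <= y1 ->
  (forall z, rect x0 x1 y0 y1 z -> z <> w -> derivable f z 1) ->
  J f x0 x1 y0 y1 = J f (Re w - t) (Re w + t) (Im w - t) (Im w + t).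
Proof.
move=> t0 a b c d df; set u := Re w in a b *; set v := Im w in c d *.
have ut : u - t <= u + t by lra.
have vt : v - t <= v + t by lra.
have a' := le_trans a ut; have b' := le_trans ut b.
have c' := le_trans c vt; have d' := le_trans vt d.
have neRe (z : C) : Re z <> u -> z <> w by move=> H E; apply: H; rewrite E.
have neIm (z : C) : Im z <> v -> z <> w by move=> H E; apply: H; rewrite E.
have ltne (p q : R) : p < q -> p <> q by move=> pq E; rewrite E ltxx in pq.
have gtne (p q : R) : q < p -> p <> q by move=> pq E; rewrite E ltxx in pq.
have utu : u - t < u by lra.
have uut : u < u + t by lra.
have vtv : v - t < v by lra.
have vvt : v < v + t by lra.
have x01 := le_trans a b'; have y01 := le_trans c d'.
have hor p q y : x0 <= p -> q <= x1 -> y0 <= y <= y1 -> y <> v ->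
    continuous_on_segment p q (fun x => f (Complex x y)).
  move=> xp qx yy yv; apply: continuous_on_horizontal => x /andP[px xq].
  by apply: df; [split=> //; rewrite (le_trans xp px) (le_trans xq qx)|exact: neIm].
have ver p q x : y0 <= p -> q <= y1 -> x0 <= x <= x1 -> x <> u ->
    continuous_on_segment p q (fun y => f (Complex x y)).
  move=> yp qy xx xu; apply: continuous_on_vertical => y /andP[py yq].
  by apply: df; [split=> //; rewrite (le_trans yp py) (le_trans yq qy)|exact: neRe].
have vy0 : y0 <> v by apply/ltne/(le_lt_trans c).
have vy1 : y1 <> v by apply/gtne/(lt_le_trans _ d).
have ly0 : y0 <= y0 <= y1 by rewrite lexx.
have ly1 : y0 <= y1 <= y1 by rewrite lexx y01.
rewrite (@rect_integral_splitx _ f x0 (u - t) x1)//; [|exact: hor..].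
rewrite goursat ?add0r//; last first.
  move=> z zr; apply: df; first exact: rectS zr.
  by apply/neRe/ltne/(le_lt_trans _ utu); case: zr => /andP[].
rewrite (@rect_integral_splitx _ f (u - t) (u + t) x1)//; [|exact: hor..].
rewrite [X in _ + X]goursat ?addr0//; last first.
  move=> z zr; apply: df; first exact: rectS zr.
  by apply/neRe/gtne/(lt_le_trans uut); case: zr => /andP[].
have lu0 : x0 <= u - t <= x1 by rewrite a b'.
have lu1 : x0 <= u + t <= x1 by rewrite a' b.
have nu0 : u - t <> u by exact: ltne.
have nu1 : u + t <> u by exact: gtne.
rewrite (@rect_integral_splity _ f _ _ y0 (v - t) y1)//; [|exact: ver..].
rewrite goursat ?add0r//; last first.
  move=> z zr; apply: df; first exact: rectS zr.
  by apply/neIm/ltne/(le_lt_trans _ vtv); case: zr => _ /andP[].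
rewrite (@rect_integral_splity _ f _ _ (v - t) (v + t) y1)//; [|exact: ver..].
rewrite [X in _ + X]goursat ?addr0//.
move=> z zr; apply: df; first exact: rectS zr.
by apply/neIm/gtne/(lt_le_trans vvt); case: zr => _ /andP[].
Qed.

(** Around [w] the rectangle can be shrunk to a square of half-side [t], along
    which the integral is [O(t)] since [f] is bounded near [w]. *)
Lemma goursat_punctured f (w : C) x0 x1 y0 y1 (k d : R) :
  x0 < Re w < x1 -> y0 < Im w < y1 ->
  (forall z, rect x0 x1 y0 y1 z -> z <> w -> derivable f z 1) ->
  0 < d -> (forall z : C, z <> w -> nc (z - w) < d -> nc (f z) <= k) ->
  J f x0 x1 y0 y1 = 0.
Proof.
move=> /andP[a b] /andP[c d'] df d0 fk.
apply/Normc.eq0_normc/eqP; rewrite eq_le normc_ge0 andbT.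
apply/ler_addgt0Pr => e e0; rewrite add0r.
pose k' := `|k| + 1; have k0 : 0 < k' by rewrite ltr_wpDl.
pose t := Num.min (Num.min (Re w - x0) (x1 - Re w))
  (Num.min (Num.min (Im w - y0) (y1 - Im w)) (Num.min (d / 4) (e / 16 / k'))).
have t0 : 0 < t by rewrite !lt_min !subr_gt0 a b c d' !divr_gt0.
have t1 : t <= Re w - x0 by rewrite !ge_min lexx.
have t2 : t <= x1 - Re w by rewrite !ge_min lexx !orbT.
have t3 : t <= Im w - y0 by rewrite !ge_min lexx !orbT.
have t4 : t <= y1 - Im w by rewrite !ge_min lexx !orbT.
have t5 : t <= d / 4 by rewrite !ge_min lexx !orbT.
have t6 : t <= e / 16 / k' by rewrite !ge_min lexx !orbT.
clearbody t.
have q1 : x0 <= Re w - t by clear -t1; lra.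
have q2 : Re w + t <= x1 by clear -t2; lra.
have q3 : y0 <= Im w - t by clear -t3; lra.
have q4 : Im w + t <= y1 by clear -t4; lra.
rewrite (@rect_integral_shrink f w _ _ _ _ t)//.
have ut : Re w - t <= Re w + t by clear -t0; lra.
have vt : Im w - t <= Im w + t by clear -t0; lra.
have bne (z : C) : rect_boundary (Re w - t) (Re w + t) (Im w - t) (Im w + t) z -> z <> w.
  by move=> [_ +] zw; rewrite zw => -[]; clear -t0; lra.
have fb : forall z, rect_boundary (Re w - t) (Re w + t) (Im w - t) (Im w + t) z -> nc (f z) <= k'.
  move=> z bz; apply: (@le_trans _ _ k); last by rewrite /k'; have := ler_norm k; lra.
  apply: fk; first exact: bne.
  have [[z1 z2] _] := bz.
  apply: (@le_lt_trans _ _ (2 * t)); last by clear -t5 t0 d0; lra.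
  apply: le_trans (normc_le_ReIm _) _.
  have -> : Re (z - w) = Re z - Re w by case: (z) (w) => ? ? [].
  have -> : Im (z - w) = Im z - Im w by case: (z) (w) => ? ? [].
  have -> : 2 * t = t + t by ring.
  by apply: lerD; rewrite ler_distl; [exact: z1|exact: z2].
apply: le_trans (normc_rect_integral ut vt _ fb) _.
  apply: (derivable_continuous_on_boundary ut vt) => z bz; apply: df; last exact: bne.
  by apply: rectS (bz.1).
have -> : 4 * k' * (Re w + t - (Re w - t) + (Im w + t - (Im w - t))) = t * (16 * k') by ring.
by rewrite -ler_pdivlMr ?mulr_gt0// invfM mulrA.
Qed.

Variable s : R.
Hypothesis s0 : 0 < s.

(** The factor [1 / (2 pi i)] is omitted; instead of dividing by [2 pi i] one
    compares with the transform of [1]. *)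
Definition cauchy_transform phi (w : C) : C :=
  J (fun z => phi z * (z - w)^-1) (- s) s (- s) s.
Local Notation T := cauchy_transform.
Local Notation bd := (rect_boundary (- s) s (- s) s).

Let ss : - s <= s. Proof. by move: s0; lra. Qed.

Let bd_ge (z : C) : bd z -> s <= nc z.
Proof.
move=> [_ H].
have [zs|zs] : `|Re z| = s \/ `|Im z| = s.
  by case: H => ->; rewrite ?normrN (gtr0_norm s0); auto.
- by rewrite -zs Re_le_normc.
- by rewrite -zs Im_le_normc.
Qed.

Let bd_ne (w z : C) : nc w < s -> bd z -> z != w.
Proof.
move=> ws /bd_ge sz; apply/eqP => zw; move: ws; rewrite -zw.
by rewrite ltNge sz.
Qed.

Let bc_bd phi : (forall z, bd z -> derivable phi z 1) -> bc phi (- s) s (- s) s.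
Proof. by move=> dphi; exact: (derivable_continuous_on_boundary ss ss). Qed.

Let dtrans phi (w : C) : nc w < s -> (forall z, bd z -> derivable phi z 1) ->
  forall z, bd z -> derivable (fun z : C^o => phi z * (z - w)^-1 : C^o) z 1.
Proof.
by move=> ws dphi z bz; apply: derivable_div_subC; [exact: bd_ne|exact: dphi].
Qed.

(** [(f z - f w) / (z - w)] is bounded near [w] and holomorphic elsewhere, so
    that its integral vanishes. *)
Lemma cauchy_formula f (w : C) : nc w < s ->
  (forall z, rect (- s) s (- s) s z -> derivable f z 1) ->
  T f w = f w * T (fun=> 1) w.
Proof.
move=> ws df.
have dfb (z : C^o) : bd z -> derivable f z 1 by move=> [zr _]; exact: df.
have d1 (z : C^o) : bd z -> derivable (fun=> 1 : C^o) z 1.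
  by move=> _; exact: derivable_cst.
have Rw : - s < Re w < s by rewrite -ltr_norml (le_lt_trans (Re_le_normc _)).
have Iw : - s < Im w < s by rewrite -ltr_norml (le_lt_trans (Im_le_normc _)).
have wr : rect (- s) s (- s) s w.
  by move: Rw Iw => /andP[? ?] /andP[? ?]; split; rewrite !ltW.
have [c fc] := (derivable_normcP f w).1 (df w wr).
have [d d0 dP] := fc 1 ltr01.
have E0 : J (fun z => (f z - f w) * (z - w)^-1) (- s) s (- s) s = 0.
  apply: (@goursat_punctured _ w _ _ _ _ (nc c + 1) d) => //.
    move=> z zr /eqP zw; apply: (@derivable_div_subC (fun z => f z - f w)) => //.
    by apply: derivableB; [exact: df|exact: derivable_cst].
  move=> z /eqP zw /dP; rewrite mul1r.
  have zw0 : z - w != 0 by rewrite subr_eq0.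
  have zwn : 0 < nc (z - w) by rewrite normc_gt0.
  rewrite Normc.normcM Normc.normcV ler_pdivrMr// mulrDl mul1r -Normc.normcM.
  have := normcD (c * (z - w)) (f z - f w - c * (z - w)).
  by rewrite addrC subrK; lra.
have E1 := rect_integralL (- f w) (bc_bd (dtrans ws d1)) (bc_bd (dtrans ws dfb)).
have E2 : (fun z : C^o => (f z - f w) * (z - w)^-1) =
    (fun z => (- f w) * ((fun=> 1) z * (z - w)^-1) + f z * (z - w)^-1).
  by apply/funext => z; ring.
move: E0; rewrite E2 => E0.
have := etrans (esym E1) E0; rewrite -/(T _ _) -/(T _ _) mulNr => H.
by apply/eqP; rewrite -subr_eq0 addrC H.
Qed.

(** This integrates [1 / (z - w) = 1 / z + w / (z * (z - w))]. Repeated use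
    expands a Cauchy transform in powers of [w], the remainder being a Cauchy
    transform again. *)
Lemma cauchy_transformD phi (w : C) : nc w < s ->
  (forall z, bd z -> derivable phi z 1) ->
  T phi w = T phi 0 + w * T (fun z => phi z * (z - 0)^-1) w.
Proof.
move=> ws dphi.
have s00 : nc (0 : C) < s by rewrite Normc.normc0.
have d0 := dtrans s00 dphi.
have E1 := rect_integralL w (bc_bd (dtrans ws d0)) (bc_bd d0).
rewrite [RHS]addrC -[RHS]E1.
apply: (eq_rect_integral ss ss) => z bz.
have z0 := bd_ne s00 bz; have zw := bd_ne ws bz.
rewrite -subr_eq0 in zw; rewrite subr0.
by field; rewrite zw z0.
Qed.

Lemma cauchy_transform_bounded phi : (forall z, bd z -> derivable phi z 1) ->
  exists k : R, forall w : C, nc w <= s / 2 -> nc (T phi w) <= k.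
Proof.
move=> dphi; have [b1 b2 b3 b4] := bc_bd dphi.
have [k1 H1] := continuous_on_segment_bounded ss b1.
have [k2 H2] := continuous_on_segment_bounded ss b2.
have [k3 H3] := continuous_on_segment_bounded ss b3.
have [k4 H4] := continuous_on_segment_bounded ss b4.
pose k := `|k1| + `|k2| + `|k3| + `|k4|.
have k0 : 0 <= k by rewrite !addr_ge0.
have kP z : bd z -> nc (phi z) <= k.
  case: z => x y [[/= xs ys] [] /= E].
  - rewrite E; apply: le_trans (H4 y ys) _; rewrite /k; have := ler_norm k4.
    have := normr_ge0 k1; have := normr_ge0 k2; have := normr_ge0 k3; lra.
  - rewrite E; apply: le_trans (H3 y ys) _; rewrite /k; have := ler_norm k3.
    have := normr_ge0 k1; have := normr_ge0 k2; have := normr_ge0 k4; lra.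
  - rewrite E; apply: le_trans (H1 x xs) _; rewrite /k; have := ler_norm k1.
    have := normr_ge0 k4; have := normr_ge0 k2; have := normr_ge0 k3; lra.
  - rewrite E; apply: le_trans (H2 x xs) _; rewrite /k; have := ler_norm k2.
    have := normr_ge0 k1; have := normr_ge0 k4; have := normr_ge0 k3; lra.
exists (4 * (k * (s / 2)^-1) * ((s - - s) + (s - - s))) => w ws.
have ws' : nc w < s by apply: le_lt_trans ws _; move: s0; lra.
apply: (normc_rect_integral ss ss); first exact/bc_bd/dtrans.
move=> z bz; rewrite Normc.normcM Normc.normcV.
have zw : s / 2 <= nc (z - w).
  have := bd_ge bz; have := normcD (z - w) w; rewrite subrK; move: ws; lra.
have s2 : 0 < s / 2 by rewrite divr_gt0.
by rewrite ler_pM ?kP ?normc_ge0 ?invr_ge0 ?lef_pV2 ?posrE ?(lt_le_trans s2) ?normc_ge0.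
Qed.

(** In the second order expansion the remainder is [o(w)], because Cauchy
    transforms are bounded near [0]. *)
Lemma derivable_cauchy_transform phi : (forall z, bd z -> derivable phi z 1) ->
  derivable (T phi : C^o -> C^o) 0 1.
Proof.
move=> dphi; have s00 : nc (0 : C) < s by rewrite Normc.normc0.
pose phi1 : C^o -> C^o := fun z => phi z * (z - 0)^-1.
pose phi2 : C^o -> C^o := fun z => phi1 z * (z - 0)^-1.
have d1 : forall z, bd z -> derivable phi1 z 1 by exact: dtrans.
have d2 : forall z, bd z -> derivable phi2 z 1 by exact: dtrans.
have [k kP] := cauchy_transform_bounded d2.
apply/derivable_normcP; exists (T phi1 0) => e e0.
pose k' := `|k| + 1; have k0 : 0 < k' by rewrite ltr_wpDl.
exists (Num.min (s / 2) (e / k')); first by rewrite lt_min !divr_gt0.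
move=> w; rewrite !subr0 lt_min => /andP[w1 w2].
have ws : nc w < s by apply: lt_trans w1 _; move: s0; lra.
rewrite (cauchy_transformD ws dphi) (cauchy_transformD ws d1) -/phi2.
have -> : T phi 0 + w * (T phi1 0 + w * T phi2 w) - T phi 0 - T phi1 0 * w =
    (w * T phi2 w) * w by ring.
rewrite !Normc.normcM ler_wpM2r ?normc_ge0//.
rewrite (@le_trans _ _ (nc w * k'))//.
  rewrite ler_wpM2l ?normc_ge0// (le_trans (kP _ (ltW w1)))//.
  by rewrite /k'; have := ler_norm k; lra.
by rewrite -ler_pdivlMr// ltW.
Qed.

(** On each of the four sides the integrand of the imaginary part of the
    integral of [1 / z dz] is positive. *)
Lemma cauchy_transform1_neq0 : T (fun=> 1) 0 != 0.
Proof.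
have s00 : nc (0 : C) < s by rewrite Normc.normc0.
have d1 (z : C^o) : bd z -> derivable (fun=> 1 : C^o) z 1.
  by move=> _; exact: derivable_cst.
have [b1 b2 b3 b4] := bc_bd (dtrans s00 d1).
rewrite /T /J; set c1 := segment_integral _ _ _; set c2 := segment_integral _ _ _.
set c3 := segment_integral _ _ _; set c4 := segment_integral _ _ _.
(* the minimum of that integrand, reached at the corners *)
pose m := s / (s ^+ 2 + s ^+ 2).
have m0 : 0 < m by rewrite divr_gt0// addr_gt0// exprn_gt0.
have sE : 0 < s - - s by rewrite opprK addr_gt0.
have inv (x y : R) : (1 * (Complex x y - 0)^-1 : C) =
    Complex (x / (x ^+ 2 + y ^+ 2)) (- y / (x ^+ 2 + y ^+ 2)).
  by rewrite mul1r subr0; simpc.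
have den (x : R) : - s <= x <= s -> m <= s / (s ^+ 2 + x ^+ 2).
  move=> /andP[xs1 xs2]; rewrite /m ler_pM2l// lef_pV2 ?posrE; last 2 first.
  - by rewrite addr_gt0// exprn_gt0.
  - by rewrite ltr_wpDr ?sqr_ge0// exprn_gt0.
  by rewrite lerD2l -subr_ge0 subr_sqr mulr_ge0//; move: xs1 xs2; lra.
have low (f : R -> R) : (forall x : R, - s <= x <= s -> {for x, continuous f}) ->
    (forall x, - s <= x <= s -> m <= f x) ->
    m * (s - - s) <= (\int[lebesgue_measure]_(x in `[- s, s]) f x)%R.
  move=> cf mf.
  have -> : m * (s - - s) = (\int[lebesgue_measure]_(x in `[- s, s]) m)%R.
    by rewrite Rintegral_cst//= lebesgue_measure_itv/= lte_fin (lt_trans _ s0) ?oppr_lt0.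
  apply: le_Rintegral => //; last exact: integrable_segment.
  by apply: integrable_segment => x _; exact: cvg_cst.
have msp : 0 < m * (s - - s) by rewrite mulr_gt0.
have c1P : m * (s - - s) <= Im c1.
  apply: low; first by move=> x /b1[].
  by move=> x xs; rewrite inv /= opprK sqrrN addrC; exact: den.
have lowN (f : R -> R) : (forall x : R, - s <= x <= s -> {for x, continuous f}) ->
    (forall x, - s <= x <= s -> f x <= - m) ->
    (\int[lebesgue_measure]_(x in `[- s, s]) f x)%R <= - (m * (s - - s)).
  move=> cf mf.
  have -> : - (m * (s - - s)) = (\int[lebesgue_measure]_(x in `[- s, s]) (- m))%R.
    rewrite Rintegral_cst//= lebesgue_measure_itv/= lte_fin (lt_trans _ s0) ?oppr_lt0//=.
    by rewrite mulNr.
  apply: le_Rintegral => //; first exact: integrable_segment.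
  by apply: integrable_segment => x _; exact: cvg_cst.
have c2P : Im c2 <= - (m * (s - - s)).
  apply: lowN; first by move=> x /b2[].
  by move=> x xs; rewrite inv /= mulNr lerN2 addrC; exact: den.
have c3P : m * (s - - s) <= Re c3.
  apply: low; first by move=> x /b3[].
  by move=> x xs; rewrite inv /=; exact: den.
have c4P : Re c4 <= - (m * (s - - s)).
  apply: lowN; first by move=> x /b4[].
  by move=> x xs; rewrite inv /= mulNr lerN2 sqrrN; exact: den.
have ImE : Im (c1 - c2 + 'i%C * (c3 - c4)) = Im c1 - Im c2 + (Re c3 - Re c4).
  by case: (c1) (c2) (c3) (c4) => ? ? [? ?] [? ?] [? ?] /=; ring.
apply/eqP => E; have E0 : Im c1 - Im c2 + (Re c3 - Re c4) = 0 by rewrite -ImE E.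
by move: (m * _) msp (Im c1) (Im c2) (Re c3) (Re c4) c1P c2P c3P c4P E0 => *; lra.
Qed.

End CauchyFormula.

(** * Division of holomorphic functions by the square of the variable *)

Section SecondOrder.
Context {R : realType}.
Local Notation C := R[i].

(** Expand both [T f] and [T 1] to second order at [0]. As [f w * T 1 w = T f w],
    the choice of [c] that cancels the first order terms gives
    [f w - c * w = w ^+ 2 * G w] near [0], where [G] is built from Cauchy
    transforms and is therefore differentiable at [0]. *)
Lemma holomorphic_divided (U : set C^o) (f : C^o -> C^o) :
  open U -> U 0 -> holomorphic_on U f -> f 0 = 0 ->
  exists (c : C) (g : C^o -> C^o),
    holomorphic_on U g /\ f = (fun z => c * z + (z * g z) * z).
Proof.
move=> oU U0 hf f0.
have /near_normcP[d d0 dU] : \forall z \near (0 : C^o), U z by exact: open_nbhs_nbhs.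
pose s := d / 4; have s0 : 0 < s by rewrite divr_gt0.
have df (z : C) : rect (- s) s (- s) s z -> derivable f z 1.
  move=> [z1 z2]; apply/hf/dU; rewrite subr0.
  apply: le_lt_trans (normc_le_ReIm _) _.
  have : `|complex.Re z| + `|complex.Im z| <= s + s by rewrite lerD ?ler_norml.
  by move=> H; apply: le_lt_trans H _; rewrite /s; lra.
pose bd z := rect_boundary (- s) s (- s) s z.
have s00 : nc (0 : C) < s by rewrite Normc.normc0.
have bd_ne (z : C) : bd z -> z != 0.
  move=> [_ H]; apply/eqP => z0; move: H; rewrite z0 /= => -[]; lra.
have dtrans (phi : C^o -> C^o) : (forall z, bd z -> derivable phi z 1) ->
    forall z, bd z -> derivable (fun z : C^o => phi z * (z - 0)^-1 : C^o) z 1.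
  by move=> dphi z bz; apply: derivable_div_subC; [exact: bd_ne|exact: dphi].
have dfb (z : C^o) : bd z -> derivable f z 1 by move=> [zr _]; exact: df.
have d1 (z : C^o) : bd z -> derivable (fun=> 1 : C^o) z 1.
  by move=> _; exact: derivable_cst.
pose T := cauchy_transform s.
pose f1 : C^o -> C^o := fun z => f z * (z - 0)^-1.
pose f2 : C^o -> C^o := fun z => f1 z * (z - 0)^-1.
pose e1 : C^o -> C^o := fun z => 1 * (z - 0)^-1.
pose e2 : C^o -> C^o := fun z => e1 z * (z - 0)^-1.
have df1 : forall z, bd z -> derivable f1 z 1 := dtrans f dfb.
have df2 : forall z, bd z -> derivable f2 z 1 := dtrans f1 df1.
have de1 : forall z, bd z -> derivable e1 z 1 := dtrans (fun=> 1) d1.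
have de2 : forall z, bd z -> derivable e2 z 1 := dtrans e1 de1.
have W0 := cauchy_transform1_neq0 s0; rewrite -/(T _ _) in W0.
pose W : C^o -> C^o := T (fun=> 1).
pose c := T f1 0 / W 0.
pose G : C^o -> C^o := fun w => (T f2 w - c * T e1 0 - c * w * T e2 w) * (W w)^-1.
have dW : derivable W 0 1 := derivable_cauchy_transform s0 d1.
pose P1 : C^o -> C^o := fun w => T f2 w - c * T e1 0.
pose P2 : C^o -> C^o := fun w => c * w.
have dP2 (w : C^o) : derivable P2 w 1.
  by apply: (@derivableM _ _ (fun=> c : C^o) id); [exact: derivable_cst|exact: derivable_id].
have dG : derivable G 0 1.
  apply: (@derivableM _ _ (fun w : C^o => P1 w - P2 w * T e2 w : C^o) (fun w : C^o => (W w)^-1 : C^o)).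
    apply: (@derivableB _ _ _ P1 (fun w : C^o => P2 w * T e2 w : C^o)).
      apply: (@derivableB _ _ _ (T f2 : C^o -> C^o) (fun=> c * T e1 0 : C^o)).
        exact: (derivable_cauchy_transform s0 df2).
      exact: derivable_cst.
    apply: (@derivableM _ _ P2 (T e2 : C^o -> C^o)); first exact: dP2.
    exact: (derivable_cauchy_transform s0 de2).
  by apply: derivableV; [exact: W0|exact: dW].
have fW w : nc w < s -> f w * W w = w * T f1 0 + w ^+ 2 * T f2 w.
  move=> ws.
  have E0 : T f 0 = 0 by rewrite /T (cauchy_formula s0 s00 df) f0 mul0r.
  have E : T f w = f w * W w := cauchy_formula s0 ws df.
  have E1 : T f w = T f 0 + w * T f1 w := cauchy_transformD s0 ws dfb.
  have E2 : T f1 w = T f1 0 + w * T f2 w := cauchy_transformD s0 ws df1.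
  by rewrite -E E1 E2 E0; ring.
have WE w : nc w < s -> W w = W 0 + w * T e1 0 + w ^+ 2 * T e2 w.
  move=> ws.
  have E1 : W w = W 0 + w * T e1 w := cauchy_transformD s0 ws d1.
  have E2 : T e1 w = T e1 0 + w * T e2 w := cauchy_transformD s0 ws de1.
  by rewrite E1 E2; ring.
have nearW : \forall w \near (0 : C^o), nc w < s /\ W w != 0.
  have W0n : 0 < nc (W 0) by rewrite normc_gt0; exact: W0.
  have [d' d'0 d'P] := derivable_continuous_normc dW W0n.
  apply/near_normcP; exists (Num.min s d'); first by rewrite lt_min s0.
  move=> w; rewrite subr0 lt_min => /andP[ws wd']; split=> //.
  apply/eqP => Ww; have := d'P w; rewrite subr0 => /(_ wd').
  by rewrite Ww sub0r normcN ltxx.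
pose g : C^o -> C^o := fun z => if z == 0 then G 0 else (f z - c * z) * (z ^+ 2)^-1.
exists c, g; split; last first.
  apply/funext => z; rewrite /g; case: eqVneq => [->|z0].
    by rewrite f0 !mulr0 addr0.
  by field.
move=> z Uz; have [->|z0] := eqVneq z 0.
  apply: near_eq_derivable dG; near=> w.
  have [ws Ww] : nc w < s /\ W w != 0 by near: w.
  rewrite /g; case: eqVneq => [->//|w0].
  have := fW _ ws; rewrite /G => E.
  have -> : f w = (w * T f1 0 + w ^+ 2 * T f2 w) / W w by rewrite -E mulfK.
  have T1E : T f1 0 = c * W 0 by rewrite /c mulfVK.
  rewrite T1E.
  have -> : W 0 = W w - w * T e1 0 - w ^+ 2 * T e2 w by rewrite (WE _ ws); ring.
  by field; rewrite Ww w0.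
have nz : \forall w \near z, w != 0.
  by apply/near_normcP; exists (nc z); rewrite ?normc_gt0// => w wz; apply/eqP => w0;
    move: wz; rewrite w0 sub0r normcN ltxx.
apply: (@near_eq_derivable _ _ _ (fun w : C^o => (f w - c * w) * (w ^+ 2)^-1 : C^o)).
  by near=> w; rewrite /g ifN//; near: w.
apply: (@derivableM _ _ (fun w : C^o => f w - c * w : C^o) (fun w : C^o => (w ^+ 2)^-1 : C^o)).
  by apply: (@derivableB _ _ _ f P2); [exact: hf|exact: dP2].
apply: derivableV; first by rewrite expf_neq0.
by apply: (@derivableM _ _ id id); exact: derivable_id.
Unshelve. all: by end_near. Qed.

End SecondOrder.

(** * Functional calculus in sets with the sandwich property *)

(** The completion of an algebra has to be a module of its own and not a subset
    of [X]; [w] takes the value [0] outside [P]. *)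
Lemma submodule_lmodType (K : nzRingType) (X : lmodType K) (P : set X) :
  P 0 -> (forall (c : K) a b, P a -> P b -> P (c *: a + b)) ->
  exists (B : lmodType K) (v : B -> X) (w : X -> B),
    [/\ linear v, forall b, P (v b), cancel v w &
        forall x, P x -> v (w x) = x].
Proof.
move=> P0 PZ; pose p : {pred X} := fun x => `[< P x >].
have pcl : subsemimod_closed p.
  split; first split.
  - exact/asboolP.
  - move=> a b /asboolP Pa /asboolP Pb; apply/asboolP.
    by rewrite -[a]scale1r; exact: PZ.
  - move=> c a /asboolP Pa; apply/asboolP.
    by rewrite -[c *: a]addr0; exact: PZ.
pose T := {x : X | p x}.
pose subm := GRing.SubChoice_isSubLmodule.Build K X p T pcl.
pose B : lmodType K := HB.pack T subm.
exists B, (fun b : B => sval b), (fun x => insubd (0 : B) x); split.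
- by [].
- by move=> b; apply/asboolP; exact: (valP b).
- by move=> b; exact: valKd.
- by move=> x Px; rewrite insubdK//; apply/asboolP.
Qed.

Section Calculus.
Context {R : realType}.
Local Notation C := R[i].

(** The calculus gives [f(a) = c a + (a g(a)) a], with the factor [g(a)] in the
    middle arbitrary. *)
Lemma closed_calculus_in_sandwich (X : lmodType C) (mul : X -> X -> X)
    (norm : X -> R) (e : X) (A : set X) :
  (forall (c : C) a b, A a -> A b -> A (c *: a + b)) ->
  (forall a b c, A a -> A c -> A (mul (mul a b) c)) ->
  (has_unit mul A -> A = setT) ->
  closed_calculus_in mul norm e A.
Proof.
move=> AZ Asand Aunit a U Phi f Aa oU _ [[_ Phi_id] PhiZ PhiM _] hf f0.
have [/Aunit -> //|nu] := pselect (has_unit mul A).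
have [U0 f00] := f0 nu.
have [c [g [hg ->]]] := holomorphic_divided oU U0 hf f00.
have hid : holomorphic_on U id by move=> z _; exact: derivable_id.
have hM f1 f2 : holomorphic_on U f1 -> holomorphic_on U f2 ->
    holomorphic_on U (fun z => f1 z * f2 z).
  by move=> h1 h2 z Uz; apply: derivableM; [exact: h1|exact: h2].
have hzg := hM _ _ hid hg.
have E1 := PhiZ c id (fun z => (z * g z) * z) hid (hM _ _ hzg hid).
have E2 := PhiM (fun z => z * g z) id hzg hid.
have E3 := PhiM id g hid hg.
rewrite [Phi _]E1 [X in _ + X]E2 [X in mul X _]E3 Phi_id.
exact/AZ/Asand.
Qed.

(** In the unitization, [(0, a) (l, b) (0, c) = (0, l a c + a b c)]: the
    sandwich property passes to it. *)
Lemma closed_calculus_sandwich (X : lmodType C) (mul : X -> X -> X)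
    (norm : X -> R) (A : set X) :
  (forall (c : C) a b d, mul (c *: a + b) d = c *: mul a d + mul b d) ->
  (forall (c : C) a b d, mul d (c *: a + b) = c *: mul d a + mul d b) ->
  (forall (c : C) a b, A a -> A b -> A (c *: a + b)) ->
  (forall a b, A a -> A b -> A (mul a b)) ->
  (forall a b c, A a -> A c -> A (mul (mul a b) c)) ->
  (has_unit mul A -> A = setT) ->
  closed_calculus mul norm A.
Proof.
move=> mulDl mulDr AZ AM Asand Aunit; split=> [e _|nu].
  exact: closed_calculus_in_sandwich.
have mul0x a : mul 0 a = 0.
  by have := mulDl (-1) a a a; rewrite !scaleN1r !addNr.
have mulx0 a : mul a 0 = 0.
  by have := mulDr (-1) a a a; rewrite !scaleN1r !addNr.
have mulZl (c : C) a b : mul (c *: a) b = c *: mul a b.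
  by have := mulDl c a 0 b; rewrite mul0x !addr0.
apply: closed_calculus_in_sandwich.
- move=> c _ _ [a Aa <-] [b Ab <-]; exists (c *: a + b); first exact: AZ.
  by congr pair; rewrite /= scaler0 addr0.
- move=> _ [l b] _ [a Aa <-] [c Ac <-].
  exists (l *: mul a c + mul (mul a b) c).
    by apply: AZ; [exact: AM|exact: Asand].
  rewrite /unitization_mul /= !mul0r; congr pair.
  by rewrite !scale0r !add0r mulDl.
(* a unit [(0, e0)] of [A] in the unitization makes [e0] a unit of [A], so that
   [A = setT] and [e0] is a unit of the whole algebra *)
- move=> [e [[e0 Ae0 <-] ue]]; exfalso; apply: nu; exists e0; split=> //.
  have Ae : A = setT.
    apply: Aunit; exists e0; split=> // a Aa.
    have [|] := ue (0, a); first by exists a.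
    rewrite /unitization_mul /= !scale0r !add0r.
    by move=> /(congr1 snd) /= -> /(congr1 snd) /= ->.
  move=> a _; have [|] := ue (0, a); first by exists a => //; rewrite Ae.
  rewrite /unitization_mul /= !scale0r !add0r.
  by move=> /(congr1 snd) /= -> /(congr1 snd) /= ->.
Qed.

(** The entries of [a b c] are sums of sandwiches [(a i k * b k l) * c l j]; and
    the upper left entry of a unit matrix is a unit of [A], as multiplying with
    matrices supported in this entry shows. *)
Lemma closed_calculus_matrices (X : lmodType C) (mul : X -> X -> X)
    (norm : X -> R) (A : set X) m :
  (forall (c : C) a b d, mul (c *: a + b) d = c *: mul a d + mul b d) ->
  (forall (c : C) a b d, mul d (c *: a + b) = c *: mul d a + mul d b) ->
  A 0 ->
  (forall (c : C) a b, A a -> A b -> A (c *: a + b)) ->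
  (forall a b, A a -> A b -> A (mul a b)) ->
  (forall a b c, A a -> A c -> A (mul (mul a b) c)) ->
  (has_unit mul A -> A = setT) ->
  closed_calculus (@matrix_mul _ X mul m.+1) (@matrix_norm _ X norm m.+1)
    (matrices_over A).
Proof.
move=> mulDl mulDr A0 AZ AM Asand Aunit.
have mul0x a : mul 0 a = 0.
  by have := mulDl (-1) a a a; rewrite !scaleN1r !addNr.
have mulx0 a : mul a 0 = 0.
  by have := mulDr (-1) a a a; rewrite !scaleN1r !addNr.
have mulD1 a b d : mul (a + b) d = mul a d + mul b d.
  by have := mulDl 1 a b d; rewrite !scale1r.
have AD a b : A a -> A b -> A (a + b).
  by move=> Aa Ab; rewrite -[a]scale1r; exact: AZ.
have Asum (I : Type) (s : seq I) (P : pred I) F :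
    (forall i, P i -> A (F i)) -> A (\sum_(i <- s | P i) F i).
  by move=> AF; apply: big_ind.
have mul_suml (I : Type) (s : seq I) (F : I -> X) d :
    mul (\sum_(i <- s) F i) d = \sum_(i <- s) mul (F i) d.
  by elim/big_rec2 : _ => // i x y _ <-; rewrite mulD1.
have fct_sumE (I : Type) (s : seq I) (F : I -> alg_matrix X m.+1) i j :
    (\sum_(k <- s) F k) i j = \sum_(k <- s) F k i j.
  by elim/big_rec2 : _ => // k x y _ <-.
apply: closed_calculus_sandwich.
- move=> c a b d; apply/funext => i; apply/funext => j; rewrite /matrix_mul.
  transitivity (\sum_k (c *: mul (a i k) (d k j) + mul (b i k) (d k j))).
    by apply: eq_bigr => k _; exact: mulDl.
  by rewrite big_split /= -scaler_sumr.
- move=> c a b d; apply/funext => i; apply/funext => j; rewrite /matrix_mul.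
  transitivity (\sum_k (c *: mul (d i k) (a k j) + mul (d i k) (b k j))).
    by apply: eq_bigr => k _; exact: mulDr.
  by rewrite big_split /= -scaler_sumr.
- by move=> c a b Aa Ab i j; exact: AZ.
- by move=> a b Aa Ab i j; apply: Asum => k _; exact: AM.
- move=> a b c Aa Ac i j; apply/Asum => k _; rewrite /matrix_mul mul_suml.
  by apply: Asum => l _; exact: Asand.
- move=> [e [Ae ue]].
  suff -> : A = setT by apply/seteqP; split.
  apply: Aunit; exists (e ord0 ord0); split=> // a Aa.
  pose d : alg_matrix X m.+1 := fun i j => if (i == ord0) && (j == ord0) then a else 0.
  have [|ed de] := ue d; first by move=> i j; rewrite /d; case: ifP.
  split.
    have := congr1 (fun x : alg_matrix X m.+1 => x ord0 ord0) ed.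
    rewrite /matrix_mul /d /= (bigD1 ord0)//= big1 ?addr0// => i /negbTE ->.
    by rewrite mulx0.
  have := congr1 (fun x : alg_matrix X m.+1 => x ord0 ord0) de.
  rewrite /matrix_mul /d /= (bigD1 ord0)//= big1 ?addr0// => i /negbTE ->.
  by rewrite mul0x.
Qed.

End Calculus.

(** * Local C*-algebras from the sandwich property *)

Section Sandwich.
Context {R : realType}.
Local Notation C := R[i].
Variables (X : lmodType C) (mul : X -> X -> X) (star : X -> X) (norm : X -> R).
Implicit Types (a b d : X) (L A : set X).

Definition norm_closure L A : set X :=
  [set b | L b /\ forall eps : R, 0 < eps -> exists2 a, A a & norm (b - a) < eps].

Lemma normed_star_algebraW L A :
  normed_star_algebra mul star norm L -> A `<=` L -> A 0 ->
  (forall (c : C) a b, A a -> A b -> A (c *: a + b)) ->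
  (forall a b, A a -> A b -> A (mul a b)) ->
  (forall a, A a -> A (star a)) ->
  normed_star_algebra mul star norm A.
Proof.
move=> [_ [m1 m2 m3] [s1 s2 s3] [n1 n2 n3 n4]] AL A0 AZ AM As.
have T x : A x -> L x := AL x.
split=> //; split.
- by move=> c a b d /T La /T Lb /T Ld; exact: m1.
- by move=> c a b d /T La /T Lb /T Ld; exact: m2.
- by move=> a b d /T La /T Lb /T Ld; exact: m3.
- by move=> c a b /T La /T Lb; exact: s1.
- by move=> a b /T La /T Lb; exact: s2.
- by move=> a /T; exact: s3.
- by move=> a /T; exact: n1.
- by move=> c a /T; exact: n2.
- by move=> a b /T La /T Lb; exact: n3.
- by move=> a b /T La /T Lb; exact: n4.
Qed.

Lemma normed_star_algebra_norm (norm' : X -> R) A :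
  normed_star_algebra mul star norm A -> (forall a, A a -> norm' a = norm a) ->
  normed_star_algebra mul star norm' A.
Proof.
move=> [[A0 AZ AM As] m s [n1 n2 n3 n4]] nE.
have AZ' (c : C) a : A a -> A (c *: a).
  by move=> Aa; rewrite -[_ *: _]addr0; exact: AZ.
split=> //; split.
- by move=> a Aa; rewrite nE//; exact: n1.
- by move=> c a Aa; rewrite !nE ?n2//; exact: AZ'.
- move=> a b Aa Ab; rewrite !nE ?n3// -[a]scale1r.
  exact: AZ.
- by move=> a b Aa Ab; rewrite !nE ?n4//; exact: AM.
Qed.

(** [norm a ^+ 2 = norm (mul (star a) a) <= norm (star a) * norm a], and
    likewise for [star a]. *)
Lemma star_isometry L : normed_star_algebra mul star norm L ->
  (forall a, L a -> norm (mul (star a) a) = norm a ^+ 2) ->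
  forall a, L a -> norm (star a) = norm a.
Proof.
move=> [[_ _ LM Ls] _ [_ _ starK] [n1 _ _ n4]] Cstar.
have le a : L a -> norm a <= norm (star a).
  move=> La; have [] := n1 _ La; rewrite le_eqVlt => /orP[/eqP<- _|a0 _].
    exact: (n1 _ (Ls _ La)).1.
  rewrite -(ler_pM2r a0) -expr2 -Cstar//; apply: n4 => //; exact: Ls.
move=> a La; apply/eqP; rewrite eq_le le// andbT.
by rewrite -[leRHS]/(norm a) -{2}[a]starK//; apply: le; exact: Ls.
Qed.

(** The completion is the closure [P] of [A] in [L], as a module [B] of its own.
    By the lemmas above it remains to see that a unital [A] is all of [P]. A unit
    [e] of [A] satisfies [e a e = a] for [a] in [A], hence for [a] in [P] by
    continuity, and [e a e] is in [A] by the sandwich property. *)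
Theorem local_Cstar_sandwich L A :
  normed_star_algebra mul star norm L ->
  (forall a, L a -> norm (mul (star a) a) = norm a ^+ 2) ->
  (forall a : nat -> X, (forall i, L (a i)) ->
     (forall eps : R, 0 < eps -> exists N, forall i j,
        (N <= i)%N -> (N <= j)%N -> norm (a i - a j) < eps) ->
     exists2 b, L b & norm (a i - b) @[i --> \oo] --> (0 : R)) ->
  A `<=` L -> A 0 ->
  (forall (c : C) a b, A a -> A b -> A (c *: a + b)) ->
  (forall a b, A a -> A b -> A (mul a b)) ->
  (forall a, A a -> A (star a)) ->
  (forall a b d, A a -> norm_closure L A b -> A d -> A (mul (mul a b) d)) ->
  local_Cstar_algebra mul star norm A.
Proof.
move=> HL Cstar Lcomplete AL A0 AZ AM As Asand; split.
  exact: (normed_star_algebraW HL).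
have star_norm := star_isometry HL Cstar.
have [[L0 LZ LM Ls] [m1 m2 m3] [s1 s2 s3] [n1 n2 n3 n4]] := HL.
have LN a : L a -> L (- a).
  by move=> La; rewrite -[- a]addr0 -scaleN1r; exact: LZ.
have LB a b : L a -> L b -> L (a - b).
  by move=> La Lb; rewrite -[a]scale1r; apply/LZ/LN.
have norm_ge0 a : L a -> 0 <= norm a by move=> /n1[].
have norm0 : norm 0 = 0.
  by rewrite -[X in norm X](scale0r 0) n2// Normc.normc0 mul0r.
have normN a : L a -> norm (- a) = norm a.
  by move=> La; rewrite -scaleN1r n2// normcN Normc.normc1 mul1r.
have mulBl a b d : L a -> L b -> L d -> mul (a - b) d = mul a d - mul b d.
  move=> La Lb Ld; rewrite addrC -scaleN1r m1// scaleN1r addrC//.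
have mulBr a b d : L a -> L b -> L d -> mul d (a - b) = mul d a - mul d b.
  move=> La Lb Ld; rewrite addrC -scaleN1r m2// scaleN1r addrC//.
pose P := norm_closure L A.
have PL : P `<=` L by move=> a [].
have AP : A `<=` P.
  by move=> a Aa; split=> [|e e0]; [exact: AL|exists a => //; rewrite subrr norm0].
have PZ (c : C) a b : P a -> P b -> P (c *: a + b).
  move=> [La Pa] [Lb Pb]; split=> [|e e0]; first exact: LZ.
  pose k := Normc.normc c + 1.
  have c0 : 0 <= Normc.normc c by case: c @k => ? ?; exact: sqrtr_ge0.
  have k0 : 0 < k by rewrite ltr_wpDl.
  have [a' Aa' aa'] := Pa (e / 2 / k) ltac:(by rewrite !divr_gt0).
  have [b' Ab' bb'] := Pb (e / 2) ltac:(by rewrite divr_gt0).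
  exists (c *: a' + b'); first exact: AZ.
  rewrite opprD addrACA -scalerBr.
  have La' := AL _ Aa'; have Lb' := AL _ Ab'.
  apply: (le_lt_trans (n3 _ _ _ _)); [|exact: LB|].
    by rewrite -[_ *: _]addr0; apply: LZ => //; exact: LB.
  rewrite n2; last exact: LB.
  have : Normc.normc c * norm (a - a') <= e / 2.
    rewrite (@le_trans _ _ (k * norm (a - a')))//.
      by rewrite ler_wpM2r ?norm_ge0 ?lerDl//; exact: LB.
    by rewrite mulrC -ler_pdivlMr// ltW.
  by lra.
have PM a b : P a -> P b -> P (mul a b).
  move=> [La Pa] [Lb Pb]; split=> [|e e0]; first exact: LM.
  pose k := norm b + 1; have k0 : 0 < k by rewrite ltr_wpDl// norm_ge0.
  have [a' Aa' aa'] := Pa (e / 2 / k) ltac:(by rewrite !divr_gt0).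
  have La' := AL _ Aa'.
  pose l := norm a' + 1; have l0 : 0 < l by rewrite ltr_wpDl// norm_ge0.
  have [b' Ab' bb'] := Pb (e / 2 / l) ltac:(by rewrite !divr_gt0).
  have Lb' := AL _ Ab'.
  exists (mul a' b'); first exact: AM.
  have -> : mul a b - mul a' b' = mul (a - a') b + mul a' (b - b').
    by rewrite mulBl// mulBr// addrA subrK.
  apply: (le_lt_trans (n3 _ _ _ _)); [by apply: LM => //; exact: LB..|].
  have H1 := n4 _ _ (LB _ _ La La') Lb.
  have H2 := n4 _ _ La' (LB _ _ Lb Lb').
  have H3 : norm (a - a') * norm b <= e / 2.
    rewrite (@le_trans _ _ (norm (a - a') * k))//.
      by rewrite ler_wpM2l ?norm_ge0 ?lerDl//; exact: LB.
    by rewrite -ler_pdivlMr// ltW.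
  have H4 : norm a' * norm (b - b') < e / 2.
    rewrite (@le_lt_trans _ _ (l * norm (b - b')))//.
      by rewrite ler_wpM2r ?norm_ge0 ?lerDl//; exact: LB.
    by rewrite mulrC -ltr_pdivlMr.
  by lra.
have starB a b : L a -> L b -> star (a - b) = star a - star b.
  move=> La Lb; rewrite addrC -scaleN1r s1// addrC.
  by rewrite rmorphN1 scaleN1r.
have Ps a : P a -> P (star a).
  move=> [La Pa]; split=> [|e e0]; first exact: Ls.
  have [a' Aa' aa'] := Pa _ e0; exists (star a'); first exact: As.
  by rewrite -starB ?star_norm//; try exact: AL; apply: LB => //; exact: AL.
have P0 : P 0 by exact: AP.
have PHL : normed_star_algebra mul star norm P by exact: (normed_star_algebraW HL).
have [B [v [w [vlin Pv vK wK]]]] := submodule_lmodType P0 PZ.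
have vZ (c : C) x y : v (c *: x + y) = c *: v x + v y := vlin c x y.
have v0 : v 0 = 0 by have := vZ (-1) 0 0; rewrite !scaleN1r !addNr.
have vB x y : v (x - y) = v x - v y.
  by rewrite addrC -scaleN1r vZ scaleN1r addrC.
have Lv x : L (v x) by exact/PL.
have v_inj := can_inj vK.
pose mulB x y := w (mul (v x) (v y)).
pose starB' x := w (star (v x)).
pose normB x := norm (v x).
have vM x y : v (mulB x y) = mul (v x) (v y) by rewrite wK//; exact: PM.
have vs x : v (starB' x) = star (v x) by rewrite wK//; exact: Ps.
have mulBlin (c : C) x y z : mulB (c *: x + y) z = c *: mulB x z + mulB y z.
  by apply: v_inj; rewrite !(vM, vZ) m1.
have mulBlinr (c : C) x y z : mulB z (c *: x + y) = c *: mulB z x + mulB z y.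
  by apply: v_inj; rewrite !(vM, vZ) m2.
have wA a : A a -> v (w a) = a by move=> /AP /wK.
have jZ (c : C) x y : (w @` A) x -> (w @` A) y -> (w @` A) (c *: x + y).
  move=> [a Aa <-] [b Ab <-]; exists (c *: a + b); first exact: AZ.
  by apply: v_inj; rewrite vZ !wA//; exact: AZ.
have jM x y : (w @` A) x -> (w @` A) y -> (w @` A) (mulB x y).
  move=> [a Aa <-] [b Ab <-]; exists (mul a b); first exact: AM.
  by apply: v_inj; rewrite vM !wA//; exact: AM.
have jsand x y z : (w @` A) x -> (w @` A) z -> (w @` A) (mulB (mulB x y) z).
  move=> [a Aa <-] [b Ab <-].
  have Aab : A (mul (mul a (v y)) b) by apply: Asand => //; exact: Pv.
  by eexists; [exact: Aab|apply: v_inj; rewrite !vM !wA].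
have jA0 : (w @` A) 0 by exists 0 => //; apply: v_inj; rewrite v0 wA.
have junit : has_unit mulB (w @` A) -> w @` A = setT.
  move=> [e [Ae ue]]; apply/seteqP; split=> // x _.
  suff <- : mulB (mulB e x) e = x by exact: jsand.
  apply/eqP; rewrite -subr_eq0; apply/eqP/v_inj; rewrite v0.
  set y := _ - x.
  have Ly : L (v y) by exact: Lv.
  apply: (n1 _ Ly).2; apply/eqP; rewrite eq_le norm_ge0// andbT.
  apply/ler_addgt0Pr => eps eps0; rewrite add0r.
  pose k := norm (v e) * norm (v e) + 1.
  have k0 : 0 < k by rewrite ltr_wpDl// mulr_ge0// norm_ge0.
  have [a Aa xa] := (Pv x).2 (eps / k) ltac:(by rewrite divr_gt0).
  have La := AL _ Aa.
  (* [a] approximates [x], and [e a e = a], so that [e x e - x] is small *)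
  have eae : mul (mul (v e) a) (v e) = a.
    have [e1 e2] : mulB e (w a) = w a /\ mulB (w a) e = w a by apply: ue; exists a.
    by rewrite -{1}(wA a Aa) -vM e1 wA// -{1}(wA a Aa) -vM e2 wA.
  have -> : v y = mul (mul (v e) (v x - a)) (v e) + - (v x - a).
    rewrite /y vB !vM mulBr// mulBl//; [|exact: LM..].
    by rewrite eae opprB addrA subrK.
  have Lxa : L (v x - a) by exact: LB.
  apply: (le_trans (n3 _ _ _ _)); [exact: (LM _ _ (LM _ _ (Lv e) Lxa) (Lv e))|exact: LN|].
  rewrite normN//.
  have H1 := n4 _ _ (LM _ _ (Lv e) Lxa) (Lv e).
  have H2 := n4 _ _ (Lv e) Lxa.
  have H3 : norm (mul (v e) (v x - a)) * norm (v e) <=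
      norm (v e) * norm (v x - a) * norm (v e) by rewrite ler_wpM2r// norm_ge0.
  have H4 : norm (v x - a) * k <= eps by rewrite -ler_pdivlMr// ltW.
  by rewrite /k in H4; lra.
exists B, mulB, starB', normB, w; split.
- split.
  + split; split=> //.
    * by move=> x y z _ _ _; apply: v_inj; rewrite !vM m3.
    * by move=> c x y _ _; apply: v_inj; rewrite !(vs, vZ) s1.
    * by move=> x y _ _; apply: v_inj; rewrite !(vs, vM) s2.
    * by move=> x _; apply: v_inj; rewrite !vs s3.
    * move=> x _; split; first exact: norm_ge0.
      by move=> /(n1 _ (Lv x)).2 vx0; apply: v_inj; rewrite vx0 v0.
    * by move=> c x _; rewrite /normB -[c *: x]addr0 vZ v0 addr0 n2.
    * by move=> x y _ _; rewrite /normB -[x]scale1r vZ !scale1r n3.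
    * by move=> x y _ _; rewrite /normB vM n4.
  + by move=> x; rewrite /normB vM vs Cstar.
  + move=> x xC; have [|b Lb xb] := Lcomplete (v \o x) (fun i => Lv _).
      by move=> eps /xC[N xN]; exists N => i j Ni Nj; rewrite /= -vB; exact: xN.
    have Pb : P b.
      split=> // e e0.
      have /cvgrPdist_lt/(_ (e / 2) ltac:(by rewrite divr_gt0)) := xb.
      move=> [N _ /(_ N (leqnn N))] /=; rewrite sub0r normrN => xNb.
      have [a Aa xa] := (Pv (x N)).2 (e / 2) ltac:(by rewrite divr_gt0).
      exists a => //; have La := AL _ Aa.
      have -> : b - a = - (v (x N) - b) + (v (x N) - a).
        by rewrite opprB addrA subrK.
      apply: (le_lt_trans (n3 _ _ _ _)); [exact/LN/LB|exact: LB|].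
      rewrite normN; last exact: LB.
      by have := ler_norm (norm (v (x N) - b)); lra.
    exists (w b); rewrite /normB.
    by under eq_cvg do rewrite vB wK//.
- split=> //.
  + by move=> c a b Aa Ab; apply: v_inj; rewrite vZ !wA//; exact: AZ.
  + by move=> a b Aa Ab; apply: v_inj; rewrite vM !wA//; exact: AM.
  + by move=> a Aa; apply: v_inj; rewrite vs !wA//; exact: As.
  + by move=> a Aa; rewrite /normB wA.
  + move=> x e e0; have [a Aa xa] := (Pv x).2 e e0; exists a => //.
    have La := AL _ Aa.
    by rewrite /normB vB wA// -normN ?opprB//; exact: LB.
- exact: closed_calculus_sandwich.
- by move=> m; exact: closed_calculus_matrices.
Qed.

End Sandwich.

(** * Limits of complex sequences *)

Section ComplexLimits.
Context {R : realType}.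
Local Notation C := R[i].
Local Notation Re := complex.Re.
Local Notation Im := complex.Im.
Implicit Types (z w : nat -> C) (a b : C).

(** Limits with respect to the real-valued modulus avoid casts between [C] and
    [C^o] and complex radii; see [tends_toP]. *)
Definition tends_to z a : Prop :=
  forall e : R, 0 < e -> \forall i \near \oo, nc (z i - a) < e.

Lemma tends_toP z (a : C^o) : tends_to z a <-> (fun i => z i : C^o) @ \oo --> a.
Proof.
split=> [za|/cvgrPdist_lt za e e0].
  apply/cvgrPdist_lt => -[e b]; rewrite ltcE /= => /andP[/eqP -> e0].
  by near=> i; rewrite normr_normc ltcR normc_distC; near: i; exact: za.
have := za e%:C%C; rewrite ltcR => /(_ e0); apply: filterS => i.
by rewrite normr_normc ltcR normc_distC.
Unshelve. all: by end_near. Qed.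

Lemma normc_conj a : nc (a^*)%C = nc a.
Proof. by case: a => p q /=; rewrite sqrrN. Qed.

Lemma le_dist_normc a b : `|nc a - nc b| <= nc (a - b).
Proof.
have := normcD (a - b) b; have := normcD (b - a) a.
rewrite !subrK (normc_distC b) ler_norml => H1 H2.
by apply/andP; split; move: H1 H2; clear; lra.
Qed.

Lemma tends_to_cst a : tends_to (fun=> a) a.
Proof. by move=> e e0; near=> i; rewrite subrr Normc.normc0. Unshelve. all: by end_near. Qed.

Lemma tends_toJ z a : tends_to z a -> tends_to (fun i => (z i)^*)%C (a^*)%C.
Proof.
by move=> za e /za; apply: filterS => i; rewrite -rmorphB /= normc_conj.
Qed.

Lemma tends_toL (c : C) z w a b : tends_to z a -> tends_to w b ->
  tends_to (fun i => c * z i + w i) (c * a + b).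
Proof.
move=> za wb e e0.
pose k := nc c + 1; have k0 : 0 < k by rewrite ltr_wpDl// normc_ge0.
near=> i.
have -> : c * z i + w i - (c * a + b) = c * (z i - a) + (w i - b) by ring.
apply: le_lt_trans (normcD _ _) _; rewrite Normc.normcM.
have H1 : nc (z i - a) < e / 2 / k by near: i; apply: za; rewrite !divr_gt0.
have H2 : nc (w i - b) < e / 2 by near: i; apply: wb; rewrite divr_gt0.
have H3 : nc c * nc (z i - a) <= e / 2.
  rewrite (@le_trans _ _ (k * nc (z i - a)))//.
    by rewrite ler_wpM2r ?normc_ge0// lerDl.
  by rewrite mulrC -ler_pdivlMr// ltW.
by move: H2 H3; clear; lra.
Unshelve. all: by end_near. Qed.

Lemma tends_to_le z a (b : R) : tends_to z a -> (\forall i \near \oo, nc (z i) <= b) ->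
  nc a <= b.
Proof.
move=> za zb; apply/ler_addgt0Pr => e e0.
have [i [zai zbi]] : exists i, nc (z i - a) < e /\ nc (z i) <= b.
  have : \forall i \near \oo, nc (z i - a) < e /\ nc (z i) <= b.
    by near=> i; split; near: i; [exact: za|exact: zb].
  by case=> N _ /(_ N (leqnn N)); exists N.
have := le_normcB (z i) (z i - a); rewrite subKr; move: zai zbi; clear; lra.
Unshelve. all: by end_near. Qed.

Lemma tends_to_uniq z a b : tends_to z a -> tends_to z b -> a = b.
Proof.
move=> za zb; apply/eqP; rewrite -subr_eq0 -normc_eq0 eq_le normc_ge0 andbT.
have : tends_to (fun i => (-1) * z i + z i) ((-1) * b + a) by exact: tends_toL.
have -> : (-1) * b + a = a - b by ring.
move=> /tends_to_le; apply; near=> i.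
by rewrite mulN1r addNr Normc.normc0.
Unshelve. all: by end_near. Qed.

Lemma tends_to_cauchy z : (forall e : R, 0 < e -> exists N, forall i j,
    (N <= i)%N -> (N <= j)%N -> nc (z i - z j) < e) -> exists a, tends_to z a.
Proof.
move=> zC.
have part (q : C -> R) : (forall t, `|q t| <= nc t) -> (forall x y, q (x - y) = q x - q y) ->
    exists l : R, q (z i) @[i --> \oo] --> l.
  move=> qnc qB; suff /cvg_ex[l ?] : cvg (q (z i) @[i --> \oo]) by exists l.
  apply/cauchy_cvgP/cauchy_exP => e e0; have [N NP] := zC e e0.
  exists (q (z N)); exists N => // i /= Ni.
  change (`|q (z N) - q (z i)| < e); rewrite -qB.
  by apply: le_lt_trans (qnc _) _; exact: NP.
have [l1 zl1] := part _ Re_le_normc ltac:(by move=> [? ?] []).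
have [l2 zl2] := part _ Im_le_normc ltac:(by move=> [? ?] []).
exists (Complex l1 l2) => e e0; have e2 : 0 < e / 2 by rewrite divr_gt0.
move/cvgrPdist_lt : zl1 => /(_ _ e2) zl1; move/cvgrPdist_lt : zl2 => /(_ _ e2) zl2.
near=> i; apply: le_lt_trans (normc_le_ReIm _) _.
have -> : Re (z i - Complex l1 l2) = Re (z i) - l1 by case: (z i).
have -> : Im (z i - Complex l1 l2) = Im (z i) - l2 by case: (z i).
rewrite [e]splitr; apply: ltrD; rewrite distrC.
- by near: i; exact: zl1.
- by near: i; exact: zl2.
Unshelve. all: by end_near. Qed.

End ComplexLimits.

(** * Completion with respect to a positive form *)

Section PreHilbert.
Context {R : realType}.
Local Notation C := R[i].
Local Notation Re := complex.Re.
Local Notation Im := complex.Im.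
(* [lin a x y] stands for [a x + y], but [T] is not assumed to be a module: test
   sections form a subtype without module structure, and the form [p] sees an
   element only through its products. *)
Variables (T : Type) (lin : C -> T -> T -> T) (p : T -> T -> C).
Hypothesis plin : forall a x y z, p (lin a x y) z = a * p x z + p y z.
Hypothesis pconj : forall x y, p y x = (p x y)^*%C.
Hypothesis ppos : forall x, 0 <= p x x.
Implicit Types (x y z : T) (phi psi : nat -> T) (u v w : T -> C^o).

Definition prenorm x : R := Num.sqrt (Re (p x x)).
Local Notation nrm := prenorm.
Definition presub x y : T := lin (-1) y x.

Lemma pair_linr a x y z : p z (lin a x y) = (a^*)%C * p z x + p z y.
Proof. by rewrite pconj plin rmorphD rmorphM /= -!pconj. Qed.

Lemma pair_subl x y z : p (presub x y) z = p x z - p y z.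
Proof. by rewrite plin mulN1r addrC. Qed.

Lemma pair_subr x y z : p z (presub x y) = p z x - p z y.
Proof. by rewrite pair_linr rmorphN1 mulN1r addrC. Qed.

Lemma pair_diag x : p x x = ((nrm x) ^+ 2)%:C%C.
Proof.
have := ppos x; rewrite /nrm; case: (p x x) => a b; rewrite lecE => /andP[/= /eqP -> a0].
by rewrite sqr_sqrtr.
Qed.

Lemma prenorm_ge0 x : 0 <= nrm x.
Proof. exact: sqrtr_ge0. Qed.

Lemma cauchy_schwarz x y : nc (p x y) <= nrm x * nrm y.
Proof.
set c := p x y; set a := nrm x; set b := nrm y.
have a0 : 0 <= a := prenorm_ge0 x; have b0 : 0 <= b := prenorm_ge0 y.
have c0 : 0 <= nc c := normc_ge0 c.
have cc : c * (c^*)%C = ((nc c) ^+ 2)%:C%C.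
  case: (c) => s t /=; rewrite sqr_sqrtr ?addr_ge0 ?sqr_ge0//.
  by simpc; congr Complex; ring.
have key (s : R) : 0 <= s ^+ 2 * a ^+ 2 - 2 * s * (nc c) ^+ 2 + (nc c) ^+ 2 * b ^+ 2.
  (* [w] stands for [s x - c y]; as [lin] adds a vector with coefficient [1], the
     coefficient [s] of [x] is split as [(s - 1) + 1] *)
  pose w := lin (s%:C%C - 1) x (lin (- c) y x).
  have wl z : p w z = s%:C%C * p x z - c * p y z by rewrite !plin; ring.
  have wr z : p z w = s%:C%C * p z x - c^*%C * p z y.
    by rewrite [LHS]pconj wl rmorphB !rmorphM /= oppr0 -!pconj.
  have := ppos w; rewrite wl !wr (pconj x y) -/c !pair_diag -/a -/b.
  have -> : s%:C%C * (s%:C%C * (a ^+ 2)%:C%C - c^*%C * c) -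
       c * (s%:C%C * c^*%C - c^*%C * (b ^+ 2)%:C%C) =
    s%:C%C ^+ 2 * (a ^+ 2)%:C%C - 2 * s%:C%C * (c * c^*%C) + (c * c^*%C) * (b ^+ 2)%:C%C.
    by ring.
  rewrite cc -!rmorphXn -(rmorph_nat (@real_complex R) 2) -!rmorphM -rmorphB -rmorphD.
  by rewrite ler0c.
have [aE|an] := eqVneq a 0.
  (* for null [x], a large [s] makes the form negative unless [c = 0] *)
  have := key (b ^+ 2 + 1); rewrite aE expr0n mulr0 mul0r add0r => H.
  have : nc c ^+ 2 = 0.
    apply/le_anti; rewrite sqr_ge0 andbT.
    have b2 : 0 < b ^+ 2 + 2 by rewrite ltr_wpDl ?sqr_ge0.
    rewrite -(ler_pM2r b2) mul0r; move: H; rewrite -oppr_ge0.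
    by congr (_ <= _); ring.
  by move=> /eqP; rewrite sqrf_eq0 => /eqP ->.
have a2 : 0 < a ^+ 2 by rewrite exprn_gt0// lt_def an.
have := key (nc c ^+ 2 / a ^+ 2).
have -> : (nc c ^+ 2 / a ^+ 2) ^+ 2 * a ^+ 2 - 2 * (nc c ^+ 2 / a ^+ 2) * nc c ^+ 2 +
    nc c ^+ 2 * b ^+ 2 = nc c ^+ 2 * (a ^+ 2 * b ^+ 2 - nc c ^+ 2) / a ^+ 2 by field.
rewrite pmulr_lge0 ?invr_gt0// => H.
have [->|cn] := eqVneq (nc c) 0; first exact: mulr_ge0.
have c2 : 0 < nc c ^+ 2 by rewrite exprn_gt0// lt_def cn.
move: H; rewrite pmulr_rge0// subr_ge0 -exprMn.
by rewrite ler_pXn2r// nnegrE mulr_ge0.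
Qed.

Lemma prenormL a x y : nrm (lin a x y) <= nc a * nrm x + nrm y.
Proof.
have h0 : 0 <= nc a * nrm x + nrm y by rewrite addr_ge0 ?mulr_ge0 ?prenorm_ge0 ?normc_ge0.
rewrite -(@ler_pXn2r _ 2)// ?nnegrE ?prenorm_ge0//.
have E : ((nrm (lin a x y)) ^+ 2)%:C%C = p (lin a x y) (lin a x y) by rewrite pair_diag.
have := congr1 (@complex.Re R) E; rewrite /= => ->.
rewrite plin !pair_linr (pconj x y) !pair_diag.
set c := p x y; have Hc := cauchy_schwarz x y; rewrite -/c in Hc.
set n1 := nrm x in Hc *; set n2 := nrm y in Hc *.
have -> : a * (a^*%C * (n1 ^+ 2)%:C%C + c) + (a^*%C * c^*%C + (n2 ^+ 2)%:C%C) =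
    (a * a^*%C) * (n1 ^+ 2)%:C%C + ((a * c) + (a * c)^*%C) + (n2 ^+ 2)%:C%C.
  by rewrite rmorphM /=; ring.
have -> : a * a^*%C = ((nc a) ^+ 2)%:C%C.
  case: (a) => s t /=; rewrite sqr_sqrtr ?addr_ge0 ?sqr_ge0//.
  by simpc; congr Complex; ring.
have -> : Re ((nc a ^+ 2)%:C%C * (n1 ^+ 2)%:C%C + (a * c + (a * c)^*%C) + (n2 ^+ 2)%:C%C) =
    nc a ^+ 2 * n1 ^+ 2 + 2 * Re (a * c) + n2 ^+ 2.
  by case: (a * c) => s t /=; ring.
have : Re (a * c) <= nc a * (n1 * n2).
  apply: le_trans (ler_norm _) _; apply: le_trans (Re_le_normc _) _.
  by rewrite Normc.normcM ler_wpM2l ?normc_ge0.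
by rewrite sqrrD exprMn mulr2n; move: (nc a) (Re _) => *; lra.
Qed.

(** This replaces the module laws: equalities between combinations are checked
    on products. *)
Lemma prenorm_ext x y : (forall z, p x z = p y z) -> nrm x = nrm y.
Proof. by move=> xy; rewrite /nrm xy pconj xy -pconj. Qed.

Lemma prenorm_triangle y x z : nrm (presub x z) <= nrm (presub x y) + nrm (presub y z).
Proof.
have -> : nrm (presub x z) = nrm (lin 1 (presub x y) (presub y z)).
  by apply: prenorm_ext => t; rewrite plin !pair_subl; ring.
by apply: le_trans (prenormL _ _ _) _; rewrite Normc.normc1 mul1r.
Qed.

Lemma prenorm_subC x y : nrm (presub x y) = nrm (presub y x).
Proof.
have le s t : nrm (presub s t) <= nrm (presub t s).
  have -> : nrm (presub s t) = nrm (lin (-1) (presub t s) (presub s s)).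
    by apply: prenorm_ext => r; rewrite plin !pair_subl; ring.
  apply: le_trans (prenormL _ _ _) _; rewrite normcN Normc.normc1 mul1r.
  suff -> : nrm (presub s s) = 0 by rewrite addr0.
  by rewrite /nrm pair_subl pair_subr subrr sqrtr0.
by apply/eqP; rewrite eq_le !le.
Qed.

Lemma le_prenormB x y : `|nrm x - nrm y| <= nrm (presub x y).
Proof.
have le s t : nrm s - nrm t <= nrm (presub s t).
  rewrite lerBlDr.
  have -> : nrm s = nrm (lin 1 (presub s t) t).
    by apply: prenorm_ext => r; rewrite plin !pair_subl; ring.
  by apply: le_trans (prenormL _ _ _) _; rewrite Normc.normc1 mul1r.
rewrite ler_norml le andbT; have := le y x; rewrite prenorm_subC.
by move: (nrm x) (nrm y) (nrm _) => ? ? ?; lra.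
Qed.

Definition precauchy phi : Prop := forall e : R, 0 < e -> exists N, forall i j,
  (N <= i)%N -> (N <= j)%N -> nrm (presub (phi i) (phi j)) < e.

(** A Cauchy sequence stands for the limit functional [x |-> p (phi i) x], an
    element of the completion realized inside the functionals on [T]. *)
Definition represents phi u : Prop :=
  precauchy phi /\ forall x, tends_to (fun i => p (phi i) x) (u x).

Lemma precauchy_bounded phi : precauchy phi ->
  exists2 k, 0 < k & \forall i \near \oo, nrm (phi i) <= k.
Proof.
move=> /(_ 1 ltr01)[N NP]; exists (nrm (phi N) + 1).
  by rewrite ltr_wpDl// prenorm_ge0.
exists N => // i /= Ni; have := NP i N Ni (leqnn N).
have := le_prenormB (phi i) (phi N); rewrite ler_norml => /andP[_].
by move: (nrm (phi i)) (nrm _) (nrm _) => *; lra.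
Qed.

Lemma precauchyL a phi psi : precauchy phi -> precauchy psi ->
  precauchy (fun i => lin a (phi i) (psi i)).
Proof.
move=> phiC psiC e e0; pose k := nc a + 1.
have k0 : 0 < k by rewrite ltr_wpDl// normc_ge0.
have [N1 H1] := phiC (e / 2 / k) ltac:(by rewrite !divr_gt0).
have [N2 H2] := psiC (e / 2) ltac:(by rewrite divr_gt0).
exists (maxn N1 N2) => i j; rewrite !geq_max => /andP[i1 i2] /andP[j1 j2].
rewrite (@prenorm_ext _ (lin a (presub (phi i) (phi j)) (presub (psi i) (psi j)))).
  apply: le_lt_trans (prenormL _ _ _) _.
  have := H1 i j i1 j1; have := H2 i j i2 j2.
  have := prenorm_ge0 (presub (phi i) (phi j)).
  set s := nrm (presub (phi i) _); set t := nrm (presub (psi i) _) => s0 te se.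
  have : nc a * s <= e / 2.
    rewrite (@le_trans _ _ (k * s))//; first by rewrite ler_wpM2r// /k lerDl.
    by rewrite mulrC -ler_pdivlMr// ltW.
  by move: te; clear; lra.
by move=> z; rewrite !(plin, pair_subl); ring.
Qed.

(** In [nrm (phi i) ^+ 2 = p (phi i - phi j) (phi i) + p (phi j) (phi i)] the first
    term is small and the second tends to [0] with [j]. Therefore the limit
    functional of a Cauchy sequence determines the sequence up to null
    sequences. *)
Lemma precauchy_weak0 phi : precauchy phi ->
  (forall x, tends_to (fun i => p (phi i) x) 0) ->
  forall e : R, 0 < e -> \forall i \near \oo, nrm (phi i) < e.
Proof.
move=> phiC phi0 e e0; have e2 : 0 < e / 2 by rewrite divr_gt0.
have [N NP] := phiC _ e2; exists N => // i /= Ni.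
have n0 := prenorm_ge0 (phi i).
suff : nrm (phi i) <= e / 2 by move: e0; clear; lra.
have H : tends_to (fun j => (-1) * p (phi j) (phi i) + p (phi i) (phi i))
    ((-1) * 0 + p (phi i) (phi i)).
  by apply: tends_toL; [exact: phi0|exact: tends_to_cst].
have : nc ((-1) * 0 + p (phi i) (phi i)) <= e / 2 * nrm (phi i).
  apply: (tends_to_le H); exists N => // j /= Nj.
  rewrite mulN1r addrC -pair_subl; apply: le_trans (cauchy_schwarz _ _) _.
  by rewrite ler_wpM2r// ltW// NP.
rewrite mulr0 add0r pair_diag normc_real ger0_norm ?sqr_ge0// expr2.
have [->|nn] := eqVneq (nrm (phi i)) 0; first by move=> _; exact: ltW.
by rewrite ler_pM2r// lt_def nn.
Qed.

Lemma represents_dist phi phi' u : represents phi u -> represents phi' u ->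
  forall e : R, 0 < e -> \forall i \near \oo, nrm (presub (phi i) (phi' i)) < e.
Proof.
move=> [C1 W1] [C2 W2]; apply: precauchy_weak0; first exact: precauchyL.
move=> x; have := tends_toL (-1) (W2 x) (W1 x).
rewrite mulN1r addNr => H e /H; apply: filterS => i.
by rewrite plin.
Qed.

Lemma pair_cauchy phi psi : precauchy phi -> precauchy psi ->
  exists a, tends_to (fun i => p (phi i) (psi i)) a.
Proof.
move=> C1 C2; apply: tends_to_cauchy => e e0.
have [k1 k10 [M1 _ B1]] := precauchy_bounded C1.
have [k2 k20 [M2 _ B2]] := precauchy_bounded C2.
have [N1 H1] := C1 (e / 2 / k2) ltac:(by rewrite !divr_gt0).
have [N2 H2] := C2 (e / 2 / k1) ltac:(by rewrite !divr_gt0).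
exists (maxn (maxn M1 M2) (maxn N1 N2)) => i j.
rewrite !geq_max => /andP[/andP[i1 i2] /andP[i3 i4]] /andP[/andP[j1 j2] /andP[j3 j4]].
have -> : p (phi i) (psi i) - p (phi j) (psi j) =
    p (presub (phi i) (phi j)) (psi i) + p (phi j) (presub (psi i) (psi j)).
  by rewrite pair_subl pair_subr; ring.
apply: le_lt_trans (normcD _ _) _.
have S1 := cauchy_schwarz (presub (phi i) (phi j)) (psi i).
have S2 := cauchy_schwarz (phi j) (presub (psi i) (psi j)).
have T1 : nrm (presub (phi i) (phi j)) * nrm (psi i) < e / 2.
  rewrite (@le_lt_trans _ _ (nrm (presub (phi i) (phi j)) * k2))//.
    by rewrite ler_wpM2l ?prenorm_ge0//; exact: B2.
  by rewrite -ltr_pdivlMr//; exact: H1.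
have T2 : nrm (phi j) * nrm (presub (psi i) (psi j)) < e / 2.
  rewrite (@le_lt_trans _ _ (k1 * nrm (presub (psi i) (psi j))))//.
    by rewrite ler_wpM2r ?prenorm_ge0//; exact: B1.
  by rewrite mulrC -ltr_pdivlMr//; exact: H2.
by move: S1 S2 T1 T2; clear; lra.
Qed.

Lemma pair_limit_uniq phi phi' psi psi' u v a :
  represents phi u -> represents phi' u -> represents psi v -> represents psi' v ->
  tends_to (fun i => p (phi i) (psi i)) a -> tends_to (fun i => p (phi' i) (psi' i)) a.
Proof.
move=> ru ru' rv rv' la e e0.
have [k1 k10 B1] := precauchy_bounded ru'.1.
have [k2 k20 B2] := precauchy_bounded rv.1.
have e3 : 0 < e / 3 by rewrite divr_gt0.
near=> i.
have -> : p (phi' i) (psi' i) - a = p (presub (phi' i) (phi i)) (psi i) +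
    p (phi' i) (presub (psi' i) (psi i)) + (p (phi i) (psi i) - a).
  by rewrite pair_subl pair_subr; ring.
apply: le_lt_trans (normcD _ _) _.
have S0 := normcD (p (presub (phi' i) (phi i)) (psi i)) (p (phi' i) (presub (psi' i) (psi i))).
have S1 := cauchy_schwarz (presub (phi' i) (phi i)) (psi i).
have S2 := cauchy_schwarz (phi' i) (presub (psi' i) (psi i)).
have T1 : nrm (presub (phi' i) (phi i)) * nrm (psi i) < e / 3.
  rewrite (@le_lt_trans _ _ (nrm (presub (phi' i) (phi i)) * k2))//.
    by rewrite ler_wpM2l ?prenorm_ge0//; near: i.
  by rewrite -ltr_pdivlMr//; near: i; apply: (represents_dist ru' ru); rewrite divr_gt0.
have T2 : nrm (phi' i) * nrm (presub (psi' i) (psi i)) < e / 3.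
  rewrite (@le_lt_trans _ _ (k1 * nrm (presub (psi' i) (psi i))))//.
    by rewrite ler_wpM2r ?prenorm_ge0//; near: i.
  by rewrite mulrC -ltr_pdivlMr//; near: i; apply: (represents_dist rv' rv); rewrite divr_gt0.
have T3 : nc (p (phi i) (psi i) - a) < e / 3 by near: i; exact: la.
by move: S0 S1 S2 T1 T2 T3; clear; lra.
Unshelve. all: by end_near. Qed.

Definition completion : set (T -> C^o) := [set u | exists phi, represents phi u].

(** The limit exists and is independent of the sequences for [u] and [v] in the
    completion ([ipP]); elsewhere the value is arbitrary. *)
Definition ip u v : C := xget 0 [set a | forall phi psi,
  represents phi u -> represents psi v -> tends_to (fun i => p (phi i) (psi i)) a].

Definition of_pre x : T -> C^o := fun y => p x y.

Local Notation H := completion.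

Lemma ipP u v phi psi : represents phi u -> represents psi v ->
  tends_to (fun i => p (phi i) (psi i)) (ip u v).
Proof.
move=> ru rv; have [a la] := pair_cauchy ru.1 rv.1.
suff /(xgetPex 0) : exists a, forall phi psi, represents phi u ->
    represents psi v -> tends_to (fun i => p (phi i) (psi i)) a by exact.
by exists a => phi' psi' ru' rv'; exact: (pair_limit_uniq ru ru' rv rv' la).
Qed.

Lemma precauchy_cst x : precauchy (fun=> x).
Proof.
by move=> e e0; exists 0%N => i j _ _; rewrite /prenorm pair_subl pair_subr subrr sqrtr0.
Qed.

Lemma represents_of_pre x : represents (fun=> x) (of_pre x).
Proof. by split; [exact: precauchy_cst|move=> y; exact: tends_to_cst]. Qed.

Lemma representsL a phi psi u v : represents phi u -> represents psi v ->
  represents (fun i => lin a (phi i) (psi i)) (a *: u + v).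
Proof.
move=> [C1 W1] [C2 W2]; split; first exact: precauchyL.
move=> x; have := tends_toL a (W1 x) (W2 x).
by move=> K e /K; apply: filterS => i; rewrite plin.
Qed.

Lemma completionL a u v : H u -> H v -> H (a *: u + v).
Proof. by move=> [phi ru] [psi rv]; eexists; exact: (representsL a ru rv). Qed.

Lemma completion_of_pre x : H (of_pre x).
Proof. by eexists; exact: represents_of_pre. Qed.

Lemma ipL a u v w : H u -> H v -> H w ->
  ip (a *: u + v) w = a * ip u w + ip v w.
Proof.
move=> [phi ru] [psi rv] [chi rw]; apply: tends_to_uniq (ipP (representsL a ru rv) rw) _.
have := tends_toL a (ipP ru rw) (ipP rv rw).
by move=> K e /K; apply: filterS => i; rewrite plin.
Qed.

Lemma ipJ u v : H u -> H v -> ip v u = (ip u v)^*%C.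
Proof.
move=> [phi ru] [psi rv]; apply: tends_to_uniq (ipP rv ru) _.
have := tends_toJ (ipP ru rv).
by move=> K e /K; apply: filterS => i; rewrite -pconj.
Qed.

Lemma ip_ge0 u : H u -> 0 <= ip u u.
Proof.
move=> [phi ru]; have K := ipP ru ru.
have KN : ip u u = (nc (ip u u))%:C%C.
  apply: (tends_to_uniq K) => e /(ipP ru ru); apply: filterS => i; rewrite pair_diag.
  apply: le_lt_trans; rewrite -rmorphB normc_real.
  have E : nc (nrm (phi i) ^+ 2)%:C%C = nrm (phi i) ^+ 2.
    by rewrite normc_real ger0_norm ?sqr_ge0.
  by have := le_dist_normc (nrm (phi i) ^+ 2)%:C%C (ip u u); rewrite E.
by rewrite KN ler0c normc_ge0.
Qed.

Lemma ip_of_pre u x : H u -> ip u (of_pre x) = u x.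
Proof.
move=> [phi ru]; apply: tends_to_uniq (ipP ru (represents_of_pre x)) _.
exact: ru.2.
Qed.

Definition hnorm u : R := Num.sqrt (Re (ip u u)).

Lemma hnorm_of_pre x : hnorm (of_pre x) = nrm x.
Proof. by rewrite /hnorm ip_of_pre//; exact: completion_of_pre. Qed.

Lemma hnorm_le phi u (k : R) : represents phi u -> 0 <= k ->
  (\forall i \near \oo, nrm (phi i) <= k) -> hnorm u <= k.
Proof.
move=> ru k0 nk.
have : nc (ip u u) <= k ^+ 2.
  apply: (tends_to_le (ipP ru ru)); apply: filterS nk => i nk.
  rewrite pair_diag normc_real ger0_norm ?sqr_ge0// ler_pXn2r// nnegrE.
  exact: prenorm_ge0.
move=> le; rewrite /hnorm -(ger0_norm k0) -sqrtr_sqr ler_wsqrtr//.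
exact: le_trans (ler_norm _) (le_trans (Re_le_normc _) le).
Qed.

(** [nrm (phi i - phi j)] is small, and converges with [j] to the norm of the
    difference. *)
Lemma represents_cvg phi u : represents phi u -> forall e : R, 0 < e ->
  \forall i \near \oo, hnorm (of_pre (phi i) - u) < e.
Proof.
move=> ru e e0; have e2 : 0 < e / 2 by rewrite divr_gt0.
have [N NP] := ru.1 _ e2; exists N => // i /= Ni.
suff : hnorm (of_pre (phi i) - u) <= e / 2 by move: e0; clear; lra.
rewrite addrC -scaleN1r.
apply: (hnorm_le (representsL (-1) ru (represents_of_pre (phi i)))); first exact: ltW.
by exists N => // j /= Nj; apply/ltW/(NP i j).
Qed.

Lemma of_preB x y : of_pre x - of_pre y = of_pre (presub x y).
Proof. by apply/funext => z; rewrite /of_pre pair_subl. Qed.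

Lemma completion_dense u (e : R) : H u -> 0 < e -> exists x, hnorm (of_pre x - u) < e.
Proof.
move=> [phi ru] e0; have [N _ /(_ N (leqnn N)) HN] := represents_cvg ru e0.
by exists (phi N).
Qed.

End PreHilbert.

Section Completion.
Context {R : realType}.
Local Notation C := R[i].
Local Notation Re := complex.Re.
Local Notation Im := complex.Im.
Variables (T : Type) (lin : C -> T -> T -> T) (p : T -> T -> C).
Hypothesis plin : forall a x y z, p (lin a x y) z = a * p x z + p y z.
Hypothesis pconj : forall x y, p y x = (p x y)^*%C.
Hypothesis ppos : forall x, 0 <= p x x.
Implicit Types (x y z : T) (u v w : T -> C^o).
Local Notation H := (completion lin p).
Local Notation ip := (ip lin p).
Local Notation hnorm := (hnorm lin p).
Local Notation represents := (represents lin p).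

(* the lemmas on positive forms apply to the completion itself *)
Let HT := {u : T -> C^o | H u}.
Let hlin a (u v : HT) : HT :=
  exist _ (a *: sval u + sval v) (completionL plin pconj ppos a (svalP u) (svalP v)).
Let hp (u v : HT) := ip (sval u) (sval v).

Let hpL a (u v w : HT) : hp (hlin a u v) w = a * hp u w + hp v w.
Proof. by apply: (ipL plin pconj ppos); exact: svalP. Qed.

Let hpJ (u v : HT) : hp v u = (hp u v)^*%C.
Proof. by apply: (ipJ plin pconj ppos); exact: svalP. Qed.

Let hp_ge0 (u : HT) : 0 <= hp u u.
Proof. by apply: (ip_ge0 plin pconj ppos); exact: svalP. Qed.

Lemma ip_cauchy_schwarz u v : H u -> H v -> nc (ip u v) <= hnorm u * hnorm v.
Proof. by move=> Hu Hv; exact: (cauchy_schwarz hpL hpJ hp_ge0 (exist _ u Hu) (exist _ v Hv)). Qed.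

Lemma hnormL a u v : H u -> H v -> hnorm (a *: u + v) <= nc a * hnorm u + hnorm v.
Proof. by move=> Hu Hv; exact: (prenormL hpL hpJ hp_ge0 a (exist _ u Hu) (exist _ v Hv)). Qed.

Lemma ip_hnorm u : H u -> ip u u = ((hnorm u) ^+ 2)%:C%C.
Proof. by move=> Hu; exact: (pair_diag hp_ge0 (exist _ u Hu)). Qed.

Let subE u v : u - v = (-1) *: v + u. Proof. by rewrite scaleN1r addrC. Qed.

Lemma hnorm_distC u v : H u -> H v -> hnorm (u - v) = hnorm (v - u).
Proof.
by move=> Hu Hv; rewrite !subE; exact: (prenorm_subC hpL hpJ hp_ge0 (exist _ u Hu) (exist _ v Hv)).
Qed.

Lemma hnorm_triangle u v w : H u -> H v -> H w ->
  hnorm (u - w) <= hnorm (u - v) + hnorm (v - w).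
Proof.
move=> Hu Hv Hw; rewrite !subE.
exact: (prenorm_triangle hpL hpJ hp_ge0 (exist _ v Hv) (exist _ u Hu) (exist _ w Hw)).
Qed.

Lemma le_dist_hnorm u v : H u -> H v -> `|hnorm u - hnorm v| <= hnorm (u - v).
Proof.
move=> Hu Hv; rewrite subE.
exact: (le_prenormB hpL hpJ hp_ge0 (exist _ u Hu) (exist _ v Hv)).
Qed.

(** Each [u i] is approximated up to [1 / (i + 1)] by an element of [T]; these
    elements form a Cauchy sequence, and it represents the limit. *)
Lemma completion_complete (u : nat -> T -> C^o) : (forall i, H (u i)) ->
  (forall e : R, 0 < e -> exists N, forall i j, (N <= i)%N -> (N <= j)%N ->
     hnorm (u i - u j) < e) ->
  exists2 v, H v & forall e : R, 0 < e -> \forall i \near \oo, hnorm (u i - v) < e.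
Proof.
move=> Hu uC.
have inv0 (i : nat) : 0 < (i.+1%:R)^-1 :> R by rewrite invr_gt0.
have /choice[x xP] : forall i, exists x, hnorm (of_pre p x - u i) < (i.+1%:R)^-1.
  by move=> i; exact: (completion_dense plin pconj ppos (Hu i) (inv0 i)).
have Hx i : H (of_pre p (x i)) := completion_of_pre plin pconj (x i).
have small (e : R) : 0 < e -> \forall i \near \oo, (i.+1%:R)^-1 < e :> R.
  by move=> e0; exact: (near_infty_natSinv_lt (PosNum e0)).
have xC : precauchy lin p x.
  move=> e e0; have e3 : 0 < e / 3 by rewrite divr_gt0.
  have [N NP] := uC _ e3; have [M _ MP] := small _ e3.
  exists (maxn N M) => i j; rewrite !geq_max => /andP[Ni Mi] /andP[Nj Mj].
  rewrite -(hnorm_of_pre plin pconj ppos).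
  have -> : of_pre p (presub lin (x i) (x j)) = of_pre p (x i) - of_pre p (x j).
    by rewrite -(of_preB plin).
  have A1 := hnorm_triangle (Hx i) (Hu i) (Hx j).
  have A2 := hnorm_triangle (Hu i) (Hu j) (Hx j).
  have A3 := lt_trans (xP i) (MP i Mi).
  have A4 := lt_trans (xP j) (MP j Mj).
  have A5 := NP i j Ni Nj; rewrite hnorm_distC// in A4.
  by lra.
have /choice[v vP] : forall y, exists a, tends_to (fun i => p (x i) y) a.
  by move=> y; exact: (pair_cauchy plin pconj ppos xC (precauchy_cst plin pconj y)).
have rv : represents x v by split.
have Hv : H v by exists x.
exists v => // e e0; have e2 : 0 < e / 2 by rewrite divr_gt0.
near=> i.
apply: le_lt_trans (hnorm_triangle (Hu i) (Hx i) Hv) _; rewrite [e]splitr; apply: ltrD.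
  rewrite hnorm_distC//; apply: lt_trans (xP i) _; near: i; exact: small.
by near: i; exact: (represents_cvg plin pconj ppos rv).
Unshelve. all: by end_near. Qed.

End Completion.

(** * Adjointable bounded operators of a Hilbert space *)

Section Operators.
Context {R : realType}.
Local Notation C := R[i].
Variables (D : lmodType C) (T : Type) (H : set D) (ip : D -> D -> C).
Variables (tst : T -> D) (ev : D -> T -> C).

Definition ip_norm (u : D) : R := Num.sqrt (complex.Re (ip u u)).
Local Notation hn := ip_norm.

(** The facts on the Sobolev space of order zero that the theory of operators
    uses: [H] is a Hilbert space of functionals, the values [ev u x] of which are
    the products with a dense family [tst]. *)
Record hilbert_subspace : Prop := HilbertSubspace {
  hilbert0 : H 0;
  hilbertL : forall (a : C) u v, H u -> H v -> H (a *: u + v);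
  hilbert_tst : forall x, H (tst x);
  hilbert_ipL : forall a u v w, H u -> H v -> H w ->
    ip (a *: u + v) w = a * ip u w + ip v w;
  hilbert_ipJ : forall u v, H u -> H v -> ip v u = (ip u v)^*%C;
  hilbert_ip_tst : forall u x, H u -> ip u (tst x) = ev u x;
  hilbert_ev_inj : forall u v, H u -> H v -> (forall x, ev u x = ev v x) -> u = v;
  hilbert_cauchy_schwarz : forall u v, H u -> H v -> nc (ip u v) <= hn u * hn v;
  hilbert_normL : forall a u v, H u -> H v -> hn (a *: u + v) <= nc a * hn u + hn v;
  hilbert_ip_norm : forall u, H u -> ip u u = ((hn u) ^+ 2)%:C%C;
  hilbert_dense : forall u (e : R), H u -> 0 < e -> exists x, hn (tst x - u) < e;
  hilbert_complete : forall u : nat -> D, (forall i, H (u i)) ->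
    (forall e : R, 0 < e -> exists N, forall i j, (N <= i)%N -> (N <= j)%N ->
       hn (u i - u j) < e) ->
    exists2 v, H v & forall e : R, 0 < e -> \forall i \near \oo, hn (u i - v) < e }.

Hypothesis hilbH : hilbert_subspace.
Let H0 := hilbert0 hilbH.
Let HL := hilbertL hilbH.
Let Htst := hilbert_tst hilbH.
Let ipL := hilbert_ipL hilbH.
Let ipJ := hilbert_ipJ hilbH.
Let ip_tst := hilbert_ip_tst hilbH.
Let ev_inj := hilbert_ev_inj hilbH.
Let CS := hilbert_cauchy_schwarz hilbH.
Let ip_normL := hilbert_normL hilbH.
Let ip_hn := hilbert_ip_norm hilbH.
Let dense := hilbert_dense hilbH.
Let complete := hilbert_complete hilbH.
Implicit Types (u v w : D) (A B S : D -> D).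

Definition bounded_by A (b : R) : Prop := forall u, H u -> hn (A u) <= b * hn u.

(** Operators vanish outside [H], so that they are determined by their values on
    [H] ([bounded_op_ext]). *)
Definition bounded_op A : Prop :=
  [/\ forall u, H u -> H (A u),
      forall (a : C) u v, H u -> H v -> A (a *: u + v) = a *: A u + A v &
      exists2 b : R, 0 <= b & bounded_by A b] /\
  forall u, ~ H u -> A u = 0.

Definition op_norm A : R := inf [set b : R | 0 <= b /\ bounded_by A b].

(** Adjunction is only required on the dense family; see [adj_ip]. *)
Definition adjoint_pair A S : Prop := forall x y, ev (A (tst x)) y = (ev (S (tst y)) x)^*%C.

Definition op_adjoint A : D -> D := xget 0 [set S | bounded_op S /\ adjoint_pair A S].

Definition adjointable : set (D -> D) := [set A | bounded_op A /\ exists S, bounded_op S /\ adjoint_pair A S].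

Lemma ip_norm_ge0 u : 0 <= hn u. Proof. exact: sqrtr_ge0. Qed.

Lemma hilbertB u v : H u -> H v -> H (u - v).
Proof. by move=> Hu Hv; rewrite addrC -scaleN1r; exact: HL. Qed.

Lemma ip_norm0 : hn 0 = 0.
Proof.
have := ipL (-1) H0 H0 H0.
by rewrite scaler0 addr0 mulN1r addNr /ip_norm => ->; rewrite sqrtr0.
Qed.

Lemma ip_normD u v : H u -> H v -> hn (u + v) <= hn u + hn v.
Proof.
move=> Hu Hv; rewrite -{1}[u]scale1r; apply: le_trans (ip_normL _ Hu Hv) _.
by rewrite Normc.normc1 mul1r.
Qed.

Lemma ip_normZ a u : H u -> hn (a *: u) <= nc a * hn u.
Proof.
by move=> Hu; have := ip_normL a Hu H0; rewrite addr0 ip_norm0 addr0.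
Qed.

Lemma ip_norm_distC u v : H u -> H v -> hn (u - v) = hn (v - u).
Proof.
move=> Hu Hv.
have le s t : H s -> H t -> hn (s - t) <= hn (t - s).
  move=> Hs Ht; have := ip_normZ (-1) (hilbertB Ht Hs).
  by rewrite scaleN1r opprB normcN Normc.normc1 mul1r.
by apply/eqP; rewrite eq_le !le.
Qed.

Lemma ip_normB u v : H u -> H v -> hn (u - v) <= hn u + hn v.
Proof.
move=> Hu Hv; rewrite ip_norm_distC// -scaleN1r addrC.
by apply: le_trans (ip_normL _ Hu _) _ => //; rewrite ?normcN ?Normc.normc1 ?mul1r.
Qed.

Lemma ip_norm_triangle u v w : H u -> H v -> H w -> hn (u - w) <= hn (u - v) + hn (v - w).
Proof.
move=> Hu Hv Hw.
have -> : u - w = (u - v) + (v - w) by rewrite addrA subrK.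
by apply: ip_normD; exact: hilbertB.
Qed.

Lemma ip_norm_eq0 u : H u -> hn u = 0 -> u = 0.
Proof.
move=> Hu hu; apply: ev_inj => // x; rewrite -!ip_tst//.
have E v : H v -> hn v = 0 -> ip v (tst x) = 0.
  move=> Hv hv; apply/Normc.eq0_normc/eqP; rewrite eq_le normc_ge0 andbT.
  by have := CS Hv (Htst x); rewrite hv mul0r.
by rewrite !E// ip_norm0.
Qed.

Lemma ev_le u x : H u -> nc (ev u x) <= hn u * hn (tst x).
Proof. by move=> Hu; rewrite -ip_tst//; exact: CS. Qed.

Lemma ipB u v w : H u -> H v -> H w -> ip (u - v) w = ip u w - ip v w.
Proof. by move=> Hu Hv Hw; rewrite addrC -scaleN1r ipL// mulN1r addrC. Qed.

Lemma ipBr u v w : H u -> H v -> H w -> ip w (u - v) = ip w u - ip w v.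
Proof.
move=> Hu Hv Hw; rewrite (ipJ (hilbertB Hu Hv) Hw) (ipJ Hu Hw) (ipJ Hv Hw).
by rewrite ipB// rmorphB.
Qed.

Lemma evB u v x : H u -> H v -> ev (u - v) x = ev u x - ev v x.
Proof. by move=> Hu Hv; rewrite -!ip_tst ?ipB//; exact: hilbertB. Qed.

Lemma bounded_opH A u : bounded_op A -> H u -> H (A u). Proof. by move=> [[AH _ _] _]; exact: AH. Qed.

Lemma bounded_opL A (a : C) u v : bounded_op A -> H u -> H v -> A (a *: u + v) = a *: A u + A v.
Proof. by move=> [[_ AL _] _]; exact: AL. Qed.

Lemma bounded_op0 A : bounded_op A -> A 0 = 0.
Proof. by move=> bA; have := bounded_opL (-1) bA H0 H0; rewrite !scaleN1r !addNr. Qed.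

Lemma bounded_opB A u v : bounded_op A -> H u -> H v -> A (u - v) = A u - A v.
Proof. by move=> bA Hu Hv; rewrite addrC -scaleN1r bounded_opL// scaleN1r addrC. Qed.

Lemma op_norm_has_inf A : bounded_op A -> has_inf [set b : R | 0 <= b /\ bounded_by A b].
Proof. by move=> [[_ _ [b b0 bA]] _]; split; [exists b|exists 0 => ? []]. Qed.

Lemma op_norm_ge0 A : 0 <= op_norm A.
Proof.
rewrite /op_norm; have [->|/set0P ne] := eqVneq [set b : R | 0 <= b /\ bounded_by A b] set0.
  by rewrite inf0.
by apply: lb_le_inf => // b [].
Qed.

Lemma op_norm_le A (b : R) : 0 <= b -> bounded_by A b -> op_norm A <= b.
Proof. by move=> b0 Ab; apply: ge_inf; [exists 0 => ? []|]. Qed.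

Lemma op_normP A : bounded_op A -> bounded_by A (op_norm A).
Proof.
move=> bA u Hu; apply/ler_addgt0Pr => e e0.
have k0 : 0 < hn u + 1 by rewrite ltr_wpDl// ip_norm_ge0.
have [|b [b0 Ab] be] := @inf_adherent _ _ (e / (hn u + 1)) _ (op_norm_has_inf bA).
  by rewrite divr_gt0.
apply: le_trans (Ab u Hu) _.
apply: (@le_trans _ _ ((op_norm A + e / (hn u + 1)) * hn u)).
  by rewrite ler_wpM2r ?ip_norm_ge0// ltW.
rewrite mulrDl lerD2l -mulrA ger_pMr// ler_pdivrMl// mulr1.
by rewrite lerDl.
Qed.

Lemma bounded_op_ext A B : bounded_op A -> bounded_op B -> (forall u, H u -> A u = B u) -> A = B.
Proof.
move=> bA bB AB; apply/funext => u; have [/AB//|nu] := pselect (H u).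
by rewrite bA.2// bB.2.
Qed.

Lemma op_norm_eq0 A : bounded_op A -> op_norm A = 0 -> A = 0.
Proof.
move=> bA A0; apply/funext => u; have [Hu|nu] := pselect (H u); last exact: bA.2.
apply: ip_norm_eq0; first exact: bounded_opH.
by apply/eqP; rewrite eq_le ip_norm_ge0 andbT; have := op_normP bA Hu; rewrite A0 mul0r.
Qed.

Lemma bounded_op_lin (a : C) A B : bounded_op A -> bounded_op B -> bounded_op (a *: A + B).
Proof.
move=> bA bB; have E u : (a *: A + B) u = a *: A u + B u by [].
split; last by move=> u nu; rewrite E bA.2// bB.2// scaler0 addr0.
split.
- by move=> u Hu; rewrite E; apply: HL; exact: bounded_opH.
- move=> c u v Hu Hv; rewrite !E (bounded_opL _ bA Hu Hv) (bounded_opL _ bB Hu Hv) !scalerDr !scalerA [c * a]mulrC.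
  by rewrite -!addrA; congr (_ + _); rewrite addrCA.
- exists (nc a * op_norm A + op_norm B).
    by rewrite addr_ge0 ?mulr_ge0 ?normc_ge0 ?op_norm_ge0.
  move=> u Hu; rewrite E; apply: le_trans (ip_normL _ (bounded_opH bA Hu) (bounded_opH bB Hu)) _.
  rewrite mulrDl -mulrA lerD ?op_normP// ler_wpM2l ?normc_ge0 ?op_normP//.
Qed.

Lemma bounded_op_sub A B : bounded_op A -> bounded_op B -> bounded_op (A - B).
Proof. by move=> bA bB; rewrite addrC -scaleN1r; exact: bounded_op_lin. Qed.

Lemma bounded_op_comp A B : bounded_op A -> bounded_op B -> bounded_op (A \o B).
Proof.
move=> bA bB; split; last by move=> u nu /=; rewrite bB.2// bounded_op0.
split => /=.
- by move=> u Hu; exact: (bounded_opH bA (bounded_opH bB Hu)).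
- move=> c u v Hu Hv; rewrite (bounded_opL _ bB Hu Hv).
  by apply: bounded_opL => //; exact: bounded_opH.
- exists (op_norm A * op_norm B); first by rewrite mulr_ge0 ?op_norm_ge0.
  move=> u Hu /=; apply: le_trans (op_normP bA (bounded_opH bB Hu)) _.
  by rewrite -mulrA ler_wpM2l ?op_norm_ge0 ?op_normP.
Qed.

Lemma bounded_op_zero : bounded_op 0.
Proof.
split=> //; split=> //.
- by move=> a u v _ _; rewrite scaler0 addr0.
- by exists 0 => // u _; rewrite mul0r ip_norm0.
Qed.

Lemma op_normD A B : bounded_op A -> bounded_op B -> op_norm (A + B) <= op_norm A + op_norm B.
Proof.
move=> bA bB; apply: op_norm_le; first by rewrite addr_ge0 ?op_norm_ge0.
move=> u Hu; apply: le_trans (ip_normD (bounded_opH bA Hu) (bounded_opH bB Hu)) _.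
by rewrite mulrDl lerD ?op_normP.
Qed.

Lemma op_normZ_le a A : bounded_op A -> op_norm (a *: A) <= nc a * op_norm A.
Proof.
move=> bA; apply: op_norm_le; first by rewrite mulr_ge0 ?op_norm_ge0 ?normc_ge0.
move=> u Hu; apply: le_trans (ip_normZ a (bounded_opH bA Hu)) _.
by rewrite -mulrA ler_wpM2l ?normc_ge0 ?op_normP.
Qed.

Lemma bounded_opZ a A : bounded_op A -> bounded_op (a *: A).
Proof. by move=> bA; rewrite -[_ *: _]addr0; apply: bounded_op_lin => //; exact: bounded_op_zero. Qed.

Lemma op_normZ a A : bounded_op A -> op_norm (a *: A) = nc a * op_norm A.
Proof.
move=> bA; apply/eqP; rewrite eq_le op_normZ_le//=.
have [->|a0] := eqVneq a 0; first by rewrite Normc.normc0 mul0r op_norm_ge0.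
have := op_normZ_le a^-1 (bounded_opZ a bA); rewrite scalerA mulVf// scale1r Normc.normcV.
by rewrite ler_pdivlMl ?normc_gt0.
Qed.

Lemma op_normM A B : bounded_op A -> bounded_op B -> op_norm (A \o B) <= op_norm A * op_norm B.
Proof.
move=> bA bB; apply: op_norm_le; first by rewrite mulr_ge0 ?op_norm_ge0.
move=> u Hu /=; apply: le_trans (op_normP bA (bounded_opH bB Hu)) _.
by rewrite -mulrA ler_wpM2l ?op_norm_ge0 ?op_normP.
Qed.

(** Both sides are bounded sesquilinear forms that agree on a dense family. *)
Lemma adj_ip A S : bounded_op A -> bounded_op S -> adjoint_pair A S ->
  forall u v, H u -> H v -> ip (A u) v = ip u (S v).
Proof.
move=> bA bS AS u v Hu Hv.
apply/eqP; rewrite -subr_eq0; apply/eqP/Normc.eq0_normc/eqP.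
rewrite eq_le normc_ge0 andbT.
pose K := op_norm A + op_norm S; have K0 : 0 <= K by rewrite addr_ge0 ?op_norm_ge0.
pose F u v := ip (A u) v - ip u (S v).
have FK s t : H s -> H t -> nc (F s t) <= K * (hn s * hn t).
  move=> Hs Ht; apply: le_trans (le_normcB _ _) _; rewrite mulrDl; apply: lerD.
    apply: le_trans (CS (bounded_opH bA Hs) Ht) _.
    by rewrite mulrA ler_wpM2r ?ip_norm_ge0 ?op_normP.
  apply: le_trans (CS Hs (bounded_opH bS Ht)) _.
  by rewrite mulrCA ler_wpM2l ?ip_norm_ge0 ?op_normP.
have F0 x y : F (tst x) (tst y) = 0.
  rewrite /F ip_tst; last exact: bounded_opH.
  by rewrite AS -ip_tst; [rewrite -ipJ ?subrr//; exact: bounded_opH|exact: bounded_opH].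
apply/ler_addgt0Pr => e e0; rewrite add0r -/(F u v).
pose k := K * hn v + K * (hn u + 1) + 1.
have k0 : 0 < k by rewrite ltr_wpDl// addr_ge0// mulr_ge0 ?ip_norm_ge0// addr_ge0 ?ip_norm_ge0.
pose d := Num.min 1 (e / k).
have d0 : 0 < d by rewrite lt_min ltr01 divr_gt0.
have [x xu] := dense Hu d0; have [y yv] := dense Hv d0.
have d1 : d <= 1 by rewrite ge_min lexx.
have de : d <= e / k by rewrite ge_min lexx orbT.
have -> : F u v = F (u - tst x) v + F (tst x) (v - tst y).
  rewrite -[LHS]subr0 -(F0 x y) /F (bounded_opB bA Hu (Htst x)) (bounded_opB bS Hv (Htst y)).
  rewrite (ipB (bounded_opH bA Hu) (bounded_opH bA (Htst x)) Hv) (ipB Hu (Htst x) (bounded_opH bS Hv)).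
  rewrite (ipBr Hv (Htst y) (bounded_opH bA (Htst x))).
  rewrite (ipBr (bounded_opH bS Hv) (bounded_opH bS (Htst y)) (Htst x)).
  by ring.
apply: le_trans (normcD _ _) _.
have B1 := FK _ _ (hilbertB Hu (Htst x)) Hv.
have B2 := FK _ _ (Htst x) (hilbertB Hv (Htst y)).
rewrite ip_norm_distC// in xu; rewrite ip_norm_distC// in yv.
have ox : hn (tst x) <= hn u + 1.
  have := ip_normB Hu (hilbertB Hu (Htst x)); rewrite subKr => H1.
  by apply: le_trans H1 _; rewrite lerD2l ltW// (lt_le_trans xu).
apply: le_trans (lerD B1 B2) _.
apply: (@le_trans _ _ (K * (d * hn v) + K * ((hn u + 1) * d))).
  apply: lerD; rewrite ler_wpM2l//.
    by rewrite ler_wpM2r ?ip_norm_ge0// ltW.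
  by apply: ler_pM; rewrite ?ip_norm_ge0// ltW.
apply: (@le_trans _ _ (d * k)); last by rewrite -ler_pdivlMr.
have -> : d * k = K * (d * hn v) + K * ((hn u + 1) * d) + d by rewrite /k; ring.
by rewrite lerDl ltW.
Qed.

Lemma ip_adj A S : bounded_op A -> bounded_op S ->
  (forall u v, H u -> H v -> ip (A u) v = ip u (S v)) -> adjoint_pair A S.
Proof.
move=> bA bS AS x y; rewrite -!ip_tst; [|exact: bounded_opH..].
by rewrite AS// -ipJ//; exact: bounded_opH.
Qed.

Lemma adj_sym A S : adjoint_pair A S -> adjoint_pair S A.
Proof. by move=> AS x y; rewrite AS conjcK. Qed.

Lemma adj_uniq A S S' : bounded_op A -> bounded_op S -> bounded_op S' -> adjoint_pair A S -> adjoint_pair A S' -> S = S'.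
Proof.
move=> bA bS bS' AS AS'; apply: bounded_op_ext => // u Hu.
apply: ev_inj; [exact: bounded_opH..|] => x; rewrite -!ip_tst; [|exact: bounded_opH..].
have e B : bounded_op B -> adjoint_pair A B -> ip (B u) (tst x) = ip u (A (tst x)).
  by move=> bB AB; apply: adj_ip => //; exact: adj_sym.
by rewrite !e.
Qed.

Lemma op_adjointE A S : bounded_op A -> bounded_op S -> adjoint_pair A S -> op_adjoint A = S.
Proof.
move=> bA bS AS; have [bS' AS'] : bounded_op (op_adjoint A) /\ adjoint_pair A (op_adjoint A).
  by apply: (@xgetPex _ 0 [set S | bounded_op S /\ adjoint_pair A S]); exists S.
exact: (adj_uniq bA).
Qed.

Lemma op_adjointP A : adjointable A -> bounded_op (op_adjoint A) /\ adjoint_pair A (op_adjoint A).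
Proof. by move=> [bA [S [bS AS]]]; rewrite (op_adjointE bA bS AS). Qed.

Lemma adjL a A S B U : bounded_op A -> bounded_op B -> bounded_op S -> bounded_op U -> adjoint_pair A S -> adjoint_pair B U ->
  adjoint_pair (a *: A + B) ((a^*)%C *: S + U).
Proof.
move=> bA bB bS bU AS BU.
have evL (c : C) u v z : H u -> H v -> ev (c *: u + v) z = c * ev u z + ev v z.
  by move=> Hu Hv; rewrite -!ip_tst// ?ipL//; exact: HL.
move=> x y; have -> : (a *: A + B) (tst x) = a *: A (tst x) + B (tst x) by [].
have -> : ((a^*)%C *: S + U) (tst y) = (a^*)%C *: S (tst y) + U (tst y) by [].
rewrite !evL; [|exact: bounded_opH..].
by rewrite rmorphD rmorphM /= conjcK AS BU.
Qed.

Lemma adj_comp A S B U : bounded_op A -> bounded_op B -> bounded_op S -> bounded_op U -> adjoint_pair A S -> adjoint_pair B U ->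
  adjoint_pair (A \o B) (U \o S).
Proof.
move=> bA bB bS bU AS BU; apply: ip_adj; [exact: bounded_op_comp..|] => u v Hu Hv /=.
by rewrite (adj_ip bA bS AS)// ?(adj_ip bB bU BU)//; exact: bounded_opH.
Qed.

(** [hn (S v) ^+ 2 = ip (A (S v)) v <= op_norm A * hn (S v) * hn v]. *)
Lemma op_norm_adj_le A S : bounded_op A -> bounded_op S -> adjoint_pair A S -> op_norm S <= op_norm A.
Proof.
move=> bA bS AS; apply: op_norm_le; first exact: op_norm_ge0.
move=> v Hv; have HS := bounded_opH bS Hv.
have sq : hn (S v) ^+ 2 <= op_norm A * hn v * hn (S v).
  have : nc (ip (A (S v)) v) <= hn (A (S v)) * hn v by apply: CS => //; exact: bounded_opH.
  rewrite (adj_ip bA bS AS)// ip_hn// normc_real ger0_norm ?sqr_ge0//.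
  move/le_trans; apply; rewrite mulrAC ler_wpM2r ?ip_norm_ge0//; exact: op_normP.
have [->|n0] := eqVneq (hn (S v)) 0; first by rewrite mulr_ge0 ?op_norm_ge0 ?ip_norm_ge0.
by move: sq; rewrite expr2 ler_pM2r// lt_def n0 ip_norm_ge0.
Qed.

Lemma op_norm_adj A S : bounded_op A -> bounded_op S -> adjoint_pair A S -> op_norm S = op_norm A.
Proof.
by move=> bA bS AS; apply/eqP; rewrite eq_le !op_norm_adj_le//; exact: adj_sym.
Qed.

(** [hn (A u) ^+ 2 = ip u (S (A u)) <= op_norm (S \o A) * hn u ^+ 2]. *)
Lemma op_norm_Cstar A S : bounded_op A -> bounded_op S -> adjoint_pair A S -> op_norm (S \o A) = op_norm A ^+ 2.
Proof.
move=> bA bS AS; apply/eqP; rewrite eq_le; apply/andP; split.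
  by apply: le_trans (op_normM bS bA) _; rewrite (op_norm_adj bA bS AS) expr2.
have bSA := bounded_op_comp bS bA.
rewrite -[leRHS]sqr_sqrtr ?op_norm_ge0// ler_pXn2r ?nnegrE ?op_norm_ge0 ?sqrtr_ge0//.
apply: op_norm_le; first exact: sqrtr_ge0.
move=> u Hu; have HA := bounded_opH bA Hu.
rewrite -(@ler_pXn2r _ 2)// ?nnegrE ?ip_norm_ge0 ?mulr_ge0 ?sqrtr_ge0 ?ip_norm_ge0//.
rewrite exprMn (sqr_sqrtr (op_norm_ge0 (S \o A))).
have : nc (ip u (S (A u))) <= hn u * hn (S (A u)) by apply: CS => //; exact: bounded_opH.
rewrite -(adj_ip bA bS AS)// ip_hn// normc_real ger0_norm ?sqr_ge0//.
move/le_trans; apply; rewrite expr2 mulrA [leRHS]mulrC ler_wpM2l ?ip_norm_ge0//.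
exact: (op_normP bSA).
Qed.

Lemma adj_0 : adjoint_pair 0 0.
Proof.
have evz x : ev 0 x = 0.
  by have := evB x H0 H0; rewrite subr0 subrr.
by move=> x y; rewrite !evz rmorph0.
Qed.

Lemma adjointable_normed_star_algebra :
  normed_star_algebra (fun A B => A \o B) op_adjoint op_norm adjointable.
Proof.
have LZ (c : C) A B : adjointable A -> adjointable B -> adjointable (c *: A + B).
  move=> [bA [S [bS AS]]] [bB [U [bU BU]]]; split; first exact: bounded_op_lin.
  by exists ((c^*)%C *: S + U); split; [exact: bounded_op_lin|exact: adjL].
have LM A B : adjointable A -> adjointable B -> adjointable (A \o B).
  move=> [bA [S [bS AS]]] [bB [U [bU BU]]]; split; first exact: bounded_op_comp.
  by exists (U \o S); split; [exact: bounded_op_comp|exact: adj_comp].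
split; split=> //.
- by split; [exact: bounded_op_zero|exists 0; split; [exact: bounded_op_zero|exact: adj_0]].
- move=> A LA; have [bS AS] := op_adjointP LA; split=> //.
  by exists A; split; [exact: LA.1|exact: adj_sym].
- move=> c A B S [bA _] [bB _] [bS _]; apply/funext => u.
  change (S (c *: A u + B u) = c *: S (A u) + S (B u)).
  have [Hu|nu] := pselect (H u); first exact: (bounded_opL c bS (bounded_opH bA Hu) (bounded_opH bB Hu)).
  by rewrite (bA.2 _ nu) (bB.2 _ nu) !scaler0 addr0 bounded_op0// scaler0 addr0.
- move=> c A B LA LB; have [bS AS] := op_adjointP LA; have [bU BU] := op_adjointP LB.
  by apply: op_adjointE; [exact: bounded_op_lin LA.1 LB.1|exact: bounded_op_lin|exact: adjL LA.1 LB.1 _ _ _ _].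
- move=> A B LA LB; have [bS AS] := op_adjointP LA; have [bU BU] := op_adjointP LB.
  by apply: op_adjointE; [exact: bounded_op_comp LA.1 LB.1|exact: bounded_op_comp|exact: adj_comp LA.1 LB.1 _ _ _ _].
- move=> A LA; have [bS AS] := op_adjointP LA.
  by apply: op_adjointE => //; [exact: LA.1|exact: adj_sym].
- by move=> A [bA _]; split; [exact: op_norm_ge0|exact: op_norm_eq0].
- by move=> c A [bA _]; exact: op_normZ.
- by move=> A B [bA _] [bB _]; exact: op_normD.
- by move=> A B [bA _] [bB _]; exact: op_normM.
Qed.

Lemma adjointable_Cstar A : adjointable A -> op_norm (op_adjoint A \o A) = op_norm A ^+ 2.
Proof. by move=> LA; have [bS AS] := op_adjointP LA; exact: op_norm_Cstar LA.1 _ _. Qed.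

(** The limit is taken pointwise; the Cauchy condition in the operator norm makes
    the convergence uniform on bounded sets. *)
Lemma bounded_op_complete (A : nat -> D -> D) : (forall i, bounded_op (A i)) ->
  (forall e : R, 0 < e -> exists N, forall i j, (N <= i)%N -> (N <= j)%N ->
     op_norm (A i - A j) < e) ->
  exists2 B, bounded_op B & forall e : R, 0 < e -> \forall i \near \oo, op_norm (A i - B) < e.
Proof.
move=> bA AC.
have bAB i j : bounded_op (A i - A j).
  by rewrite addrC -scaleN1r; exact: bounded_op_lin.
have ptC u : H u -> forall e : R, 0 < e -> exists N, forall i j,
    (N <= i)%N -> (N <= j)%N -> hn (A i u - A j u) < e.
  move=> Hu e e0; have k0 : 0 < hn u + 1 by rewrite ltr_wpDl// ip_norm_ge0.
  have [N NP] := AC (e / (hn u + 1)) ltac:(by rewrite divr_gt0).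
  exists N => i j Ni Nj; have := op_normP (bAB i j) Hu.
  have -> : (A i - A j) u = A i u - A j u by [].
  move/le_lt_trans; apply.
  apply: (@le_lt_trans _ _ (op_norm (A i - A j) * (hn u + 1))).
    by rewrite ler_wpM2l ?op_norm_ge0// lerDl.
  by rewrite -ltr_pdivlMr//; exact: NP.
have /choice[B BP] : forall u, exists v, (H u -> H v /\ forall e : R, 0 < e ->
    \forall i \near \oo, hn (A i u - v) < e) /\ (~ H u -> v = 0).
  move=> u; have [Hu|nu] := pselect (H u); last by exists 0.
  have [v Hv vP] := complete (fun i => bounded_opH (bA i) Hu) (ptC u Hu).
  by exists v.
have HBu u : H u -> H (B u) by move=> /(BP u).1[].
have Bcvg u : H u -> forall e : R, 0 < e -> \forall i \near \oo, hn (A i u - B u) < e.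
  by move=> /(BP u).1[].
have small w : H w -> (forall e : R, 0 < e -> hn w <= e) -> w = 0.
  move=> Hw we; apply: ip_norm_eq0 => //; apply/eqP; rewrite eq_le ip_norm_ge0 andbT.
  by apply/ler_addgt0Pr => e e0; rewrite add0r; exact: we.
have Blin (a : C) u v : H u -> H v -> B (a *: u + v) = a *: B u + B v.
  move=> Hu Hv; have Huv := HL a Hu Hv.
  have HBl : H (a *: B u + B v) by apply: HL; exact: HBu.
  apply/eqP; rewrite -subr_eq0; apply/eqP/small; first by apply: hilbertB => //; exact: HBu.
  move=> e e0; pose k := nc a + 1; have k0 : 0 < k by rewrite ltr_wpDl// normc_ge0.
  have e3 : 0 < e / 3 by rewrite divr_gt0.
  have [i [A1 [A2 A3]]] : exists i, hn (A i (a *: u + v) - B (a *: u + v)) < e / 3 /\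
      hn (A i u - B u) < e / 3 / k /\ hn (A i v - B v) < e / 3.
    have /= [N _ /(_ N (leqnn N)) ?] : \forall i \near \oo,
        hn (A i (a *: u + v) - B (a *: u + v)) < e / 3 /\
        hn (A i u - B u) < e / 3 / k /\ hn (A i v - B v) < e / 3.
      near=> i; split; first by near: i; exact: Bcvg.
      by split; near: i; apply: Bcvg => //; rewrite divr_gt0.
    by exists N.
  have HAi w : H w -> H (A i w) by exact: bounded_opH.
  apply: le_trans (ip_norm_triangle (HBu _ Huv) (HAi _ Huv) HBl) _.
  rewrite ip_norm_distC; [|exact: HBu|exact: HAi].
  have -> : A i (a *: u + v) - (a *: B u + B v) = a *: (A i u - B u) + (A i v - B v).
    by rewrite (bounded_opL _ (bA i) Hu Hv) scalerBr opprD addrACA.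
  have Hu' : H (A i u - B u) by apply: hilbertB; [exact: HAi|exact: HBu].
  have Hv' : H (A i v - B v) by apply: hilbertB; [exact: HAi|exact: HBu].
  have B1 := ip_normL a Hu' Hv'.
  have B2 : nc a * hn (A i u - B u) <= e / 3.
    apply: (@le_trans _ _ (k * hn (A i u - B u))).
      by rewrite ler_wpM2r ?ip_norm_ge0// /k lerDl.
    by rewrite mulrC -ler_pdivlMr// ltW.
  have -> : e = e / 3 + (e / 3 + e / 3) by field.
  apply: lerD; first exact: ltW.
  by apply: le_trans B1 _; apply: lerD => //; exact: ltW.
have Bdist (e : R) : 0 < e -> exists N, forall i, (N <= i)%N ->
    forall u, H u -> hn (A i u - B u) <= e * hn u.
  move=> e0; have [N NP] := AC e e0; exists N => i Ni u Hu.
  apply/ler_addgt0Pr => d d0.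
  have [M _ MP] := Bcvg u Hu _ d0.
  pose j := maxn M N.
  apply: le_trans (ip_norm_triangle (bounded_opH (bA i) Hu) (bounded_opH (bA j) Hu) (HBu _ Hu)) _.
  apply: lerD; last by apply/ltW/(MP j); rewrite /= leq_maxl.
  apply: le_trans (op_normP (bAB i j) Hu) _.
  by rewrite ler_wpM2r ?ip_norm_ge0// ltW// NP// leq_maxr.
have bB : bounded_op B.
  split; last by move=> u /(BP u).2.
  split=> //; have [N NP] := Bdist 1 ltr01.
  exists (op_norm (A N) + 1); first by rewrite addr_ge0 ?op_norm_ge0.
  move=> u Hu; have := NP N (leqnn N) u Hu; rewrite mul1r => le1.
  rewrite mulrDl mul1r.
  have := ip_normB (bounded_opH (bA N) Hu) (hilbertB (bounded_opH (bA N) Hu) (HBu _ Hu)).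
  rewrite subKr => /le_trans; apply; apply: lerD => //.
  exact: op_normP.
exists B => // e e0; have e2 : 0 < e / 2 by rewrite divr_gt0.
have [N NP] := Bdist _ e2; exists N => // i /= Ni.
apply: (@le_lt_trans _ _ (e / 2)); last by rewrite ltr_pdivrMr// ltr_pMr// ltr1n.
by apply: op_norm_le; [exact: ltW|move=> u Hu; exact: NP].
Unshelve. all: by end_near. Qed.

(** Adjunction is isometric, so that the adjoints converge as well, and their
    limit is adjoint to the limit of the operators. *)
Lemma adjointable_complete (A : nat -> D -> D) : (forall i, adjointable (A i)) ->
  (forall e : R, 0 < e -> exists N, forall i j, (N <= i)%N -> (N <= j)%N ->
     op_norm (A i - A j) < e) ->
  exists2 B, adjointable B & op_norm (A i - B) @[i --> \oo] --> (0 : R).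
Proof.
move=> LA AC; have bA i : bounded_op (A i) by exact: (LA i).1.
have [B bB AB] := bounded_op_complete bA AC.
have bS i : bounded_op (op_adjoint (A i)) by exact: (op_adjointP (LA i)).1.
have AS i : adjoint_pair (A i) (op_adjoint (A i)) by exact: (op_adjointP (LA i)).2.
have SC (e : R) : 0 < e -> exists N, forall i j, (N <= i)%N -> (N <= j)%N ->
    op_norm (op_adjoint (A i) - op_adjoint (A j)) < e.
  move=> /AC[N NP]; exists N => i j Ni Nj.
  have E (f : nat -> D -> D) : f i - f j = (-1) *: f j + f i.
    by rewrite scaleN1r addrC.
  rewrite (E (fun k => op_adjoint (A k))) (@op_norm_adj ((-1) *: A j + A i)).
  - by rewrite -E; exact: NP.
  - exact: bounded_op_lin.
  - exact: bounded_op_lin.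
  - by have := adjL (-1) (bA j) (bA i) (bS j) (bS i) (AS j) (AS i); rewrite rmorphN1.
have [S bS' SS] := bounded_op_complete bS SC.
exists B; last first.
  apply/cvgrPdist_lt => e e0; near=> i; rewrite sub0r normrN ger0_norm ?op_norm_ge0//.
  by near: i; exact: AB.
split=> //; exists S; split=> // x y.
have evc (F : nat -> D -> D) (G : D -> D) s t : (forall i, bounded_op (F i)) -> bounded_op G ->
    (forall e : R, 0 < e -> \forall i \near \oo, op_norm (F i - G) < e) ->
    tends_to (fun i => ev (F i (tst s)) t) (ev (G (tst s)) t).
  move=> bF bG FG e e0; pose k := hn (tst s) * hn (tst t) + 1.
  have k0 : 0 < k by rewrite ltr_wpDl// mulr_ge0 ?ip_norm_ge0.
  have ek : 0 < e / k by rewrite divr_gt0.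
  apply: filterS (FG _ ek) => i Fi.
  have bFG : bounded_op (F i - G) by rewrite addrC -scaleN1r; exact: bounded_op_lin.
  rewrite -evB; [|exact: bounded_opH..].
  apply: le_lt_trans (ev_le _ _) _; first by apply: hilbertB; exact: bounded_opH.
  have := op_normP bFG (Htst s).
  have -> : (F i - G) (tst s) = F i (tst s) - G (tst s) by [].
  move=> le1.
  apply: (@le_lt_trans _ _ (op_norm (F i - G) * k)); last by rewrite -ltr_pdivlMr.
  apply: (@le_trans _ _ (op_norm (F i - G) * hn (tst s) * hn (tst t))).
    by rewrite ler_wpM2r ?ip_norm_ge0.
  by rewrite -mulrA ler_wpM2l ?op_norm_ge0// /k lerDl.
apply: tends_to_uniq (evc A B x y bA bB AB) _.
have := tends_toJ (evc (fun i => op_adjoint (A i)) S y x bS bS' SS).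
by move=> K e /K; apply: filterS => i; rewrite -(AS i x y).
Unshelve. all: by end_near. Qed.

End Operators.

(** * Smoothness of linear combinations *)

Section SmoothCombinations.
Context {R : realType}.

(** Iterated derivatives at a point depend on the values near the point, hence
    the open set. *)
Lemma smooth_on_ext (V W : normedModType R) (O : set V) (f g : V -> W) :
  open O -> (forall x, O x -> f x = g x) -> smooth_on O f -> smooth_on O g.
Proof.
move=> oO fg sf.
have nearO x : O x -> \forall y \near x, O y by move=> Ox; exact: open_nbhs_nbhs.
have E vs x : O x -> iterated_derive vs f x = iterated_derive vs g x.
  elim: vs x => [|v vs IH] x Ox /=; first exact: fg.
  by apply: near_eq_derive; apply: filterS (nearO _ Ox) => y /IH.
move=> vs x Ox; have [cf df] := sf vs x Ox.
have near_fg : \forall y \near x, iterated_derive vs f y = iterated_derive vs g y.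
  by apply: filterS (nearO _ Ox) => y; exact: E.
split.
  rewrite /prop_for /continuous_at -E//.
  by apply: cvg_trans cf; apply: near_eq_cvg; exact: near_fg.
by move=> v; apply: near_eq_derivable (df v); exact: near_fg.
Qed.

Lemma smooth_onL (V W : normedModType R) (O : set V) (a : R) (f g : V -> W) :
  open O -> smooth_on O f -> smooth_on O g ->
  smooth_on O (fun x => a *: f x + g x).
Proof.
move=> oO sf sg.
have nearO x : O x -> \forall y \near x, O y by move=> Ox; exact: open_nbhs_nbhs.
have E vs x : O x -> iterated_derive vs (fun x => a *: f x + g x) x =
    a *: iterated_derive vs f x + iterated_derive vs g x.
  elim: vs x => [//|v vs IH] x Ox /=.
  have [_ df] := sf vs x Ox; have [_ dg] := sg vs x Ox.
  transitivity ('D_v (a *: iterated_derive vs f + iterated_derive vs g) x).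
    by apply: near_eq_derive; apply: filterS (nearO _ Ox) => y /IH.
  by rewrite deriveD ?deriveZ//; exact: derivableZ.
move=> vs x Ox; have [cf df] := sf vs x Ox; have [cg dg] := sg vs x Ox.
have near_E : \forall y \near x, a *: iterated_derive vs f y + iterated_derive vs g y =
    iterated_derive vs (fun x => a *: f x + g x) y.
  by apply: filterS (nearO _ Ox) => y /E.
split.
  rewrite /prop_for /continuous_at E//.
  apply: cvg_trans; first by apply: near_eq_cvg; exact: near_E.
  by apply: cvgD => //; apply: cvgZ => //; exact: cvg_cst.
move=> v; apply: (@near_eq_derivable _ _ _ (a *: iterated_derive vs f + iterated_derive vs g)).
  exact: near_E.
by apply: derivableD => //; exact: derivableZ.
Qed.

Lemma smooth_on_cst (V W : normedModType R) (O : set V) (c : W) :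
  smooth_on O (fun=> c).
Proof.
move=> vs x _.
have [c' E] : exists c' : W, iterated_derive vs (fun=> c : W) = (fun _ : V => c').
  elim: vs => [|v vs [c' IH]] /=; first by exists c.
  by exists 0; rewrite IH; apply/funext => y; exact: derive_cst.
by rewrite E; split; [exact: cvg_cst|move=> v; exact: derivable_cst].
Qed.

End SmoothCombinations.

Section SmoothFunctions.
Context {R : realType} {n : nat} {M : manifold R n}.
Local Notation C := R[i].

Lemma chart_image_open (c : chart R n M) (W : set M) : atlas c -> open W ->
  open (cmap c @` (cdom c `&` W)).
Proof.
move=> /atlas_chart[_ oI K _ ccinv] oW.
have -> : cmap c @` (cdom c `&` W) = cimg c `&` [set y | W (cinv c y)].
  apply/seteqP; split=> [y [x [dx Wx] <-]|y [[x dx <-]]] /=.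
    by split; [exists x|rewrite /= K].
  by rewrite K// => Wx; exists x.
rewrite openE => y [Iy Wy]; apply: filterI; first exact: open_nbhs_nbhs.
by apply: (ccinv y Iy); exact: open_nbhs_nbhs.
Qed.

Lemma smoothM_on_ext (W : set M) (f g : M -> R^o) : open W ->
  (forall x, W x -> f x = g x) -> smoothM_on W f -> smoothM_on W g.
Proof.
move=> oW fg sf c ac; apply: smooth_on_ext (sf c ac); first exact: chart_image_open.
have [_ _ K _ _] := atlas_chart ac.
by move=> _ [x [dx Wx] <-] /=; rewrite K// fg.
Qed.

Lemma smoothM_onL (W : set M) (a : R) (f g : M -> R^o) : open W ->
  smoothM_on W f -> smoothM_on W g -> smoothM_on W (fun x => a * f x + g x).
Proof.
move=> oW sf sg c ac.
by apply: (smooth_onL a _ (sf c ac) (sg c ac)); exact: chart_image_open.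
Qed.

Lemma smoothM_on_cst (W : set M) (c : R) : smoothM_on W (fun=> c : R^o).
Proof. by move=> d _; exact: smooth_on_cst. Qed.

Lemma smoothM_continuous (f : M -> R^o) : smoothM f -> continuous f.
Proof.
move=> sf x; have [c ac dx] := atlas_cover x.
have [od _ K ccmap _] := atlas_chart ac.
have [cf _] := sf c ac [::] (cmap c x) ltac:(by exists x).
rewrite /continuous_at -[f x](_ : (f \o cinv c) (cmap c x) = f x); last by rewrite /= K.
apply: cvg_trans; last exact: (cvg_comp _ _ (ccmap x dx) cf).
apply: near_eq_cvg; have : \forall y \near x, cdom c y by exact: open_nbhs_nbhs.
by apply: filterS => y dy /=; rewrite K.
Qed.

Lemma csmoothM_on_ext (W : set M) (f g : M -> C) : open W ->
  (forall x, W x -> f x = g x) -> csmoothM_on W f -> csmoothM_on W g.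
Proof.
move=> oW fg [s1 s2]; split.
- by apply: smoothM_on_ext s1 => // x Wx; rewrite fg.
- by apply: smoothM_on_ext s2 => // x Wx; rewrite fg.
Qed.

Lemma csmoothM_onL (W : set M) (a : C) (f g : M -> C) : open W ->
  csmoothM_on W f -> csmoothM_on W g -> csmoothM_on W (fun x => a * f x + g x).
Proof.
move=> oW [f1 f2] [g1 g2]; split.
- have := smoothM_onL (complex.Re a) oW f1 (smoothM_onL (- complex.Im a) oW f2 g1).
  apply: smoothM_on_ext => // x _.
  by case: a (f x) (g x) => ? ? [? ?] [? ?] /=; ring.
- have := smoothM_onL (complex.Re a) oW f2 (smoothM_onL (complex.Im a) oW f1 g2).
  apply: smoothM_on_ext => // x _.
  by case: a (f x) (g x) => ? ? [? ?] [? ?] /=; ring.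
Qed.

Lemma csmoothM_on_cst (W : set M) (c : C) : csmoothM_on W (fun=> c).
Proof. by split; exact: smoothM_on_cst. Qed.

Lemma tangent_cst (x : M) (v : tvector M) (c : R) : tangent x v -> v (fun=> c) = 0.
Proof.
move=> [_ vL vM]; have s1 := @smoothM_on_cst setT 1; have s0 := @smoothM_on_cst setT 0.
have v1 : v (fun=> 1) = 0.
  have := vM _ _ s1 s1; rewrite /= mulr1.
  have -> : 1 * v (fun=> 1) + v (fun=> 1) * 1 = v (fun=> 1) + v (fun=> 1) :> R by ring.
  by move/eqP; rewrite -[X in X == _]addr0 (inj_eq (addrI _)) eq_sym => /eqP.
have v0 : v (fun=> 0) = 0.
  have := vL (-1) _ _ s0 s0; rewrite mulr0 addr0 => ->; ring.
have := vL c _ _ s1 s0; rewrite mulr1 addr0 v1 v0 => ->; ring.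
Qed.

Lemma cderiv_cst (x : M) (v : tvector M) (c : C) : tangent x v -> cderiv v (fun=> c) = 0.
Proof. by move=> tv; rewrite /cderiv !(tangent_cst _ tv). Qed.

Lemma smooth_vfield0 : smooth_vfield (0 : vfield M).
Proof.
split=> [x|f _]; last exact: smoothM_on_cst.
by split=> // *; rewrite /= !(mulr0, mul0r, addr0).
Qed.

End SmoothFunctions.

(** * Linear combinations of test sections *)

Section TestSections.
Context {R : realType} {n : nat} {M : manifold R n} {r : nat}.
Variable E : hermitian_bundle M r.
Local Notation C := R[i].
Implicit Types (s t : section E) (phi psi : test E).

Lemma smooth_sectionL (a : C) s t : smooth_section s -> smooth_section t ->
  smooth_section (a *: s + t).
Proof.
move=> ss st tau At j; have [triv _ _] := @bundleP _ _ _ _ E.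
have [ot tlin _] := triv tau At.
apply: csmoothM_on_ext (csmoothM_onL a ot (ss tau At j) (st tau At j)) => // x tx.
have -> : (a *: s + t) x = a *: s x + t x by [].
by rewrite (tlin x tx) !mxE.
Qed.

Lemma smooth_section0 : smooth_section (0 : section E).
Proof.
move=> tau At j; have [triv _ _] := @bundleP _ _ _ _ E.
have [ot tlin _] := triv tau At.
apply: csmoothM_on_ext (@csmoothM_on_cst R n M (tdom tau) 0) => // x tx.
have -> : (0 : section E) x = 0 by [].
have /eqP := tlin x tx (-1) 0 0; rewrite !scaleN1r !addNr => /eqP ->.
by rewrite mxE.
Qed.

Lemma test_sectionL (a : C) s t : test_section s -> test_section t ->
  test_section (a *: s + t).
Proof.
move=> [ss cs] [st ct]; split; first exact: smooth_sectionL.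
apply: (subclosed_compact _ (compactU cs ct)); first exact: closed_closure.
rewrite -closureU; apply: closure_subset => x /= H.
have [sx|sx] := eqVneq (s x) 0; last by left.
right; apply: contraNneq H => tx.
have -> : (a *: s + t) x = a *: s x + t x by [].
by rewrite sx tx scaler0 addr0.
Qed.

Lemma test_section0 : test_section (0 : section E).
Proof.
split; first exact: smooth_section0.
rewrite (_ : [set x | _] = set0) ?closure0; first exact: compact0.
by apply/seteqP; split=> // x /=; rewrite eqxx.
Qed.

Definition test_lin (a : C) phi psi : test E :=
  exist _ (a *: sval phi + sval psi) (test_sectionL a (svalP phi) (svalP psi)).

Definition test0 : test E := exist _ 0 test_section0.

End TestSections.

(** * Upper integrals *)

Section UpperIntegral.
Context {R : realType} {n : nat} {M : manifold R n} (g : riemannian M).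
Implicit Types (f h : M -> R^o).
Local Notation U := (upper_integral g).

Lemma cc_funL (a : R) f h : cc_fun f -> cc_fun h -> cc_fun (fun x => a * f x + h x : R^o).
Proof.
move=> [cf sf] [ch sh]; split.
  by move=> x; apply: cvgD; [apply: cvgM; [exact: cvg_cst|exact: cf]|exact: ch].
apply: (subclosed_compact _ (compactU sf sh)); first exact: closed_closure.
rewrite -closureU; apply: closure_subset => x /= H.
have [fx|fx] := eqVneq (f x) 0; last by left.
by right; apply: contraNneq H => hx; rewrite fx hx mulr0 addr0.
Qed.

Lemma cc_fun0 : cc_fun ((fun=> 0) : M -> R^o).
Proof.
split; first by move=> x; exact: cvg_cst.
rewrite (_ : [set x | _] = set0) ?closure0; first exact: compact0.
by apply/seteqP; split=> // x /=; rewrite eqxx.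
Qed.

Lemma volL (a : R) f h : cc_fun f -> cc_fun h ->
  vol g (fun x => a * f x + h x) = a * vol g f + vol g h.
Proof. by have [volL _ _] := volP g => cf ch; exact: volL. Qed.

Lemma vol_ge0 f : cc_fun f -> (forall x, 0 <= f x) -> 0 <= vol g f.
Proof. by have [_ vol0 _] := volP g => cf f0; exact: vol0. Qed.

Lemma vol0 : vol g (fun=> 0) = 0.
Proof.
have := volL (-1) cc_fun0 cc_fun0; rewrite mulr0 addr0 => ->; ring.
Qed.

Lemma volZ (a : R) f : cc_fun f -> vol g (fun x => a * f x) = a * vol g f.
Proof.
move=> cf; have := volL a cf cc_fun0; rewrite vol0 addr0 => <-.
by congr (vol g); apply/funext => x; rewrite addr0.
Qed.

Lemma le_vol f h : cc_fun f -> cc_fun h -> (forall x, f x <= h x) -> vol g f <= vol g h.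
Proof.
move=> cf ch fh; rewrite -subr_ge0.
have -> : vol g h - vol g f = vol g (fun x => (-1) * f x + h x).
  by rewrite volL//; ring.
apply: vol_ge0; first exact: cc_funL.
by move=> x; rewrite mulN1r addrC subr_ge0.
Qed.

Lemma upper_integral_ge0 f : (forall x, 0 <= f x) -> (0 <= U f)%E.
Proof.
move=> f0; apply/ereal_infP => _ [h [ch fh] <-]; rewrite lee_fin.
by apply: vol_ge0 => // x; exact: le_trans (fh x).
Qed.

Lemma upper_integral_cc f : cc_fun f -> U f = (vol g f)%:E.
Proof.
move=> cf; apply/eqP; rewrite eq_le; apply/andP; split.
  by apply: ereal_inf_lbound; exists f.
by apply/ereal_infP => _ [h [ch fh] <-]; rewrite lee_fin; exact: le_vol.
Qed.

(** Upper integrals need not be additive, but majorants can be added. *)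
Lemma le_upper_integralL (c d x y : R) (f f1 f2 : M -> R) : 0 <= c -> 0 <= d ->
  (forall z, f z <= c * f1 z + d * f2 z) -> U f1 = x%:E -> U f2 = y%:E ->
  (U f <= (c * x + d * y)%:E)%E.
Proof.
move=> c0 d0 ff U1 U2; apply/lee_addgt0Pr => e e0.
have adh F z : U F = z%:E -> forall e : R, 0 < e ->
    exists h : M -> R^o, [/\ cc_fun h, forall x, F x <= h x & vol g h < z + e].
  move=> UF e' e'0; have : (U F < (z + e')%:E)%E by rewrite UF lte_fin ltrDl.
  by move=> /ereal_inf_lt[_ [h [ch Fh] <-]]; rewrite lte_fin => hz; exists h.
have k0 : 0 < c + d + 1 by rewrite ltr_wpDl// addr_ge0.
have ek : 0 < e / (c + d + 1) by rewrite divr_gt0.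
have [h1 [ch1 fh1 v1]] := adh _ _ U1 _ ek.
have [h2 [ch2 fh2 v2]] := adh _ _ U2 _ ek.
have cd2 : cc_fun (fun x => d * h2 x + 0 : R^o) by apply: cc_funL => //; exact: cc_fun0.
have le1 : (U f <= (vol g (fun x => c * h1 x + (d * h2 x + 0)))%:E)%E.
  apply: ereal_inf_lbound; exists (fun x => c * h1 x + (d * h2 x + 0)) => //.
  split; first exact: cc_funL.
  by move=> z; rewrite addr0; apply: le_trans (ff z) _; rewrite lerD// ler_wpM2l.
apply: le_trans le1 _; rewrite -EFinD lee_fin volL// volL//; last exact: cc_fun0.
rewrite vol0 addr0.
set q := e / _ in v1 v2 ek.
have H1 : c * vol g h1 <= c * (x + q) by rewrite ler_wpM2l// ltW.
have H2 : d * vol g h2 <= d * (y + q) by rewrite ler_wpM2l// ltW.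
have H3 : (c + d) * q <= e.
  apply: (@le_trans _ _ ((c + d + 1) * q)); first by rewrite ler_wpM2r ?(ltW ek)// lerDl.
  by rewrite /q mulrC divfK// gt_eqF.
by move: H1 H2 H3; rewrite !mulrDr mulrDl; move: (c * vol g h1) (d * vol g h2) (c * x) (d * y) (c * q) (d * q) => *; lra.
Qed.

End UpperIntegral.

(** * Sobolev norms of test sections *)

Section TestNorm.
Context {R : realType} {n : nat} {M : manifold R n} (g : riemannian M).
Context {r : nat} (E : hermitian_bundle M r).
Local Notation C := R[i].
Local Notation U := (upper_integral g).
Implicit Types (s t : section E) (phi psi : test E).

Lemma hmetricL x (a : C) (u v w : E x) : hmetric (a *: u + v) w = a * hmetric u w + hmetric v w.
Proof. by have [H _ _ _] := @hmetricP _ _ _ _ E; exact: H. Qed.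

Lemma hmetricJ x (u v : E x) : hmetric v u = (hmetric u v)^*%C.
Proof. by have [_ H _ _] := @hmetricP _ _ _ _ E; exact: H. Qed.

Lemma hmetric_ge0 x (u : E x) : 0 <= hmetric u u.
Proof.
have [_ _ H _] := @hmetricP _ _ _ _ E.
have [->|u0] := eqVneq u 0; last exact/ltW/H.
have := hmetricL (-1) (0 : E x) 0 0.
by rewrite scaler0 addr0 mulN1r addNr => ->.
Qed.

Definition fibre_norm x (u : E x) : R := prenorm (@hmetric _ _ _ _ E x) u.

Lemma fibre_normL x (a : C) (u v : E x) :
  fibre_norm (a *: u + v) <= nc a * fibre_norm u + fibre_norm v.
Proof.
exact: (@prenormL _ _ (fun a u v => a *: u + v) _ (@hmetricL x) (@hmetricJ x) (@hmetric_ge0 x)).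
Qed.

Lemma sqnorm_fibre s x : sqnorm s x = fibre_norm (s x) ^+ 2.
Proof. by rewrite /sqnorm (pair_diag (@hmetric_ge0 x)). Qed.

(** The triangle inequality of the Sobolev norms is derived from its weighted
    forms: the right-hand side is linear in the squares, so that it passes
    through sums and upper integrals, and [le_sqr_weighted] recovers
    [(p + q) ^+ 2] as its infimum over the weights [e]. *)
Lemma sqr_le_weighted (e p q z : R) : 0 < e -> 0 <= z -> z <= p + q ->
  z ^+ 2 <= (1 + e) * p ^+ 2 + (1 + e^-1) * q ^+ 2.
Proof.
move=> e0 z0 zpq.
have : z ^+ 2 <= (p + q) ^+ 2 by rewrite ler_pXn2r ?nnegrE// (le_trans z0).
move/le_trans; apply; rewrite -subr_ge0.
have -> : (1 + e) * p ^+ 2 + (1 + e^-1) * q ^+ 2 - (p + q) ^+ 2 = (e * p - q) ^+ 2 / e.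
  by field; rewrite gt_eqF.
by rewrite divr_ge0 ?sqr_ge0// ltW.
Qed.

Lemma le_sqr_weighted (p q z : R) : 0 <= p -> 0 <= q ->
  (forall e : R, 0 < e -> z <= (1 + e) * p ^+ 2 + (1 + e^-1) * q ^+ 2) ->
  z <= (p + q) ^+ 2.
Proof.
move=> p0 q0 H; apply/ler_addgt0Pr => d d0.
(* the optimal weight is [q / p]; adding [c] makes it positive and finite *)
pose k := 4 * (p + q) + 4.
have k0 : 0 < k by rewrite /k; lra.
pose c := Num.min 1 (d / k).
have c0 : 0 < c by rewrite lt_min ltr01 divr_gt0.
have c1 : c <= 1 by rewrite ge_min lexx.
have ck : c * k <= d by rewrite -ler_pdivlMr// ge_min lexx orbT.
have pc : 0 < p + c by rewrite ltr_wpDl.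
have qc : 0 < q + c by rewrite ltr_wpDl.
have := H ((q + c) / (p + c)) (divr_gt0 qc pc).
move/le_trans; apply.
apply: (@le_trans _ _ ((p + c + (q + c)) ^+ 2)).
  rewrite invf_div.
  have le1 : p ^+ 2 <= (p + c) ^+ 2 by rewrite ler_pXn2r ?nnegrE ?(ltW pc)// lerDl ltW.
  have le2 : q ^+ 2 <= (q + c) ^+ 2 by rewrite ler_pXn2r ?nnegrE ?(ltW qc)// lerDl ltW.
  have -> : (p + c + (q + c)) ^+ 2 = (1 + (q + c) / (p + c)) * (p + c) ^+ 2 +
      (1 + (p + c) / (q + c)) * (q + c) ^+ 2.
    by field; rewrite !gt_eqF.
  by apply: lerD; apply: ler_wpM2l => //; rewrite addr_ge0// divr_ge0// ltW.
rewrite -lerBlDl.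
have -> : (p + c + (q + c)) ^+ 2 - (p + q) ^+ 2 = c * (4 * (p + q) + 4 * c) by ring.
apply: le_trans ck; rewrite ler_pM2l// /k lerD2l.
by rewrite -[leRHS]mulr1 ler_pM2l.
Qed.

Lemma nablaL X (a : C) s t : smooth_vfield X -> smooth_section s -> smooth_section t ->
  nabla X (a *: s + t) = a *: nabla X s + nabla X t.
Proof.
move=> sX ss st; have [_ _ H] := @nablaP _ _ _ _ E.
have := H (fun=> a) X s t (@csmoothM_on_cst _ _ _ setT a) sX ss st.
move=> ->; apply: functional_extensionality_dep => x.
have [tX _] := sX.
have -> : cderiv (X x) (fun=> a) = 0 by exact: cderiv_cst (tX x).
by rewrite scale0r addr0.
Qed.

Lemma nabla_smooth X s : smooth_vfield X -> smooth_section s -> smooth_section (nabla X s).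
Proof. by have [H _ _] := @nablaP _ _ _ _ E; exact: H. Qed.

Lemma lc_smooth X Y : smooth_vfield X -> smooth_vfield Y -> smooth_vfield (lc g X Y).
Proof. by have [H _] := lcP g; exact: H. Qed.

Local Notation nab := (nabla_iter g (@nabla _ _ _ _ E)).

Lemma smooth_section_sum (I : Type) (l : seq I) (F : I -> section E) :
  (forall i, smooth_section (F i)) -> smooth_section (\sum_(i <- l) F i).
Proof.
move=> sF; elim/big_rec : _ => [|i s _ ss]; first exact: smooth_section0.
have := smooth_sectionL 1 (sF i) ss; rewrite scale1r; exact.
Qed.

Lemma smooth_sectionB s t : smooth_section s -> smooth_section t -> smooth_section (s - t).
Proof.
by move=> ss st; have := smooth_sectionL (-1) st ss; rewrite scaleN1r addrC; exact.
Qed.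

Lemma nabla_iter_smooth k (Xs : seq (vfield M)) : (forall i, smooth_vfield (nth 0 Xs i)) ->
  forall s, smooth_section s -> smooth_section (nab k s Xs).
Proof.
elim: k Xs => [//|k IH] [_ s _|X Ys sX s ss] /=; first exact: smooth_section0.
have sX0 : smooth_vfield X := sX 0%N.
have sY i : smooth_vfield (nth 0 Ys i) := sX i.+1.
have s1 := nabla_smooth sX0 (IH _ sY _ ss).
have s2 (j : 'I_(size Ys)) :
    smooth_section (nab k s (set_nth 0 Ys j (lc g X (nth 0 Ys j)))).
  apply: (IH _ _ s ss) => i.
  by rewrite nth_set_nth /=; case: ifP => _; [apply: (lc_smooth sX0 (sY _))|exact: sY].
exact: (smooth_sectionB s1 (smooth_section_sum _ s2)).
Qed.

Lemma nabla_iterL k (Xs : seq (vfield M)) : (forall i, smooth_vfield (nth 0 Xs i)) ->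
  forall (a : C) s t, smooth_section s -> smooth_section t ->
  nab k (a *: s + t) Xs = a *: nab k s Xs + nab k t Xs.
Proof.
elim: k Xs => [//|k IH] [_ a s t _ _|X Ys sX a s t ss st] /=.
  by rewrite scaler0 addr0.
have sX0 : smooth_vfield X := sX 0%N.
have sY i : smooth_vfield (nth 0 Ys i) := sX i.+1.
have sset (j : 'I_(size Ys)) i : smooth_vfield (nth 0 (set_nth 0 Ys j (lc g X (nth 0 Ys j))) i).
  by rewrite nth_set_nth /=; case: ifP => _; [apply: (lc_smooth sX0 (sY _))|exact: sY].
rewrite (IH _ sY a s t ss st).
rewrite (nablaL a sX0 (nabla_iter_smooth k sY ss) (nabla_iter_smooth k sY st)).
under eq_bigr => j _ do rewrite (IH _ (sset j) a s t ss st).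
by rewrite big_split /= -scaler_sumr scalerBr opprD addrACA.
Qed.

Lemma sqnorm_nabla_ge0 i s x : 0 <= sqnorm_nabla g i s x.
Proof. by apply: sumr_ge0 => m _; rewrite sqnorm_fibre sqr_ge0. Qed.

Lemma nabla_frame_smooth (X : 'I_n -> vfield M) (l : seq 'I_n) :
  (forall j, smooth_vfield (X j)) -> forall i, smooth_vfield (nth 0 [seq X j | j <- l] i).
Proof.
move=> sX i; elim: l i => [|j l IH] [|i] /=;
  [exact: smooth_vfield0|exact: smooth_vfield0|exact: sX|exact: IH].
Qed.

(** The frame chosen at [x] does not depend on the section, and [nabla^i] is
    linear in the section for a fixed frame. *)
Lemma sqnorm_nabla_weighted i (a : C) s t x (e : R) :
  smooth_section s -> smooth_section t -> 0 < e ->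
  sqnorm_nabla g i (a *: s + t) x <=
  (1 + e) * nc a ^+ 2 * sqnorm_nabla g i s x + (1 + e^-1) * sqnorm_nabla g i t x.
Proof.
move=> ss st e0; rewrite /sqnorm_nabla; set X := xget _ _.
(* where [M] has no such frame, the chosen default is the zero field *)
have sX j : smooth_vfield (X j).
  by rewrite /X; case: xgetP => [Y _ [sY _]|_]; [exact: sY|exact: smooth_vfield0].
rewrite !mulr_sumr -big_split /=; apply: ler_sum => m _.
have sXm := nabla_frame_smooth m sX.
rewrite (nabla_iterL i sXm a ss st).
rewrite !sqnorm_fibre -mulrA -exprMn; apply: sqr_le_weighted => //.
  exact: prenorm_ge0.
exact: fibre_normL.
Qed.

Lemma sqnorm_nabla0 i x : sqnorm_nabla g i (0 : section E) x = 0.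
Proof.
rewrite /sqnorm_nabla; set X := xget _ _.
have sX j : smooth_vfield (X j).
  by rewrite /X; case: xgetP => [Y _ [sY _]|_]; [exact: sY|exact: smooth_vfield0].
apply: big1 => m _; have s0 := @smooth_section0 _ _ _ _ E.
have := nabla_iterL i (nabla_frame_smooth m sX) (-1) s0 s0.
rewrite scaler0 addr0 scaleN1r addNr => ->.
have := hmetricL (-1) (0 : E x) 0 0.
by rewrite scaler0 addr0 mulN1r addNr /sqnorm => ->.
Qed.

Definition sqtest_norm k s : \bar R := (\sum_(0 <= i < k.+1) U (sqnorm_nabla g i s))%E.

Lemma sqtest_norm_ge0 k s : (0 <= sqtest_norm k s)%E.
Proof.
by apply: sume_ge0 => i _; apply: upper_integral_ge0 => x; exact: sqnorm_nabla_ge0.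
Qed.

Lemma test_norm_ge0 k s : (0 <= test_norm g k s)%E.
Proof. exact: poweR_ge0. Qed.

Lemma test_norm_le k s (A : R) : 0 <= A ->
  (test_norm g k s <= A%:E)%E = (sqtest_norm k s <= (A ^+ 2)%:E)%E.
Proof.
move=> A0; rewrite /test_norm -/(sqtest_norm k s).
have := sqtest_norm_ge0 k s; case: (sqtest_norm k s) => [y| |//]; last first.
  by rewrite poweRyr ?invr_eq0// !leye_eq.
rewrite lee_fin => y0; rewrite poweR_EFin !lee_fin powR12_sqrt//.
by rewrite -{1}(ger0_norm A0) -sqrtr_sqr ler_sqrt// sqr_ge0.
Qed.

Lemma sqtest_normL k (a : C) s t (e : R) (x y : R) : smooth_section s -> smooth_section t ->
  0 < e -> (sqtest_norm k s <= x%:E)%E -> (sqtest_norm k t <= y%:E)%E ->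
  (sqtest_norm k (a *: s + t)%R <= ((1 + e) * nc a ^+ 2 * x + (1 + e^-1) * y)%:E)%E.
Proof.
move=> ss st e0 xs yt.
have fin u z : (sqtest_norm k u <= z%:E)%E -> forall i, (i < k.+1)%N ->
    exists b : R, U (sqnorm_nabla g i u) = b%:E.
  move=> uz i ik.
  have U0 j : (0 <= U (sqnorm_nabla g j u))%E.
    by apply: upper_integral_ge0 => v; exact: sqnorm_nabla_ge0.
  have : (U (sqnorm_nabla g i u) <= z%:E)%E.
    apply: le_trans uz; rewrite /sqtest_norm big_mkord (bigD1 (Ordinal ik))//=.
    by rewrite leeDl// sume_ge0.
  by have := U0 i; case: (U _) => [b| |//] _; [exists b|rewrite leye_eq].
pose b (u : section E) (i : nat) : R := fine (U (sqnorm_nabla g i u)).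
have bE u z : (sqtest_norm k u <= z%:E)%E -> sqtest_norm k u = (\sum_(0 <= i < k.+1) b u i)%:E.
  move=> uz; rewrite /sqtest_norm -sumEFin; apply: eq_big_nat => i /andP[_ ik].
  by rewrite /b; have [c ->] := fin _ _ uz i ik.
have := xs; have := yt; rewrite (bE _ _ xs) (bE _ _ yt) !lee_fin => ySt xSs.
have c1 : 0 <= (1 + e) * nc a ^+ 2 by rewrite mulr_ge0 ?sqr_ge0// addr_ge0// ltW.
have c2 : 0 <= 1 + e^-1 by rewrite addr_ge0// invr_ge0 ltW.
apply: (@le_trans _ _ (\sum_(0 <= i < k.+1) ((1 + e) * nc a ^+ 2 * b s i + (1 + e^-1) * b t i))%:E).
  rewrite -sumEFin /sqtest_norm big_nat [leRHS]big_nat; apply: lee_sum => i /andP[_ ik].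
  apply: (@le_upper_integralL _ _ _ g _ _ _ _ _ (sqnorm_nabla g i s) (sqnorm_nabla g i t)) => //.
  - by move=> z; exact: sqnorm_nabla_weighted.
  - by rewrite /b; have [c ->] := fin _ _ xs i ik.
  - by rewrite /b; have [c ->] := fin _ _ yt i ik.
by rewrite lee_fin big_split /= -!mulr_sumr lerD// ler_wpM2l.
Qed.

Lemma test_normL k (a : C) s t (A B : R) : smooth_section s -> smooth_section t ->
  0 <= A -> 0 <= B -> (test_norm g k s <= A%:E)%E -> (test_norm g k t <= B%:E)%E ->
  (test_norm g k (a *: s + t)%R <= (nc a * A + B)%:E)%E.
Proof.
move=> ss st A0 B0; rewrite !test_norm_le ?addr_ge0 ?mulr_ge0 ?normc_ge0// => sA tB.
have H e : 0 < e -> (sqtest_norm k (a *: s + t)%R <=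
    ((1 + e) * (nc a * A) ^+ 2 + (1 + e^-1) * B ^+ 2)%:E)%E.
  by move=> e0; rewrite exprMn mulrA; exact: sqtest_normL.
have := sqtest_norm_ge0 k (a *: s + t); have := H 1 ltr01.
case: (sqtest_norm k (a *: s + t)%R) H => [z| |//] H _ _; last by have := H 1 ltr01; rewrite leye_eq.
rewrite lee_fin; apply: le_sqr_weighted => //; first by rewrite mulr_ge0 ?normc_ge0.
Qed.

Lemma hmetric_cc s t : test_section s -> test_section t ->
  cc_fun (fun x => complex.Re (hmetric (s x) (t x)) : R^o) /\
  cc_fun (fun x => complex.Im (hmetric (s x) (t x)) : R^o).
Proof.
move=> [ss cs] [st ct]; have [hL hJ _ hs] := @hmetricP _ _ _ _ E.
have [s1 s2] := hs s t ss st.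
have h0 x (v : E x) : hmetric (0 : E x) v = 0.
  by have := hL x (-1) 0 0 v; rewrite scaler0 addr0 mulN1r addNr.
have supp (q : C -> R) : q 0 = 0 ->
    compact (closure [set x | q (hmetric (s x) (t x)) != 0]).
  move=> q0; apply: (subclosed_compact _ cs); first exact: closed_closure.
  by apply: closure_subset => x /=; apply: contraNneq => ->; rewrite h0 q0.
split; split.
- exact: smoothM_continuous s1.
- exact: (supp (@complex.Re R) erefl).
- exact: smoothM_continuous s2.
- exact: (supp (@complex.Im R) erefl).
Qed.

Definition test_pairing phi psi : C := l2_pairing g (sval phi) (sval psi).

Lemma l2_pairing_split s t : l2_pairing g s t =
  Complex (vol g (fun x => complex.Re (hmetric (s x) (t x))))
          (vol g (fun x => complex.Im (hmetric (s x) (t x)))).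
Proof. by []. Qed.

Lemma test_pairingL (a : C) phi psi chi :
  test_pairing (test_lin a phi psi) chi = a * test_pairing phi chi + test_pairing psi chi.
Proof.
rewrite /test_pairing !l2_pairing_split.
have [c1 c2] := hmetric_cc (svalP phi) (svalP chi).
have [d1 d2] := hmetric_cc (svalP psi) (svalP chi).
have E1 x : hmetric (sval (test_lin a phi psi) x) (sval chi x) =
    a * hmetric (sval phi x) (sval chi x) + hmetric (sval psi x) (sval chi x).
  exact: hmetricL.
set f1 := fun x => complex.Re (hmetric (sval phi x) (sval chi x)) in c1 *.
set f2 := fun x => complex.Im (hmetric (sval phi x) (sval chi x)) in c2 *.
set k1 := fun x => complex.Re (hmetric (sval psi x) (sval chi x)) in d1 *.
set k2 := fun x => complex.Im (hmetric (sval psi x) (sval chi x)) in d2 *.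
have -> : (fun x => complex.Re (hmetric (sval (test_lin a phi psi) x) (sval chi x))) =
    (fun x => complex.Re a * f1 x + (- complex.Im a * f2 x + k1 x)).
  apply/funext => x; rewrite E1 /f1 /f2 /k1.
  by case: (a) (hmetric (sval phi x) _) (hmetric (sval psi x) _) => ? ? [? ?] [? ?] /=; ring.
have -> : (fun x => complex.Im (hmetric (sval (test_lin a phi psi) x) (sval chi x))) =
    (fun x => complex.Re a * f2 x + (complex.Im a * f1 x + k2 x)).
  apply/funext => x; rewrite E1 /f1 /f2 /k2.
  by case: (a) (hmetric (sval phi x) _) (hmetric (sval psi x) _) => ? ? [? ?] [? ?] /=; ring.
rewrite (volL g (complex.Re a) c1 (cc_funL (- complex.Im a) c2 d1)).
rewrite (volL g (- complex.Im a) c2 d1).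
rewrite (volL g (complex.Re a) c2 (cc_funL (complex.Im a) c1 d2)).
rewrite (volL g (complex.Im a) c1 d2).
case: a {E1} => p q.
by apply/eqP; rewrite eq_complex /=; apply/andP; split; apply/eqP; ring.
Qed.

Lemma test_pairingJ phi psi : test_pairing psi phi = (test_pairing phi psi)^*%C.
Proof.
rewrite /test_pairing !l2_pairing_split /=.
have [c1 c2] := hmetric_cc (svalP phi) (svalP psi).
congr Complex.
  by congr (vol g _); apply/funext => x; rewrite hmetricJ; case: (hmetric _ _).
rewrite -mulN1r -(volZ g (-1) c2).
congr (vol g _); apply/funext => x; rewrite hmetricJ.
by case: (hmetric _ _) => ? ? /=; rewrite mulN1r.
Qed.

Lemma hmetric_real x (u : E x) : hmetric u u = (complex.Re (hmetric u u))%:C%C.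
Proof.
have := hmetric_ge0 u; case: (hmetric u u) => a b.
by rewrite lecE => /andP[/= /eqP ->].
Qed.

Lemma test_pairing_ge0 phi : 0 <= test_pairing phi phi.
Proof.
rewrite /test_pairing !l2_pairing_split.
have -> : (fun x => complex.Im (hmetric (sval phi x) (sval phi x))) = (fun=> 0).
  by apply/funext => x; rewrite hmetric_real.
rewrite vol0 ler0c; apply: vol_ge0.
  by have [] := hmetric_cc (svalP phi) (svalP phi).
by move=> x; have := hmetric_ge0 (sval phi x); rewrite hmetric_real ler0c.
Qed.

(** The square norm of a test section is continuous with compact support, so
    that its upper integral is its integral. *)
Lemma test_norm0 phi : test_norm g 0 (sval phi) = (prenorm test_pairing phi)%:E.
Proof.
have U0 : U (sqnorm_nabla g 0 (sval phi)) = (complex.Re (test_pairing phi phi))%:E.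
  have -> : sqnorm_nabla g 0 (sval phi) = sqnorm (sval phi).
    apply/funext => x; rewrite /sqnorm_nabla /=.
    by rewrite (big_pred1 [tuple]) // => m; apply/esym/eqP; exact: tuple0.
  by rewrite upper_integral_cc//; have [] := hmetric_cc (svalP phi) (svalP phi).
rewrite /test_norm big_nat1 U0 poweR_EFin powR12_sqrt//.
by have := test_pairing_ge0 phi; rewrite (pair_diag test_pairing_ge0) ler0c.
Qed.

End TestNorm.

(** * Sobolev norms of distributions *)

Section SobolevNorms.
Context {R : realType} {n : nat} {M : manifold R n} (g : riemannian M).
Context {r : nat} (E : hermitian_bundle M r).
Local Notation C := R[i].
Implicit Types (u v : dsection E) (phi psi : nat -> test E) (L : set M).

Lemma test_smooth (x : test E) : smooth_section (sval x).
Proof. by case: (svalP x). Qed.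

Lemma approximates_cauchyL k (a : C) u v phi psi :
  approximates g k phi u -> approximates g k psi v ->
  forall e : R, 0 < e -> exists N, forall i j, (N <= i)%N -> (N <= j)%N ->
    (test_norm g k (sval (test_lin a (phi i) (psi i)) -
                    sval (test_lin a (phi j) (psi j)))%R < e%:E)%E.
Proof.
move=> [C1 _] [C2 _] e e0; have k0 : 0 < nc a + 1 by rewrite ltr_wpDl// normc_ge0.
have d0 : 0 < e / 2 / (nc a + 1) by rewrite !divr_gt0.
have [N1 H1] := C1 _ d0; have [N2 H2] := C2 (e / 2) ltac:(by rewrite divr_gt0).
exists (maxn N1 N2) => i j; rewrite !geq_max => /andP[i1 i2] /andP[j1 j2].
have -> : sval (test_lin a (phi i) (psi i)) - sval (test_lin a (phi j) (psi j)) =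
    a *: (sval (phi i) - sval (phi j)) + (sval (psi i) - sval (psi j)).
  by rewrite /= scalerBr opprD addrACA.
have sB (x y : test E) : smooth_section (sval x - sval y).
  by apply: smooth_sectionB; exact: test_smooth.
have B1 := ltW (H1 i j i1 j1); have B2 := ltW (H2 i j i2 j2).
have e2 : 0 <= e / 2 by rewrite ltW// divr_gt0.
apply: (le_lt_trans (test_normL a (sB _ _) (sB _ _) (ltW d0) e2 B1 B2)).
rewrite lte_fin [ltRHS]splitr ltrD2r mulrA ltr_pdivrMr// mulrC ltr_pM2l ?ltrDl//.
by rewrite divr_gt0.
Qed.

Lemma approximatesL k (a : C) u v phi psi :
  approximates g k phi u -> approximates g k psi v ->
  approximates g k (fun i => test_lin a (phi i) (psi i)) (a *: u + v).
Proof.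
move=> Au Av; split; first exact: approximates_cauchyL Au Av.
move=> x; have [_ W1] := Au; have [_ W2] := Av.
have /tends_toP c1 := W1 x; have /tends_toP c2 := W2 x.
apply/tends_toP => e e0; have := tends_toL a c1 c2 e0.
apply: filterS => i.
have -> : l2_pairing g (sval (test_lin a (phi i) (psi i))) (sval x) =
    a * test_pairing g (phi i) x + test_pairing g (psi i) x := test_pairingL g a _ _ _.
exact.
Qed.

(** [completion_norm] is an infimum over sequences along which the norms
    converge; this makes linear combinations of such sequences admissible. *)
Lemma test_norm_cvg k (chi : nat -> test E) (b : R) :
  (forall e : R, 0 < e -> exists N, forall i j, (N <= i)%N -> (N <= j)%N ->
     (test_norm g k (sval (chi i) - sval (chi j))%R < e%:E)%E) ->
  (\forall i \near \oo, (test_norm g k (sval (chi i)) <= b%:E)%E) ->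
  exists l : R, test_norm g k (sval (chi i)) @[i --> \oo] --> l%:E.
Proof.
move=> chiC [N0 _ chib].
pose y i := fine (test_norm g k (sval (chi i))).
have fin i : (N0 <= i)%N -> test_norm g k (sval (chi i)) = (y i)%:E /\ 0 <= y i.
  move=> Ni; have := chib i Ni; have := test_norm_ge0 g k (sval (chi i)); rewrite /y.
  by case: (test_norm _ _ _) => [z| |] //=; rewrite ?lee_fin ?leye_eq.
have yB e : 0 < e -> exists N, forall i j, (N <= i)%N -> (N <= j)%N -> y i <= e + y j.
  move=> e0; have [N NP] := chiC e e0; exists (maxn N0 N) => i j.
  rewrite !geq_max => /andP[i1 i2] /andP[j1 j2].
  have [yi _] := fin i i1; have [yj yj0] := fin j j1.
  have B1 := ltW (NP i j i2 j2).
  have B2 : (test_norm g k (sval (chi j)) <= (y j)%:E)%E by rewrite yj.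
  have sB : smooth_section (sval (chi i) - sval (chi j)).
    by apply: smooth_sectionB; exact: test_smooth.
  have := test_normL 1 sB (test_smooth (chi j)) (ltW e0) yj0 B1 B2.
  by rewrite scale1r subrK yi lee_fin Normc.normc1 mul1r.
have : cvg (y i @[i --> \oo]).
  apply/cauchy_cvgP/cauchy_exP => e e0; have [N NP] := yB (e / 2) ltac:(by rewrite divr_gt0).
  exists (y N); exists N => // i /= Ni; change (`|y N - y i| < e).
  have := NP i N Ni (leqnn N); have := NP N i (leqnn N) Ni.
  by move=> H1 H2; rewrite ltr_norml; apply/andP; split; move: H1 H2 e0; clear; lra.
move=> /cvg_ex[l yl]; exists l; apply/fine_cvgP; split; last exact: yl.
by exists N0 => // i /fin[-> _].
Qed.

Lemma test_norm_cvg_le k (chi : nat -> test E) (l b : R) :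
  test_norm g k (sval (chi i)) @[i --> \oo] --> l%:E ->
  (\forall i \near \oo, (test_norm g k (sval (chi i)) <= b%:E)%E) -> l <= b.
Proof.
move=> cl cb; rewrite -lee_fin; apply: (closed_cvg (fun x => (x <= b%:E)%E)) cl => //.
exact: closed_ereal_ge_ereal.
Qed.

Lemma completion_norm_ge0 k u : (0 <= completion_norm g k u)%E.
Proof.
apply/ereal_infP => l [phi _ cl].
apply: (closed_cvg (fun x => (0 <= x)%E)) cl; first exact: closed_ereal_le_ereal.
by apply: nearW => i; exact: test_norm_ge0.
Qed.

Lemma completion_normL k (a : C) u v (x y : R) :
  completion_norm g k u = x%:E -> completion_norm g k v = y%:E ->
  (completion_norm g k (a *: u + v)%R <= (nc a * x + y)%:E)%E.
Proof.
have adh (w : dsection E) z : completion_norm g k w = z%:E -> forall e : R, 0 < e ->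
    exists2 phi, approximates g k phi w & \forall i \near \oo,
      (test_norm g k (sval (phi i)) <= (z + e)%:E)%E.
  move=> wz e e0; have : (completion_norm g k w < (z + e)%:E)%E.
    by rewrite wz lte_fin ltrDl.
  move=> /ereal_inf_lt[l [phi Aphi cl] lz]; exists phi => //.
  have : \forall t \near l, (t < (z + e)%:E)%E.
    by apply: open_nbhs_nbhs; split=> //; exact: open_ereal_lt_ereal.
  by move=> /cl[N _ NP]; exists N => // i Ni; apply/ltW/NP.
move=> ux vy; apply/lee_addgt0Pr => e e0.
have k0 : 0 < nc a + 1 by rewrite ltr_wpDl// normc_ge0.
pose d := e / (nc a + 1); have d0 : 0 < d by rewrite divr_gt0.
have [phi Aphi bphi] := adh _ _ ux _ d0; have [psi Apsi bpsi] := adh _ _ vy _ d0.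
have x0 : 0 <= x by rewrite -lee_fin -ux; exact: completion_norm_ge0.
have y0 : 0 <= y by rewrite -lee_fin -vy; exact: completion_norm_ge0.
have bchi : \forall i \near \oo,
    (test_norm g k (sval (test_lin a (phi i) (psi i))) <= (nc a * (x + d) + (y + d))%:E)%E.
  near=> i; apply: test_normL; try exact: test_smooth.
  - by rewrite addr_ge0// ltW.
  - by rewrite addr_ge0// ltW.
  - by near: i.
  - by near: i.
have [l cl] := test_norm_cvg (approximates_cauchyL a Aphi Apsi) bchi.
apply: (@le_trans _ _ l%:E).
  apply: ereal_inf_lbound; exists (fun i => test_lin a (phi i) (psi i)).
    exact: approximatesL Aphi Apsi.
  exact: cl.
rewrite -EFinD lee_fin; apply: le_trans (test_norm_cvg_le cl bchi) _.
have -> : nc a * (x + d) + (y + d) = nc a * x + y + (nc a + 1) * d by ring.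
by rewrite /d [(nc a + 1) * _]mulrC divfK ?gt_eqF.
Unshelve. all: by end_near. Qed.

Lemma dual_norm_ge0 k u : (0 <= dual_norm g k u)%E.
Proof. by apply/ereal_infP => _ [b [b0 _] <-]; rewrite lee_fin. Qed.

Lemma dual_normL k (a : C) u v (x y : R) :
  dual_norm g k u = x%:E -> dual_norm g k v = y%:E ->
  (dual_norm g k (a *: u + v)%R <= (nc a * x + y)%:E)%E.
Proof.
have adh (w : dsection E) z : dual_norm g k w = z%:E -> forall e : R, 0 < e ->
    exists b : R, [/\ 0 <= b, b <= z + e & forall phi : test E,
      ((nc (w phi))%:E <= b%:E * test_norm g k (sval phi))%E].
  move=> wz e e0; have : (dual_norm g k w < (z + e)%:E)%E.
    by rewrite wz lte_fin ltrDl.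
  by move=> /ereal_inf_lt[_ [b [b0 wb] <-]]; rewrite lte_fin => bz; exists b; split; [exact: b0|exact: ltW|exact: wb].
move=> ux vy; apply/lee_addgt0Pr => e e0.
have k0 : 0 < nc a + 1 by rewrite ltr_wpDl// normc_ge0.
pose d := e / (nc a + 1); have d0 : 0 < d by rewrite divr_gt0.
have [b [b0 bx ub]] := adh _ _ ux _ d0; have [c [c0 cy vc]] := adh _ _ vy _ d0.
have a0 : 0 <= nc a := normc_ge0 a.
apply: (@le_trans _ _ (nc a * b + c)%:E).
  apply: ereal_inf_lbound; exists (nc a * b + c) => //.
  split; first by rewrite addr_ge0// mulr_ge0.
  move=> phi; have -> : (a *: u + v) phi = a * u phi + v phi by [].
  apply: (@le_trans _ _ (nc a * nc (u phi) + nc (v phi))%:E).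
    by rewrite lee_fin -Normc.normcM normcD.
  rewrite !EFinD !EFinM ge0_muleDl ?lee_fin ?mulr_ge0//.
  by rewrite leeD ?vc// -muleA lee_wpmul2l ?lee_fin.
rewrite -EFinD lee_fin.
apply: (@le_trans _ _ (nc a * (x + d) + (y + d))); first by rewrite lerD// ler_wpM2l.
have -> : nc a * (x + d) + (y + d) = nc a * x + y + (nc a + 1) * d by ring.
by rewrite /d [(nc a + 1) * _]mulrC divfK ?gt_eqF.
Qed.

Lemma sobolev_norm_ge0 (k : int) u : (0 <= sobolev_norm g k u)%E.
Proof. by case: k => k; [exact: completion_norm_ge0|exact: dual_norm_ge0]. Qed.

Lemma conj_linearL (a : C) u v : conj_linear u -> conj_linear v -> conj_linear (a *: u + v).
Proof.
move=> cu cv b x y z H; have lin w : (a *: u + v) w = a * u w + v w by [].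
by rewrite !lin (cu _ _ _ _ H) (cv _ _ _ _ H); ring.
Qed.

Definition sobnorm (k : int) u : R := fine (sobolev_norm g k u).

Lemma sobnorm_ge0 k u : 0 <= sobnorm k u.
Proof. by rewrite fine_ge0// sobolev_norm_ge0. Qed.

Lemma sobnormE k u : sobolev g k u -> sobolev_norm g k u = (sobnorm k u)%:E.
Proof.
move=> [_ fu]; rewrite /sobnorm fineK// ge0_fin_numE//; exact: sobolev_norm_ge0.
Qed.

Lemma sobolev_normL k (a : C) u v : sobolev g k u -> sobolev g k v ->
  (sobolev_norm g k (a *: u + v)%R <= (nc a * sobnorm k u + sobnorm k v)%:E)%E.
Proof.
move=> su sv; have := sobnormE su; have := sobnormE sv.
by case: k {su sv} => k Ev Eu; [exact: completion_normL Eu Ev|exact: dual_normL Eu Ev].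
Qed.

Lemma sobolevL k (a : C) u v : sobolev g k u -> sobolev g k v -> sobolev g k (a *: u + v).
Proof.
move=> su sv; split; first by apply: conj_linearL; [exact: su.1|exact: sv.1].
exact: le_lt_trans (sobolev_normL a su sv) (ltry _).
Qed.

Lemma sobnormL k (a : C) u v : sobolev g k u -> sobolev g k v ->
  sobnorm k (a *: u + v) <= nc a * sobnorm k u + sobnorm k v.
Proof.
by move=> su sv; rewrite -lee_fin -sobnormE ?sobolev_normL//; exact: sobolevL.
Qed.

Lemma test_norm_zero k : test_norm g k (0 : section E) = 0%E.
Proof.
apply/eqP; rewrite eq_le test_norm_ge0 andbT.
rewrite (test_norm_le g k (0 : section E) (lexx 0)).
rewrite expr0n /sqtest_norm big1// => i _.
have -> : sqnorm_nabla g i (0 : section E) = (fun=> 0).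
  by apply/funext => x; exact: sqnorm_nabla0.
by rewrite upper_integral_cc ?vol0//; exact: cc_fun0.
Qed.

Lemma sobolev_norm_zero k : sobolev_norm g k (0 : dsection E) = 0%E.
Proof.
apply/eqP; rewrite eq_le sobolev_norm_ge0 andbT.
case: k => k; last first.
  apply: ereal_inf_lbound.
  exists 0 => //; split=> // phi.
  have -> : (0 : dsection E) phi = 0 by [].
  by rewrite Normc.normc0 mul0e.
apply: ereal_inf_lbound; exists (fun=> test0 E).
  split=> [e e0|x].
    by exists 0%N => i j _ _; rewrite subrr test_norm_zero lte_fin.
  have -> : l2_pairing g (sval (test0 E)) (sval x) = 0.
    have := test_pairingL g (-1) (test0 E) (test0 E) x.
    have -> : test_pairing g (test_lin (-1) (test0 E) (test0 E)) x = test_pairing g (test0 E) x.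
      by rewrite /test_pairing /= scaler0 addr0.
    by rewrite mulN1r addNr.
  by apply/tends_toP; exact: tends_to_cst.
by rewrite test_norm_zero; exact: cvg_cst.
Qed.

Lemma sobolev0 k : sobolev g k (0 : dsection E).
Proof.
split; last by rewrite sobolev_norm_zero.
by move=> a x y z _; rewrite /= mulr0 addr0.
Qed.

Lemma sobnorm_zero k : sobnorm k 0 = 0.
Proof. by rewrite /sobnorm sobolev_norm_zero. Qed.

End SobolevNorms.

(** * Metric neighbourhoods *)

Section Distance.
Context {R : realType} {n : nat} {M : manifold R n} (g : riemannian M).
Implicit Types (x y z : M) (L : set M).

Lemma path_joins_cat x y z p q : path_joins x p y -> path_joins y q z ->
  path_joins x (p ++ q) z.
Proof.
elim: p x => [|c p IH] x /=; first by move=> ->.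
by move=> [sc cx pq] qz; split=> //; exact: IH pq qz.
Qed.

Lemma rdist_triangle x y z (s t : R) : (rdist g x y < s%:E)%E -> (rdist g y z < t%:E)%E ->
  (rdist g x z < (s + t)%:E)%E.
Proof.
move=> /ereal_inf_lt[_ [p pxy ->] ps] /ereal_inf_lt[_ [q qyz ->] qt].
apply: (@le_lt_trans _ _ (\sum_(c <- p ++ q) curve_length g c)%E).
  by apply: ereal_inf_lbound; exists (p ++ q) => //; exact: path_joins_cat pxy qyz.
by rewrite big_cat EFinD; exact: lteD.
Qed.

Lemma nbhd_of_nbhd_of L (s t : R) : nbhd_of g (nbhd_of g L s) t `<=` nbhd_of g L (s + t).
Proof. by move=> x [y [z Lz zy] yx]; exists z => //; exact: rdist_triangle zy yx. Qed.

End Distance.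

(** * Decay of operators away from the support *)

Section LocalNorms.
Context {R : realType} {n : nat} {M : manifold R n} (g : riemannian M).
Context {r : nat} (E : hermitian_bundle M r).
Local Notation C := R[i].
Implicit Types (u v w : dsection E) (L : set M) (k l m : int).
Implicit Types (A B F G : dsection E -> dsection E).
Local Notation S k := (sobolev g k).
Local Notation sobnorm := (sobnorm g).

Lemma sobolevB k u v : S k u -> S k v -> S k (u - v).
Proof. by move=> Su Sv; rewrite addrC -scaleN1r; exact: sobolevL. Qed.

Lemma sobnormB k u v : S k u -> S k v -> sobnorm k (u - v) <= sobnorm k u + sobnorm k v.
Proof.
move=> Su Sv; have := sobnormL (-1) Sv Su.
rewrite scaleN1r (addrC (- v)) normcN Normc.normc1 mul1r.
by rewrite (addrC (sobnorm k v)).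
Qed.

Lemma local_norm_mono k u L L' : L `<=` L' -> (local_norm g k u L <= local_norm g k u L')%E.
Proof.
move=> LL; apply: ereal_inf_le_tmp => _ [u' [Su' [W [oW LW eW]]] <-].
by exists u' => //; split=> //; exists W; split=> //; exact: subset_trans LL LW.
Qed.

Lemma local_norm_le_sobnorm k u L : S k u -> (local_norm g k u L <= (sobnorm k u)%:E)%E.
Proof.
move=> Su; rewrite -sobnormE//; apply: ereal_inf_lbound; exists u => //.
by split=> //; exists setT; split=> //; exact: openT.
Qed.

Lemma local_norm_adherent k u L (x e : R) : (local_norm g k u L <= x%:E)%E -> 0 < e ->
  exists u', [/\ S k u', sobnorm k u' <= x + e &
    exists W, [/\ open W, L `<=` W & equal_on W u' u]].
Proof.
move=> ux e0; have : (local_norm g k u L < (x + e)%:E)%E.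
  by apply: le_lt_trans ux _; rewrite lte_fin ltrDl.
move=> /ereal_inf_lt[_ [u' [Su' OP] <-]] u'x; exists u'; split=> //.
by rewrite -lee_fin -sobnormE// ltW.
Qed.

Lemma local_normL k (a : C) u v L (x y : R) :
  (local_norm g k u L <= x%:E)%E -> (local_norm g k v L <= y%:E)%E ->
  (local_norm g k (a *: u + v)%R L <= (nc a * x + y)%:E)%E.
Proof.
move=> ux vy; apply/lee_addgt0Pr => e e0.
have k0 : 0 < nc a + 1 by rewrite ltr_wpDl// normc_ge0.
pose d := e / (nc a + 1); have d0 : 0 < d by rewrite divr_gt0.
have [u' [Su' u'x [W [oW LW eW]]]] := local_norm_adherent ux d0.
have [v' [Sv' v'y [P [oP LP eP]]]] := local_norm_adherent vy d0.
apply: (@le_trans _ _ (sobnorm k (a *: u' + v'))%:E).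
  rewrite -sobnormE; last exact: sobolevL.
  apply: ereal_inf_lbound; exists (a *: u' + v') => //; split; first exact: sobolevL.
  exists (W `&` P); split; [exact: openI|by move=> z Lz; split; [exact: LW|exact: LP]|].
  move=> phi sphi.
  have -> : (a *: u' + v') phi = a * u' phi + v' phi by [].
  have -> : (a *: u + v) phi = a * u phi + v phi by [].
  by rewrite eW ?eP// => z /sphi[].
rewrite -EFinD lee_fin; apply: le_trans (sobnormL a Su' Sv') _.
have -> : e = (nc a + 1) * d by rewrite /d mulrC divfK// gt_eqF.
apply: (@le_trans _ _ (nc a * (x + d) + (y + d))); last by rewrite le_eqVlt; apply/orP; left; apply/eqP; ring.
by rewrite lerD// ler_wpM2l// normc_ge0.
Qed.

Definition decays_at k l A (e rho : R) : Prop := forall L u, S k u -> supp u `<=` L ->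
  (local_norm g l (A u) (~` nbhd_of g L rho) <= (e * sobnorm k u)%:E)%E.

(** Quasilocality without a rate function; for bounded operators the two are
    equivalent ([quasilocal_decays], [decays_quasilocal]). *)
Definition decays k l A : Prop := forall e : R, 0 < e ->
  exists2 rho0 : R, 0 < rho0 & forall rho, rho0 <= rho -> decays_at k l A e rho.

Lemma bounded_operatorP k l A : bounded_operator g k l A ->
  exists2 b : R, 0 <= b & forall u, S k u -> sobnorm l (A u) <= b * sobnorm k u.
Proof.
move=> [AS _ [b b0 Ab]]; exists b => // u Su.
by have := Ab u Su; rewrite (sobnormE Su) (sobnormE (AS _ Su)) -EFinM lee_fin.
Qed.

Lemma bounded_operator_intro k l A (b : R) : (forall u, S k u -> S l (A u)) ->
  (forall (a : C) u v, S k u -> S k v -> A (a *: u + v) = a *: A u + A v) -> 0 <= b ->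
  (forall u, S k u -> sobnorm l (A u) <= b * sobnorm k u) -> bounded_operator g k l A.
Proof.
move=> AS AL b0 Ab; split=> //; exists b => // u Su.
by rewrite (sobnormE Su) (sobnormE (AS _ Su)) -EFinM lee_fin Ab.
Qed.

Lemma quasilocal_decays k l A : quasilocal g k l A -> decays k l A.
Proof.
move=> [mu [mu0 mulim muP]] e e0.
have /cvgrPdist_lt/(_ e e0)[b [_ bP]] := mulim.
exists (`|b| + 1); first by rewrite ltr_wpDl.
move=> rho rho0 L u Su sL.
have r0 : 0 < rho by apply: lt_le_trans rho0; rewrite ltr_wpDl.
have := muP rho L u r0 Su sL; rewrite (sobnormE Su) -EFinM => /le_trans; apply.
rewrite lee_fin ler_wpM2r ?sobnorm_ge0//.
have : b < rho by apply: lt_le_trans rho0; rewrite ltr_pwDr// ler_norm.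
move=> /bP; rewrite /= sub0r normrN => /ltW; exact/le_trans/ler_norm.
Qed.

(** The rate at [rho] is the infimum of the admissible constants, which exist
    because the operator is bounded. *)
Lemma decays_quasilocal k l A : bounded_operator g k l A -> decays k l A ->
  quasilocal g k l A.
Proof.
move=> bA dA; have [AS _ _] := bA; have [b b0 Ab] := bounded_operatorP bA.
pose D rho : set R := [set e : R | 0 <= e /\ decays_at k l A e rho].
have Db rho : D rho b.
  split=> // L u Su _; apply: le_trans (local_norm_le_sobnorm _ (AS _ Su)) _.
  by rewrite lee_fin Ab.
have lbD rho : has_lbound (D rho) by exists 0 => e [].
have infD rho : has_inf (D rho) by split; [exists b|].
have mu0 rho : 0 <= inf (D rho) by apply: lb_le_inf; [exists b|move=> e []].
exists (fun rho => inf (D rho)); split=> //.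
- apply/cvgrPdist_le => e e0; have [rho0 _ H] := dA e e0.
  exists rho0; split; first exact: num_real.
  move=> rho /ltW rr; rewrite sub0r normrN ger0_norm//.
  by apply: ge_inf => //; split; [exact: ltW|exact: H].
- move=> rho L u _ Su sL; rewrite (sobnormE Su) -EFinM; apply/lee_addgt0Pr => e e0.
  have k0 : 0 < sobnorm k u + 1 by rewrite ltr_wpDl// sobnorm_ge0.
  have d0 : 0 < e / (sobnorm k u + 1) by rewrite divr_gt0.
  have [d [_ dd] de] := inf_adherent d0 (infD rho).
  apply: le_trans (dd L u Su sL) _; rewrite -EFinD lee_fin.
  apply: (@le_trans _ _ ((inf (D rho) + e / (sobnorm k u + 1)) * sobnorm k u)).
    by rewrite ler_wpM2r ?sobnorm_ge0// ltW.
  rewrite mulrDl lerD2l -mulrA ger_pMr// mulrC ler_pdivrMr// mul1r.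
  by rewrite lerDl.
Qed.

Lemma bounded_operator_comp k m l A B : bounded_operator g k m A ->
  bounded_operator g m l B -> bounded_operator g k l (B \o A).
Proof.
move=> bA bB; have [AS AL _] := bA; have [BS BL _] := bB.
have [b b0 Ab] := bounded_operatorP bA; have [c c0 Bc] := bounded_operatorP bB.
apply: (@bounded_operator_intro _ _ _ (c * b)).
- by move=> u Su; apply/BS/AS.
- by move=> a u v Su Sv; rewrite /= AL// BL//; exact: AS.
- exact: mulr_ge0.
- move=> u Su; apply: le_trans (Bc _ (AS _ Su)) _.
  by rewrite -mulrA ler_wpM2l// Ab.
Qed.

Lemma bounded_operatorL k l (a : C) A B : bounded_operator g k l A ->
  bounded_operator g k l B -> bounded_operator g k l (a *: A + B).
Proof.
move=> bA bB; have [AS AL _] := bA; have [BS BL _] := bB.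
have [b b0 Ab] := bounded_operatorP bA; have [c c0 Bc] := bounded_operatorP bB.
have ABE u : (a *: A + B) u = a *: A u + B u by [].
apply: (@bounded_operator_intro _ _ _ (nc a * b + c)).
- by move=> u Su; rewrite ABE; apply: sobolevL; [exact: AS|exact: BS].
- move=> d u v Su Sv; rewrite !ABE (AL _ _ _ Su Sv) (BL _ _ _ Su Sv).
  by rewrite !scalerDr !scalerA [d * a]mulrC -!addrA; congr (_ + _); rewrite addrCA.
- by rewrite addr_ge0// mulr_ge0// normc_ge0.
- move=> u Su; rewrite ABE; apply: le_trans (sobnormL a (AS _ Su) (BS _ Su)) _.
  by rewrite mulrDl -mulrA lerD ?Bc// ler_wpM2l ?normc_ge0// Ab.
Qed.

Lemma supp_sub u v L W : open W -> ~` L `<=` W -> equal_on W v u -> supp (u - v) `<=` L.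
Proof.
move=> oW LW eW x sx; apply: contrapT => nLx.
apply: (sx W oW (LW _ nLx)) => phi sphi.
have -> : (u - v) phi = u phi - v phi by [].
by rewrite eW// subrr.
Qed.

(** Let [u] be supported in [L] and [h = rho / 2]. The decay of [A] provides a
    small [v] that agrees with [A u] away from the [h]-neighbourhood of [L]. So
    [B v] is small, and [A u - v] is supported in this neighbourhood, whence
    [B (A u - v)] is small at distance [h] from it. *)
Lemma decays_comp k m l A B : bounded_operator g k m A -> bounded_operator g m l B ->
  decays k m A -> decays m l B -> decays k l (B \o A).
Proof.
move=> bA bB dA dB e e0; have [AS _ _] := bA; have [BS BL _] := bB.
have [b b0 Ab] := bounded_operatorP bA; have [c c0 Bc] := bounded_operatorP bB.
have bc0 : 0 < b + c + 1 by rewrite ltr_wpDl// addr_ge0.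
pose d := Num.min 1 (e / (b + c + 1)).
have d0 : 0 < d by rewrite lt_min ltr01 divr_gt0.
have d1 : d <= 1 by rewrite ge_min lexx.
have de : d * (b + c + 1) <= e by rewrite -ler_pdivlMr// ge_min lexx orbT.
clearbody d.
have [rA rA0 HA] := dA _ d0; have [rB rB0 HB] := dB _ d0.
(* so that [rho / 2] is at least [rA] and at least [rB] *)
exists (rA + rA + (rB + rB)); first by rewrite !addr_gt0.
move=> rho rr L u Su sL.
pose h := rho / 2.
have hA : rA <= h by rewrite /h ler_pdivlMr//; move: rr rB0; lra.
have hB : rB <= h by rewrite /h ler_pdivlMr//; move: rr rA0; lra.
have hh : h + h = rho by rewrite /h -splitr.
set x := sobnorm k u; have x0 : 0 <= x := sobnorm_ge0 g k u.
apply/lee_addgt0Pr => f f0.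
pose q := f / (c + d + 1).
have cd0 : 0 < c + d + 1 by rewrite ltr_wpDl// addr_ge0// ltW.
have q0 : 0 < q by rewrite divr_gt0.
have [v [Sv vx [W [oW LW eW]]]] := local_norm_adherent (HA h hA L u Su sL) q0.
rewrite -/x in vx.
have SAu := AS _ Su.
have Sw := sobolevB SAu Sv.
have sw : supp (A u - v) `<=` nbhd_of g L h by exact: supp_sub oW LW eW.
have wx : sobnorm m (A u - v) <= b * x + (d * x + q).
  by apply: le_trans (sobnormB SAu Sv) _; rewrite lerD// Ab.
have L1 := HB h hB (nbhd_of g L h) _ Sw sw.
have L2 : (local_norm g l (B (A u - v)%R) (~` nbhd_of g L rho) <=
    (d * sobnorm m (A u - v)%R)%:E)%E.
  apply: le_trans L1; apply: local_norm_mono; apply: subsetC.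
  by rewrite -hh; exact: nbhd_of_nbhd_of.
have L3 := local_norm_le_sobnorm (~` nbhd_of g L rho) (BS _ Sv).
have BE : (B \o A) u = 1 *: B v + B (A u - v).
  by rewrite /= -(BL 1 v _ Sv Sw) scale1r addrC subrK.
rewrite BE; apply: le_trans (local_normL 1 L3 L2) _.
rewrite -EFinD lee_fin Normc.normc1 mul1r.
have H1 := Bc _ Sv.
have H2 : c * sobnorm m v <= c * (d * x + q) by rewrite ler_wpM2l.
have H3 : d * sobnorm m (A u - v) <= d * (b * x + (d * x + q)) by rewrite ler_wpM2l// ltW.
apply: le_trans (lerD (le_trans H1 H2) H3) _.
have -> : c * (d * x + q) + d * (b * x + (d * x + q)) =
    d * (b + c + d) * x + (c + d) * q by ring.
apply: lerD.
  rewrite ler_wpM2r//; apply: le_trans de; rewrite ler_pM2l//.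
  by rewrite lerD2l.
apply: (@le_trans _ _ ((c + d + 1) * q)); first by rewrite ler_pM2r// lerDl.
by rewrite /q mulrC divfK// gt_eqF.
Qed.

(** Local norms are bounded by global ones, hence [F u - G u] is small
    everywhere. *)
Lemma decays_limit k l F : (forall u, S k u -> S l (F u)) ->
  (forall e : R, 0 < e -> exists G, [/\ forall u, S k u -> S l (G u), decays k l G &
     forall u, S k u -> sobnorm l (F u - G u) <= e * sobnorm k u]) ->
  decays k l F.
Proof.
move=> FS FG e e0; have e2 : 0 < e / 2 by rewrite divr_gt0.
have [G [GS dG FGe]] := FG _ e2.
have [rho0 r0 H] := dG _ e2; exists rho0 => // rho rr L u Su sL.
have L1 := H rho rr L u Su sL.
have L2 := local_norm_le_sobnorm (~` nbhd_of g L rho) (sobolevB (FS _ Su) (GS _ Su)).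
have -> : F u = 1 *: (F u - G u) + G u by rewrite scale1r subrK.
apply: le_trans (local_normL 1 L2 L1) _.
rewrite lee_fin Normc.normc1 mul1r [X in _ <= X * _]splitr mulrDl lerD2r.
exact: FGe.
Qed.

Lemma decaysL k l (a : C) A B : decays k l A -> decays k l B -> decays k l (a *: A + B).
Proof.
move=> dA dB e e0; have k0 : 0 < nc a + 1 by rewrite ltr_wpDl// normc_ge0.
have d0 : 0 < e / (nc a + 1) by rewrite divr_gt0.
have [rA rA0 HA] := dA _ d0; have [rB rB0 HB] := dB _ d0.
exists (rA + rB); first exact: addr_gt0.
move=> rho rr L u Su sL.
have hA : rA <= rho by move: rr rB0; lra.
have hB : rB <= rho by move: rr rA0; lra.
apply: le_trans (local_normL a (HA rho hA L u Su sL) (HB rho hB L u Su sL)) _.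
rewrite lee_fin le_eqVlt; apply/orP; left; apply/eqP.
by field; rewrite gt_eqF.
Qed.

End LocalNorms.

(** * Quasilocal smoothing operators *)

Section Smoothing.
Context {R : realType} {n : nat} {M : manifold R n} (g : riemannian M).
Context {r : nat} (E : hermitian_bundle M r).
Local Notation C := R[i].
Implicit Types (u v : dsection E) (a b c : dsection E -> dsection E).
Local Notation S0 := (@sobolev _ _ _ g _ E 0).
Local Notation sobnorm := (sobnorm g).

Lemma quasilocal_smoothing_intro a :
  (forall k l : nat, bounded_operator g (- k%:Z) l a /\ decays g (- k%:Z) l a) ->
  quasilocal_smoothing g a.
Proof.
by move=> H k l; have [ba da] := H k l; split=> //; exact: decays_quasilocal.
Qed.

Lemma quasilocal_smoothingP a : quasilocal_smoothing g a ->
  forall k l : nat, bounded_operator g (- k%:Z) l a /\ decays g (- k%:Z) l a.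
Proof. by move=> H k l; have [ba qa] := H k l; split=> //; exact: quasilocal_decays. Qed.

Lemma l2_smoothing0 : l2_smoothing g (0 : dsection E -> dsection E).
Proof.
exists 0; last by [].
apply: quasilocal_smoothing_intro => k l; split.
  apply: (@bounded_operator_intro _ _ _ _ _ _ _ _ _ 0); last 2 first.
  - by [].
  - by move=> u _; rewrite mul0r sobnorm_zero.
  - by move=> u _; exact: sobolev0.
  - by move=> z u v _ _; rewrite scaler0 addr0.
move=> e e0; exists 1; first exact: ltr01.
move=> rho _ L u _ _.
apply: le_trans (local_norm_le_sobnorm _ (sobolev0 g E l)) _.
by rewrite sobnorm_zero lee_fin mulr_ge0 ?sobnorm_ge0// ltW.
Qed.

Lemma l2_smoothingL (z : C) a b : l2_smoothing g a -> l2_smoothing g b ->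
  l2_smoothing g (z *: a + b).
Proof.
move=> [A qA Aa] [B qB Bb]; exists (z *: A + B); last first.
  by move=> u Su; have -> : (z *: A + B) u = z *: A u + B u by []; rewrite (Aa _ Su) (Bb _ Su).
apply: quasilocal_smoothing_intro => k l.
have [bA dA] := quasilocal_smoothingP qA k l; have [bB dB] := quasilocal_smoothingP qB k l.
by split; [exact: bounded_operatorL|exact: decaysL].
Qed.

Lemma l2_smoothing_comp a b : bounded_operator g 0 0 b -> l2_smoothing g a ->
  l2_smoothing g b -> l2_smoothing g (a \o b).
Proof.
move=> [bS _ _] [A qA Aa] [B qB Bb]; exists (A \o B); last first.
  by move=> u Su; rewrite /= (Bb _ Su) (Aa _ (bS _ Su)).
apply: quasilocal_smoothing_intro => k l.
have [bA dA] := quasilocal_smoothingP qA 0%N l.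
have [bB dB] := quasilocal_smoothingP qB k 0%N.
by split; [exact: bounded_operator_comp bB bA|exact: decays_comp bB bA dB dA].
Qed.

(** Since [a] and [c] are smoothing, only the boundedness of [b] on [L^2] matters
    for the product to be smoothing. It is quasilocal as the norm limit, from
    [H^-k] to [H^l], of the quasilocal products [(a \o b') \o c]. *)
Lemma l2_smoothing_sandwich a b c : l2_smoothing g a -> l2_smoothing g c ->
  bounded_operator g 0 0 b ->
  (forall e : R, 0 < e -> exists b', [/\ bounded_operator g 0 0 b', l2_smoothing g b' &
     forall u, S0 u -> sobnorm 0 (b u - b' u) <= e * sobnorm 0 u]) ->
  l2_smoothing g ((a \o b) \o c).
Proof.
move=> [A qA Aa] [K qK Kc] bb approx; exists ((A \o b) \o K); last first.
  move=> u Su; rewrite /= (Kc _ Su).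
  have cS : S0 (c u).
    by rewrite -(Kc _ Su); have [[KS _ _] _] := quasilocal_smoothingP qK 0%N 0%N; exact: KS.
  by have [bS _ _] := bb; rewrite (Aa _ (bS _ cS)).
apply: quasilocal_smoothing_intro => k l.
have [bA dA] := quasilocal_smoothingP qA 0%N l.
have [bK dK] := quasilocal_smoothingP qK k 0%N.
have bAb : bounded_operator g 0 l (A \o b) := bounded_operator_comp bb bA.
have bF : bounded_operator g (- k%:Z) l ((A \o b) \o K) := bounded_operator_comp bK bAb.
split=> //; apply: decays_limit; first by have [FS _ _] := bF.
move=> e e0.
have [x x0 Ax] := bounded_operatorP bA; have [y y0 Ky] := bounded_operatorP bK.
have xy0 : 0 < x * y + 1 by rewrite ltr_wpDl// mulr_ge0.
have [b' [bb' [B qB Bb'] bb'e]] := approx (e / (x * y + 1)) ltac:(by rewrite divr_gt0).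
have [bB dB] := quasilocal_smoothingP qB 0%N 0%N.
have bG := bounded_operator_comp bK (bounded_operator_comp bB bA).
exists ((A \o B) \o K); split.
- by have [GS _ _] := bG.
- apply: decays_comp bK (bounded_operator_comp bB bA) dK _.
  exact: decays_comp bB bA dB dA.
- move=> u Su; have [KS _ _] := bK; have KSu := KS u Su.
  have [bS _ _] := bb; have [b'S _ _] := bb'; have [_ AL _] := bA.
  have bKu := bS _ KSu; have b'Ku := b'S _ KSu.
  rewrite /= (Bb' _ KSu).
  have -> : A (b (K u)) - A (b' (K u)) = A (b (K u) - b' (K u)).
    have := AL (-1) _ _ b'Ku bKu.
    by rewrite !scaleN1r (addrC (- b' (K u))) (addrC (- A (b' (K u)))) => ->.
  apply: le_trans (Ax _ (sobolevB bKu b'Ku)) _.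
  apply: (@le_trans _ _ (x * (e / (x * y + 1) * (y * sobnorm (- k%:Z) u)))).
    rewrite ler_wpM2l//; apply: le_trans (bb'e _ KSu) _.
    by rewrite ler_wpM2l ?Ky// ltW// divr_gt0.
  have -> : x * (e / (x * y + 1) * (y * sobnorm (- k%:Z) u)) =
      e * (x * y / (x * y + 1)) * sobnorm (- k%:Z) u by ring.
  rewrite ler_wpM2r ?sobnorm_ge0// ger_pMr// ler_pdivrMr// mul1r.
  by rewrite lerDl.
Qed.

End Smoothing.

(** * The Sobolev space of order zero as a completion *)

Section SobolevZero.
Context {R : realType} {n : nat} {M : manifold R n} (g : riemannian M).
Context {r : nat} (E : hermitian_bundle M r).
Local Notation C := R[i].
Implicit Types (u v : dsection E) (phi : nat -> test E).
Local Notation lin := (@test_lin R n M r E).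
Local Notation p := (@test_pairing R n M g r E).
Local Notation pL := (@test_pairingL R n M g r E).
Local Notation pJ := (@test_pairingJ R n M g r E).
Local Notation p0 := (@test_pairing_ge0 R n M g r E).
Local Notation hnorm := (@hnorm R (test E) lin p).

Lemma presub_val (x y : test E) : sval (presub lin x y) = sval x - sval y.
Proof. by rewrite /= scaleN1r addrC. Qed.

Lemma approximates0P phi u : approximates g 0 phi u <-> represents lin p phi u.
Proof.
have E1 x y : test_norm g 0 (sval x - sval y)%R = (prenorm p (presub lin x y))%:E.
  by rewrite -presub_val test_norm0.
split=> -[C1 W1]; split.
- move=> e /C1[N NP]; exists N => i j Ni Nj.
  by have := NP i j Ni Nj; rewrite E1 lte_fin.
- by move=> x; apply/tends_toP; exact: W1.
- move=> e /C1[N NP]; exists N => i j Ni Nj.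
  by rewrite E1 lte_fin; exact: NP.
- by move=> x; apply/tends_toP; exact: W1.
Qed.

Lemma completion_conj_linear u : completion lin p u -> conj_linear u.
Proof.
move=> [phi [_ W1]] a x y z zE.
have pE w : p w z = (a^*)%C * p w x + p w y.
  rewrite -(pair_linr pL pJ).
  by rewrite /test_pairing zE.
apply: tends_to_uniq (W1 z) _.
have := tends_toL (a^*)%C (W1 x) (W1 y).
by move=> H e /H; apply: filterS => i; rewrite pE.
Qed.

Lemma completion_norm_hnorm phi u : represents lin p phi u ->
  test_norm g 0 (sval (phi i)) @[i --> \oo] --> (hnorm u)%:E.
Proof.
move=> ru; apply/fine_cvgP; split.
  by apply: nearW => i; rewrite test_norm0.
apply/cvgrPdist_lt => e e0.
have [N _ NP] := represents_cvg pL pJ p0 ru e0.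
exists N => // i Ni; rewrite /= test_norm0 /=.
have Hu : completion lin p u by exists phi.
have Hp : completion lin p (of_pre p (phi i)) := completion_of_pre pL pJ _.
rewrite -(hnorm_of_pre pL pJ p0).
apply: le_lt_trans (NP i Ni); rewrite distrC.
exact: (le_dist_hnorm pL pJ p0 Hp Hu).
Qed.

(** Along every sequence that approximates [u] the norms tend to [hnorm u], so
    that the infimum is over a single value. *)
Lemma completion_norm0E phi u : represents lin p phi u ->
  completion_norm g 0 u = (hnorm u)%:E.
Proof.
move=> ru; apply/eqP; rewrite eq_le; apply/andP; split.
  apply: ereal_inf_lbound; exists phi; first exact/approximates0P.
  exact: completion_norm_hnorm.
apply/ereal_infP => l [psi /approximates0P rpsi cl].
by rewrite (cvg_unique _ cl (completion_norm_hnorm rpsi)).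
Qed.

(** The test norm of order zero comes from the positive form [test_pairing], and
    the sequences that approximate [u] are those that represent it. *)
Lemma sobolev0_completion : sobolev g 0 = completion lin p.
Proof.
apply/seteqP; split=> u.
  move=> [_ /ereal_inf_lt[l [phi aphi _] _]]; exists phi.
  exact/approximates0P.
move=> Hu; split; first exact: completion_conj_linear.
have [phi ru] := Hu.
by rewrite /= (completion_norm0E ru) ltry.
Qed.

Lemma sobnorm0E u : sobolev g 0 u -> sobnorm g 0 u = hnorm u.
Proof.
by rewrite sobolev0_completion => -[phi ru]; rewrite /sobnorm /= (completion_norm0E ru).
Qed.

End SobolevZero.

(** * The algebra of quasilocal smoothing operators *)

Section UstarAlgebra.
Context {R : realType} {n : nat} {M : manifold R n} (g : riemannian M).
Context {r : nat} (E : hermitian_bundle M r).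
Local Notation C := R[i].
Implicit Types (u v w : dsection E) (A B S : dsection E -> dsection E).
Local Notation lin := (@test_lin R n M r E).
Local Notation p := (@test_pairing R n M g r E).
Local Notation pL := (@test_pairingL R n M g r E).
Local Notation pJ := (@test_pairingJ R n M g r E).
Local Notation p0 := (@test_pairing_ge0 R n M g r E).
Local Notation H := (sobolev g 0 : set (dsection E)).
Local Notation HE := (@sobolev0_completion R n M g r E).
Let hip (u v : dsection E) : C := @ip R (test E) lin p u v.
Let ev (u : dsection E) (x : test E) : C := u x.
Local Notation tst := (@of_test R n M g r E).
Local Notation hn := (ip_norm hip).

Lemma sobolev0_hilbert : hilbert_subspace H hip tst ev.
Proof.
split.
- exact: sobolev0.
- by move=> a u v; exact: sobolevL.
- by rewrite HE => x; exact: (completion_of_pre pL pJ).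
- by rewrite HE => a u v w; exact: (ipL pL pJ p0).
- by rewrite HE => u v; exact: (ipJ pL pJ p0).
- by rewrite HE => u x; exact: (ip_of_pre pL pJ p0).
- by move=> u v _ _ uv; apply/funext.
- by rewrite HE => u v; exact: (ip_cauchy_schwarz pL pJ p0).
- by rewrite HE => a u v; exact: (hnormL pL pJ p0).
- by rewrite HE => u; exact: (ip_hnorm pL pJ p0).
- by rewrite HE => u e; exact: (completion_dense pL pJ p0).
- by rewrite HE => u; exact: (completion_complete pL pJ p0).
Qed.
Local Notation hilb := sobolev0_hilbert.

Lemma sobnorm_ip_norm u : H u -> sobnorm g 0 u = hn u.
Proof. exact: sobnorm0E. Qed.

Local Notation bounded_op := (bounded_op H hip).
Local Notation op_norm := (op_norm H hip).

Lemma l2_operatorP A : l2_operator g A <-> bounded_op A.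
Proof.
split=> -[].
  move=> bA A0; have [AS AL _] := bA; have [b b0 Ab] := bounded_operatorP bA.
  split; [split; [exact: AS|exact: AL|]|exact: A0].
  by exists b => // u Su; rewrite -!sobnorm_ip_norm; [exact: Ab|exact: Su|exact: AS].
move=> [AS AL [b b0 Ab]] A0; split; last exact: A0.
apply: (bounded_operator_intro AS AL b0) => u Su.
by rewrite !sobnorm_ip_norm; [exact: Ab|exact: Su|exact: AS].
Qed.

Lemma opnormE A : bounded_op A -> opnorm g E A = op_norm A.
Proof.
move=> [[AS _ _] _]; congr inf.
have E1 b u : H u -> (sobolev_norm g 0 (A u) <= b%:E * sobolev_norm g 0 u)%E =
    (hn (A u) <= b * hn u).
  move=> Su; rewrite (sobnormE Su) (sobnormE (AS _ Su)) -EFinM lee_fin.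
  by rewrite !sobnorm_ip_norm; [|exact: Su|exact: AS].
apply/seteqP; split=> b [b0 Ab]; split; [exact: b0| |exact: b0|] => u Su.
- by rewrite -E1; [exact: Ab|exact: Su].
- by rewrite E1; [exact: Ab|exact: Su].
Qed.

Lemma adjointE : adjoint g E = op_adjoint H hip tst ev.
Proof.
apply/funext => A; rewrite /adjoint /op_adjoint; congr xget.
apply/seteqP; split=> S [bS AS]; split; [exact/l2_operatorP|exact: AS|exact/l2_operatorP|exact: AS].
Qed.

Local Notation L := (adjointable H hip tst ev).
Local Notation U := (Ustar g E).

Lemma Ustar_adjointable A : U A -> L A.
Proof.
by move=> [/l2_operatorP bA _ [S [/l2_operatorP bS AS _]]]; split; [exact: bA|exists S].
Qed.

Lemma UstarP A : U A -> [/\ bounded_op A, l2_smoothing g A, bounded_op (adjoint g E A),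
  adjoint_pair tst ev A (adjoint g E A) & l2_smoothing g (adjoint g E A)].
Proof.
move=> [/l2_operatorP bA sA [S [/l2_operatorP bS AS sS]]].
by rewrite adjointE (op_adjointE hilb bA bS AS).
Qed.

Lemma Ustar_intro A S : bounded_op A -> bounded_op S -> adjoint_pair tst ev A S -> l2_smoothing g A ->
  l2_smoothing g S -> U A.
Proof.
move=> bA bS AS sA sS; split; [exact/l2_operatorP|exact: sA|].
by exists S; split; [exact/l2_operatorP|exact: AS|exact: sS].
Qed.

Lemma Ustar0 : U 0.
Proof.
have b0 := bounded_op_zero hilb.
by apply: (Ustar_intro b0 b0); [exact: (adj_0 hilb)|exact: l2_smoothing0..].
Qed.

Lemma UstarL (c : C) A B : U A -> U B -> U (c *: A + B).
Proof.
move=> /UstarP[bA sA bS AS sS] /UstarP[bB sB bT BT sT].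
apply: (Ustar_intro (bounded_op_lin hilb c bA bB) (bounded_op_lin hilb (c^*)%C bS bT)).
- exact: (adjL hilb c bA bB bS bT AS BT).
- exact: l2_smoothingL.
- exact: l2_smoothingL.
Qed.

Lemma UstarM A B : U A -> U B -> U (A \o B).
Proof.
move=> /UstarP[bA sA bS AS sS] /UstarP[bB sB bT BT sT].
apply: (Ustar_intro (bounded_op_comp hilb bA bB) (bounded_op_comp hilb bT bS)).
- exact: (adj_comp hilb bA bB bS bT AS BT).
- by apply: (l2_smoothing_comp _ sA sB); have /l2_operatorP[] := bB.
- by apply: (l2_smoothing_comp _ sT sS); have /l2_operatorP[] := bS.
Qed.

Lemma Ustar_adjoint A : U A -> U (adjoint g E A).
Proof.
move=> /UstarP[bA sA bS AS sS].
exact: (Ustar_intro bS bA (adj_sym AS) sS sA).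
Qed.

Lemma op_norm_approximation A B (e : R) : bounded_op A -> bounded_op B -> op_norm (A - B) <= e ->
  forall u, H u -> sobnorm g 0 (A u - B u) <= e * sobnorm g 0 u.
Proof.
move=> bA bB AB u Su.
have bAB := bounded_op_sub hilb bA bB.
rewrite !sobnorm_ip_norm; [|exact: Su|].
  have := op_normP bAB Su.
  have -> : (A - B) u = A u - B u by [].
  by move/le_trans; apply; rewrite ler_wpM2r// sqrtr_ge0.
exact: (sobolevB (bounded_opH bA Su) (bounded_opH bB Su)).
Qed.

(** The adjoint of [(A \o B) \o K] is the sandwich of the adjoint of [B] between
    those of [K] and [A]; and the adjoints of operators approximating [B]
    approximate its adjoint, because adjunction is isometric. *)
Lemma Ustar_sandwich A B K : U A -> norm_closure (opnorm g E) L U B -> U K ->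
  U ((A \o B) \o K).
Proof.
move=> /UstarP[bA sA bSA ASA sSA] [LB BU] /UstarP[bK sK bSK KSK sSK].
have [bB _] := LB; have [bT BT] := op_adjointP hilb LB; set T := op_adjoint _ _ _ _ _ in bT BT.
have bAB := bounded_op_comp hilb bA bB; have bABK := bounded_op_comp hilb bAB bK.
have bTSA := bounded_op_comp hilb bT bSA.
have bKTA := bounded_op_comp hilb bSK bTSA.
have l0 F : bounded_op F -> bounded_operator g 0 0 F by move=> /l2_operatorP[].
have diff F G : bounded_op F -> bounded_op G -> bounded_op (F - G) := @bounded_op_sub _ _ _ _ _ _ _ hilb F G.
have approx (e : R) : 0 < e -> exists F, [/\ U F, op_norm (B - F) <= e &
    op_norm (T - adjoint g E F) <= e].
  move=> /BU[F UF BF]; exists F; have [bF _ bS FS _] := UstarP UF.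
  have BF' : op_norm (B - F) <= e by rewrite -(opnormE (diff _ _ bB bF)) ltW.
  split; [exact: UF|exact: BF'|]; suff -> : op_norm (T - adjoint g E F) = op_norm (B - F) by [].
  apply: (op_norm_adj hilb (diff _ _ bB bF) (diff _ _ bT bS)).
  have := adjL hilb (-1) bF bB bS bT FS BT.
  by rewrite rmorphN1 !scaleN1r (addrC (- F)) (addrC (- adjoint g E F)).
have E1 : adjoint g E K \o (T \o adjoint g E A) = (adjoint g E K \o T) \o adjoint g E A by [].
apply: (Ustar_intro bABK bKTA).
- exact: (adj_comp hilb bAB bK bTSA bSK (adj_comp hilb bA bB bSA bT ASA BT) KSK).
- apply: (l2_smoothing_sandwich sA sK (l0 _ bB)) => e /approx[F [UF BF _]].
  have [bF sF _ _ _] := UstarP UF.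
  by exists F; split; [exact: l0|exact: sF|exact: (op_norm_approximation bB bF BF)].
- rewrite E1; apply: (l2_smoothing_sandwich sSK sSA (l0 _ bT)) => e /approx[F [UF _ TF]].
  have [_ _ bS _ sS] := UstarP UF.
  by exists (adjoint g E F); split; [exact: l0|exact: sS|exact: (op_norm_approximation bT bS TF)].
Qed.

Lemma Ustar_local_Cstar :
  local_Cstar_algebra (fun A B => A \o B) (adjoint g E) (opnorm g E) U.
Proof.
have LN A B : L A -> L B -> bounded_op (A - B).
  by move=> [bA _] [bB _]; exact: (bounded_op_sub hilb bA bB).
apply: (@local_Cstar_sandwich _ _ _ _ _ L).
- rewrite adjointE; apply: (normed_star_algebra_norm (norm := op_norm)).
    exact: (adjointable_normed_star_algebra hilb).
  by move=> A [bA _]; exact: opnormE.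
- move=> A LA; have [bS _] := op_adjointP hilb LA; have [bA _] := LA.
  rewrite adjointE (opnormE (bounded_op_comp hilb bS bA)) (opnormE bA).
  exact: (adjointable_Cstar hilb LA).
- move=> A LA AC; have [|B LB AB] := adjointable_complete hilb LA.
    move=> e /AC[N NP]; exists N => i j Ni Nj.
    by rewrite -(opnormE (LN _ _ (LA i) (LA j))); exact: NP.
  exists B => //; apply: cvg_trans AB; apply: near_eq_cvg; apply: nearW => i.
  by rewrite (opnormE (LN _ _ (LA i) LB)).
- exact: Ustar_adjointable.
- exact: Ustar0.
- exact: UstarL.
- exact: UstarM.
- exact: Ustar_adjoint.
- exact: Ustar_sandwich.
Qed.

End UstarAlgebra.

Theorem lemma2p28 (R : realType) (n : nat) (M : manifold R n)
    (g : riemannian M) (r : nat) (E : hermitian_bundle M r)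
    (hM : bounded_geometry g) (hE : bounded_geometry_bundle g E) :
  local_Cstar_algebra
    (fun S T : dsection E -> dsection E => S \o T)
    (adjoint g E) (opnorm g E) (Ustar g E).
Proof. exact: Ustar_local_Cstar. Qed.
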